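(* (a) For any $X:=\{x_i\}_{i\in[n]}$ in $\mathbb{R}^d$, any $k,s,\ell\in\mathbb{N}$ (with $2\le k\le s$) and $\epsilon>0$, the random variable $B_H$ computed by the Hoeffding Monte Carlo procedure (see context) satisfies $\operatorname{IP}(X,k)\ge B_H$ with probability at least $1-\epsilon$ (probability over the procedure's randomness). (b) Let $\mu_1,\dots,\mu_k\in\mathbb{R}^d$ be arbitrary, draw $X:=\{x_i\}_{i\in[n]}$ independently from the Gaussian mixture $\mathsf{GMM}(\{(\mu_t,I_d,\frac1k)\}_{t\in[k]})$, let $s,\ell\in\mathbb{N}$, $\epsilon>0$, assume $n\ge s\ge d\ge k$, and compute $B_H$. If $s\ge 15d\log d$ and $\ell\ge 128(d+3\log n)^2\log(1/\epsilon)$, then \[B_H\ge \frac{d-6k-2}{d+1}\cdot\operatorname{IP}(X,k)\] with probability at least $1-\frac1n-e^{-\Omega(n/(d+\log n)^2)}-\epsilon$ (probability over both $X$ and the procedure), where $\Omega(\cdot)$ hides an absolute positive constant.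
   Context: For a tuple $Y=\{y_j\}_{j\in[m]}$ in $\mathbb{R}^d$ (repeats allowed), $m\ge k$: $\operatorname{IP}(Y,k):=\min_{\Gamma}\frac1m\sum_{S\in\Gamma}\sum_{j\in S}\|y_j-c_S\|^2$ over partitions $\Gamma$ of $[m]$ into $k$ nonempty sets, $c_S$ the mean of $\{y_j\}_{j\in S}$; $\operatorname{SDP}(Y,k):=\min\{\frac1{2m}\operatorname{tr}(D_YZ): Z\in\mathbb{R}^{m\times m}, Z\mathbf1=\mathbf1, \operatorname{tr}Z=k, Z\ge0 \text{ entrywise}, Z\succeq0\}$ where $(D_Y)_{ij}=\|y_i-y_j\|^2$. Deterministic $k$-means++ initialization: $i_1:=1$, and iteratively $i_{t+1}\in\arg\max_{i\in[n]}\min_{j\in[t]}\|x_i-x_{i_j}\|$ for $t<k$. Hoeffding Monte Carlo procedure: run deterministic $k$-means++ initialization and set $b:=\max_{i\in[n]}\min_{j\in[k]}\|x_i-x_{i_j}\|^2$; draw $Y_1,\dots,Y_\ell$ independently, each consisting of $s$ points drawn uniformly from $X$ with replacement; output $B_H:=\frac1\ell\sum_{i\in[\ell]}\operatorname{SDP}(Y_i,k)-\big(\frac{b^2}{2\ell}\log\frac1\epsilon\big)^{1/2}$. $x\sim\mathsf{GMM}(\{(\mu_t,I_d,\frac1k)\}_{t\in[k]})$ means: draw $T$ uniformly from $[k]$, then $x\sim\mathsf N(\mu_T,I_d)$. Logarithms are natural. *)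

(* Defs.v *)
From HB Require Import structures.
From mathcomp Require Import all_boot all_order all_algebra.
From mathcomp Require Import all_classical all_reals all_analysis.

Set Implicit Arguments.
Unset Strict Implicit.
Unset Printing Implicit Defensive.

Import Order.TTheory GRing.Theory Num.Theory.

Local Open Scope classical_set_scope.
Local Open Scope ring_scope.

Section Defs.
Variable R : realType.

Definition sqnorm (d : nat) (v : 'rV[R]_d) : R := \sum_(j < d) (v 0 j) ^+ 2.
Definition dist (d : nat) (x y : 'rV[R]_d) : R := Num.sqrt (sqnorm (x - y)).

Definition cmean (d m : nat) (Y : 'I_m -> 'rV[R]_d) (S : {set 'I_m}) : 'rV[R]_d :=
  (#|S|%:R)^-1 *: \sum_(j in S) Y j.

Definition IPcost (d m : nat) (Y : 'I_m -> 'rV[R]_d) (G : {set {set 'I_m}}) : R :=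
  (m%:R)^-1 * \sum_(S in G) \sum_(j in S) sqnorm (Y j - cmean Y S).

(* IP(Y,k): minimum over partitions of [m] into k nonempty sets
   (finset's [partition G setT] includes that the blocks are nonempty) *)
Definition IP (d m : nat) (Y : 'I_m -> 'rV[R]_d) (k : nat) : R :=
  inf [set IPcost Y G | G in
        [set G : {set {set 'I_m}} | finset.partition G [set: 'I_m]%SET /\ #|G| = k]].

Definition Dmat (d m : nat) (Y : 'I_m -> 'rV[R]_d) : 'M[R]_m :=
  \matrix_(i, j) sqnorm (Y i - Y j).

Definition psd (m : nat) (Z : 'M[R]_m) : Prop :=
  Z^T = Z /\ forall v : 'cV[R]_m, 0 <= (v^T *m Z *m v) 0 0.

Definition sdp_feasible (m k : nat) (Z : 'M[R]_m) : Prop :=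
  [/\ Z *m (const_mx 1 : 'cV[R]_m) = const_mx 1, \tr Z = k%:R,
      (forall i j, 0 <= Z i j) & psd Z].

Definition SDP (d m : nat) (Y : 'I_m -> 'rV[R]_d) (k : nat) : R :=
  inf [set ((2 * m%:R)^-1 * \tr (Dmat Y *m Z)) | Z in [set Z | sdp_feasible k Z]].

(* min_{j in [t]} ||x - x_{i_j}||, centers indexed from 0 *)
Definition mindist (d n k : nat) (X : 'I_n -> 'rV[R]_d) (c : 'I_k -> 'I_n)
    (t : nat) (x : 'rV[R]_d) : R :=
  inf [set dist x (X (c j)) | j in [set j : 'I_k | (j < t)%N]].

(* c is a valid run of deterministic k-means++ initialization on X:
   c_0 is the first point (index 1 in the paper, 0 here), and each later
   center maximizes the distance to the previously chosen centers
   (any maximizer is allowed: ties are broken arbitrarily). *)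
Definition kpp_run (d n k : nat) (X : 'I_n -> 'rV[R]_d) (c : 'I_k -> 'I_n) : Prop :=
  (forall t : 'I_k, val t = 0%N -> val (c t) = 0%N) /\
  (forall t : 'I_k, (0 < t)%N ->
     forall i : 'I_n, mindist X c t (X i) <= mindist X c t (X (c t))).

Definition kpp_b (d n k : nat) (X : 'I_n -> 'rV[R]_d) (c : 'I_k -> 'I_n) : R :=
  sup [set (mindist X c k (X i)) ^+ 2 | i in [set: 'I_n]].

(* B_H, given the k-means++ centers c and the subsample indices J:
   Y_i = (x_{J(i,j)})_{j in [s]}, i in [l], drawn uniformly with replacement *)
Definition BH (d n k s l : nat) (X : 'I_n -> 'rV[R]_d) (c : 'I_k -> 'I_n)
    (eps : R) (J : {ffun 'I_l * 'I_s -> 'I_n}) : R :=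
  (l%:R)^-1 * \sum_(i < l) SDP (fun j : 'I_s => X (J (i, j))) k
  - Num.sqrt ((kpp_b X c) ^+ 2 / (2 * l%:R) * ln (eps^-1)).

Definition proc_prob (n s l : nat) (E : {ffun 'I_l * 'I_s -> 'I_n} -> bool) : R :=
  #|[set J : {ffun 'I_l * 'I_s -> 'I_n} | E J]|%:R /
  #|{: {ffun 'I_l * 'I_s -> 'I_n}}|%:R.

(* On the probability space P, the labels T i (uniform in [k]) and the
   coordinates Z i j (standard normal) are random variables that are mutually
   independent: their joint law is the product of the marginal laws. *)
Definition gmm_noise (dsp : measure_display) (Omega : measurableType dsp)
    (P : probability Omega R) (n d k : nat)
    (T : 'I_n -> Omega -> 'I_k) (Z : 'I_n -> 'I_d -> Omega -> R) : Prop :=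
  [/\ (forall i t, measurable (T i @^-1` [set t])),
      (forall i j, measurable_fun setT (Z i j)) &
      (forall (L : 'I_n -> {set 'I_k}) (B : 'I_n -> 'I_d -> set R),
         (forall i j, measurable (B i j)) ->
         P (\bigcap_(i in [set: 'I_n])
              ([set w | T i w \in L i] `&`
               \bigcap_(j in [set: 'I_d]) (Z i j @^-1` B i j))) =
         (\prod_(i < n) ((#|L i|%:R / k%:R)%:E *
                         \prod_(j < d) normal_prob 0 1 (B i j)))%E)].

(* the sample x_i = mu_{T_i} + z_i, so x_i ~ GMM({(mu_t, I_d, 1/k)}) i.i.d. *)
Definition gmm_X (dsp : measure_display) (Omega : measurableType dsp)
    (n d k : nat) (mu : 'I_k -> 'rV[R]_d)
    (T : 'I_n -> Omega -> 'I_k) (Z : 'I_n -> 'I_d -> Omega -> R)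
    (w : Omega) : 'I_n -> 'rV[R]_d :=
  fun i => mu (T i w) + \row_j Z i j w.

End Defs.
Arguments proc_prob {R} n s l E.
Arguments BH {R d n k} s {l} X c eps J.

(* Main.v *)
(* Part (a): the SDP of a subsample is bounded by the assignment cost of the subsample, so its mean
   is at most IP(X,k); the SDP values lie in [0,b], and Hoeffding's inequality concludes.

   Part (b): write x_i = mu_(T_i) + g_i and let S be the mean of SDP(Y,k) over subsamples Y.  On an
   event where every |g_i|^2 is at most 2(d + 3 log n), the greedy centers give b <= 8(d + 3 log n),
   the radius in B_H is at most 1/2, and B_H >= S - 1 with probability 1 - eps by Hoeffding.
   It remains to bound S from below by 1 + (d-6k-2)/(d+1) IP(X,k).
   If d >= 6k+2: projecting off the span of the centers gives
   SDP(Y,k) >= (|G_Y|^2 - 2k |G_Y|_op^2)/s for the noise matrix G_Y of the subsample.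
   Splitting Y into the level sets of its multiplicities, and estimating the operator norm over
   random subsets with a net of lattice points, the mean of |G_Y|_op^2 is at most 3s, so that
   S >= |G|^2/n - 6k, while IP(X,k) <= |G|^2/n and |G|^2/n is within 1 of d.
   If d < 6k+2: the right-hand side is 1 minus a nonnegative multiple of IP(X,k) >= S, and it suffices that
   S >= (d+1)/(6k+3).  This follows from S >= 2(1 - sqrt p), where p is k times the mean of
   exp(-|y-y'|^2/2) over two points of a subsample, which is about 3^(-d/2) at most.
   All the failure events are controlled by exponential moments that are Gaussian integrals of
   quadratic forms.  When n < K(d + log n) for a large constant K the probability bound is void. *)

Require Import Defs.
From HB Require Import structures.
From mathcomp Require Import all_boot all_order all_algebra.
From mathcomp Require Import all_classical all_reals all_analysis.
From mathcomp Require Import fingroup perm measurable_realfun ring lra.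

Set Implicit Arguments.
Unset Strict Implicit.
Unset Printing Implicit Defensive.

Import Order.TTheory GRing.Theory Num.Theory.
Import numFieldNormedType.Exports.
Local Open Scope classical_set_scope.
Local Open Scope ring_scope.

(** * Gram-Schmidt and positive semidefinite matrices *)

(** Given the labels, essentially one kind of integral is computed: the Gaussian integral of the
    exponential of a sum of squares of affine forms in disjoint groups of coordinates, done one
    coordinate at a time. This dictates the statistics: the norm of a noise matrix enters through a
    finite sum of exponentials over lattice points, and the kernel of two points through products of
    [1 + x * kern], which expand into such exponentials. The averages needed in part (b) run over
    all subsets of a given size, or all pairs, of one fixed sample, so their summands are dependent.
    Hoeffding's device for U-statistics removes the dependence: such an average is an average over
    permutations of a mean over disjoint blocks, Jensen moves the exponential inside, and disjoint
    blocks are independent. The greedy run may break ties in any way, so the integrand of (b) is not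
    known to be measurable. The failure event of labels and noise is measurable, and the integral is
    bounded below through simple functions. *)

Section dotv.
Variables (R : realType) (d : nat).
Implicit Types u v w : 'rV[R]_d.

Definition dotv u v : R := \sum_j u 0 j * v 0 j.

Lemma dotvv v : dotv v v = sqnorm v.
Proof. by apply: eq_bigr => j _; rewrite expr2. Qed.

Lemma dotvC u v : dotv u v = dotv v u.
Proof. by apply: eq_bigr => j _; rewrite mulrC. Qed.

Lemma dotvDl u v w : dotv (u + v) w = dotv u w + dotv v w.
Proof. by rewrite -big_split; apply: eq_bigr => j _; rewrite mxE mulrDl. Qed.

Lemma dotvZl (a : R) u v : dotv (a *: u) v = a * dotv u v.
Proof. by rewrite mulr_sumr; apply: eq_bigr => j _; rewrite mxE mulrA. Qed.

Lemma dotv0l v : dotv 0 v = 0.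
Proof. by rewrite /dotv big1// => j _; rewrite mxE mul0r. Qed.

Lemma dotvDr u v w : dotv u (v + w) = dotv u v + dotv u w.
Proof. by rewrite dotvC dotvDl !(dotvC u). Qed.

Lemma dotvZr (a : R) u v : dotv u (a *: v) = a * dotv u v.
Proof. by rewrite dotvC dotvZl dotvC. Qed.

Lemma dotvNl u v : dotv (- u) v = - dotv u v.
Proof. by rewrite -scaleN1r dotvZl mulN1r. Qed.

Lemma dotvNr u v : dotv u (- v) = - dotv u v.
Proof. by rewrite dotvC dotvNl dotvC. Qed.

Lemma dotv_suml (J : Type) (r : seq J) (P : pred J) (F : J -> 'rV[R]_d) v :
  dotv (\sum_(j <- r | P j) F j) v = \sum_(j <- r | P j) dotv (F j) v.
Proof. by apply: (big_morph (fun u => dotv u v)) => [x y|]; rewrite ?dotvDl ?dotv0l. Qed.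

Lemma sqnorm_ge0 v : 0 <= sqnorm v.
Proof. by apply: sumr_ge0 => j _; exact: sqr_ge0. Qed.

Lemma sqnorm0 : sqnorm (0 : 'rV[R]_d) = 0.
Proof. by rewrite -dotvv dotv0l. Qed.

Lemma sqnorm_eq0 v : sqnorm v = 0 -> v = 0.
Proof.
move=> /eqP; rewrite psumr_eq0 => [/allP h|j _]; last exact: sqr_ge0.
by apply/rowP => j; have := h j (mem_index_enum j); rewrite mxE sqrf_eq0 => /eqP.
Qed.

Lemma sqnormD u v : sqnorm (u + v) = sqnorm u + 2 * dotv u v + sqnorm v.
Proof. by rewrite -!dotvv !dotvDl !dotvDr (dotvC v u); ring. Qed.

Lemma sqnormN v : sqnorm (- v) = sqnorm v.
Proof. by rewrite -!dotvv dotvNl dotvNr opprK. Qed.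

Lemma sqnormB u v : sqnorm (u - v) = sqnorm u - 2 * dotv u v + sqnorm v.
Proof. by rewrite sqnormD sqnormN dotvNr; ring. Qed.

Lemma sqnormZ (a : R) v : sqnorm (a *: v) = a ^+ 2 * sqnorm v.
Proof. by rewrite -!dotvv dotvZl dotvZr; ring. Qed.
End dotv.

Lemma cauchy_schwarz_sum (R : realType) (J : finType) (a b : J -> R) :
  (\sum_j a j * b j) ^+ 2 <= (\sum_j a j ^+ 2) * (\sum_j b j ^+ 2).
Proof.
set A := \sum_j a j ^+ 2; set B := \sum_j b j ^+ 2; set c := \sum_j _.
have B0 : 0 <= B by apply: sumr_ge0 => j _; exact: sqr_ge0.
have [B00|Bn] := eqVneq B 0.
  suff -> : c = 0 by rewrite B00 mulr0 expr0n.
  rewrite /c big1// => j _.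
  have /eqP : B == 0 by rewrite B00.
  move=> /eqP; rewrite psumr_eq0 => [/allP h|i _]; last exact: sqr_ge0.
  by have := h j (mem_index_enum j); rewrite sqrf_eq0 => /eqP ->; rewrite mulr0.
have : 0 <= \sum_j (a j * B - b j * c) ^+ 2.
  by apply: sumr_ge0 => j _; exact: sqr_ge0.
have -> : \sum_j (a j * B - b j * c) ^+ 2 = B * (A * B - c ^+ 2).
  transitivity (\sum_j (a j ^+ 2 * B ^+ 2 +
    (a j * b j * (- 2 * B * c) + b j ^+ 2 * c ^+ 2))).
    by apply: eq_bigr => j _; ring.
  rewrite !big_split/= -!mulr_suml -/A -/B -/c; ring.
by rewrite pmulr_rge0 ?subr_ge0// lt_neqAle eq_sym Bn.
Qed.

Section gram_schmidt.
Variables (R : realType) (d : nat).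
Implicit Types (v : 'rV[R]_d) (es : seq 'rV[R]_d).

(** Orthogonal projection off the span of [es] once [es] is orthonormal; as a plain formula it is
    linear for every list. *)
Definition projc es v := v - \sum_(e <- es) dotv v e *: e.

Lemma projcB es u v : projc es (u - v) = projc es u - projc es v.
Proof.
have -> : projc es (u - v) = (u - v) - (\sum_(e <- es) dotv u e *: e - \sum_(e <- es) dotv v e *: e).
  rewrite /projc; congr (_ - _); rewrite -sumrB; apply: eq_bigr => e _.
  by rewrite dotvDl dotvNl scalerDl scaleNr.
by rewrite /projc !opprB addrACA [RHS]addrACA; congr (_ + _); rewrite addrC.
Qed.

Lemma projc_sum es (J : finType) (w : J -> R) (g : J -> 'rV[R]_d) :
  projc es (\sum_j w j *: g j) = \sum_j w j *: projc es (g j).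
Proof.
rewrite /projc; under [RHS]eq_bigr do rewrite scalerBr scaler_sumr.
rewrite sumrB; congr (_ - _); rewrite exchange_big/=; apply: eq_bigr => e _.
rewrite dotv_suml scaler_suml; apply: eq_bigr => j _.
by rewrite dotvZl scalerA.
Qed.

Lemma gram_schmidt (ms : seq 'rV[R]_d) : exists es,
  [/\ (size es <= size ms)%N, (forall e, e \in es -> sqnorm e = 1),
      (forall v, sqnorm (projc es v) = sqnorm v - \sum_(e <- es) dotv v e ^+ 2) &
      (forall m, m \in ms -> projc es m = 0)].
Proof.
(* The added clause, residuals orthogonal to every [e], makes the new unit vector orthogonal to the
   old ones; it is dropped after the induction. *)
suff [es [h1 h2 h3 h4 _]] : exists es,
  [/\ (size es <= size ms)%N, (forall e, e \in es -> sqnorm e = 1),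
      (forall v, sqnorm (projc es v) = sqnorm v - \sum_(e <- es) dotv v e ^+ 2),
      (forall m, m \in ms -> projc es m = 0) &
      (forall v e, e \in es -> dotv (projc es v) e = 0)] by exists es.
elim: ms => [|m ms [es [s1 n1 q1 z1 o1]]].
  by exists [::]; split => // v; rewrite /projc !big_nil !subr0.
have [u0|un0] := eqVneq (projc es m) 0.
  exists es; split => // [|m']; first exact: leqW.
  by rewrite inE => /orP[/eqP ->|/z1].
set u := projc es m in un0.
have su : 0 < sqnorm u.
  rewrite lt_neqAle sqnorm_ge0 andbT eq_sym; apply: contra un0 => /eqP.
  by move=> /sqnorm_eq0 ->.
pose nu := Num.sqrt (sqnorm u); have nu0 : 0 < nu by rewrite sqrtr_gt0.
have nuE : nu ^+ 2 = sqnorm u by rewrite sqr_sqrtr// ltW.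
pose e := nu^-1 *: u.
have e1 : sqnorm e = 1 by rewrite sqnormZ exprVn nuE mulVf// gt_eqF.
have oe e' : e' \in es -> dotv e' e = 0.
  by move=> h; rewrite dotvC dotvZl o1// mulr0.
have QE v : projc (e :: es) v = projc es v - dotv v e *: e.
  by rewrite /projc big_cons opprD addrA addrAC.
have Qe v : dotv (projc es v) e = dotv v e.
  rewrite /projc dotvDl dotvNl dotv_suml big_seq big1 ?subr0// => e' /oe h.
  by rewrite dotvZl h mulr0.
exists (e :: es); split => //.
- by move=> e'; rewrite inE => /orP[/eqP ->|/n1].
- move=> v; rewrite QE sqnormB q1 sqnormZ e1 dotvZr Qe big_cons; ring.
- move=> m'; rewrite inE => /orP[/eqP ->|/z1 h]; rewrite QE.
    rewrite -Qe -/u /e dotvZr dotvv scalerA -nuE.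
    by rewrite [X in X *: _](_ : _ = 1) ?scale1r ?subrr//; field; rewrite gt_eqF.
  by rewrite -Qe h dotv0l scale0r subrr.
- move=> v e'; rewrite inE QE dotvDl dotvNl dotvZl => /orP[/eqP ->|h].
    by rewrite Qe dotvv e1 mulr1 subrr.
  by rewrite o1// [dotv e e']dotvC (oe _ h) mulr0 subrr.
Qed.
End gram_schmidt.

Section psd.
Variables (R : realType) (m : nat).
Implicit Types (Z : 'M[R]_m) (u v w : 'cV[R]_m).

Definition qf Z u v : R := (u^T *m Z *m v) 0 0.

Lemma qfE Z u v : qf Z u v = \sum_i \sum_j Z i j * u i 0 * v j 0.
Proof.
rewrite /qf mxE exchange_big/=; apply: eq_bigr => j _.
rewrite mxE mulr_suml; apply: eq_bigr => i _; rewrite !mxE; ring.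
Qed.

Lemma qfDl Z u v w : qf Z (u + v) w = qf Z u w + qf Z v w.
Proof. by rewrite /qf linearD/= !mulmxDl mxE. Qed.
Lemma qfDr Z u v w : qf Z w (u + v) = qf Z w u + qf Z w v.
Proof. by rewrite /qf mulmxDr mxE. Qed.
Lemma qfZl Z (a : R) u v : qf Z (a *: u) v = a * qf Z u v.
Proof. by rewrite /qf linearZ/= -!scalemxAl mxE. Qed.
Lemma qfZr Z (a : R) u v : qf Z u (a *: v) = a * qf Z u v.
Proof. by rewrite /qf -scalemxAr mxE. Qed.
Lemma qf_deltal Z i v : qf Z (delta_mx i 0) v = (Z *m v) i 0.
Proof. by rewrite /qf trmx_delta -mulmxA -rowE mxE. Qed.
Lemma qf_sym Z u v : Z^T = Z -> qf Z u v = qf Z v u.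
Proof.
move=> ZT; rewrite /qf -[in LHS](trmxK (u^T *m Z *m v)) mxE.
by rewrite !trmx_mul trmxK ZT mulmxA.
Qed.
Lemma qf_delta Z i j : qf Z (delta_mx i 0) (delta_mx j 0) = Z i j.
Proof. by rewrite qf_deltal -colE mxE. Qed.

(** Cholesky elimination in place of diagonalisation: subtracting the rank-one matrix of row [i]
    divided by [sqrt (Z i i)] leaves a Schur complement, again positive semidefinite, with fewer
    nonzero diagonal entries. *)
Lemma psd_decomp Z : psd Z ->
  exists ws : seq 'cV[R]_m, forall i j, Z i j = \sum_(w <- ws) w i 0 * w j 0.
Proof.
have [N leN] := ubnP #|[set i | Z i i != 0]%SET|.
elim: N => // N IH in Z leN * => -[ZT Zge].
have q0 v : 0 <= qf Z v v by exact: Zge.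
have Zij i j : Z i j = Z j i by rewrite -[in LHS]ZT mxE.
have dge i : 0 <= Z i i by rewrite -qf_delta.
case: (pickP (fun i => Z i i != 0)) => [i Zi|all0]; last first.
  exists [::] => i j; rewrite big_nil.
  have /eqP di := all0 i; have /eqP dj := all0 j.
  (* With zero diagonal entries this vector has value [- 2 * Z i j ^+ 2], so nonnegativity kills the
     entry. *)
  have := q0 (- Z i j *: delta_mx i 0 + delta_mx j 0).
  rewrite !qfDl !qfDr !qfZl !qfZr !qf_delta (Zij j i).
  move: (negbFE (all0 i)) (negbFE (all0 j)) => /eqP -> /eqP -> h.
  by apply/eqP; rewrite -sqrf_eq0 eq_le sqr_ge0 andbT; nra.
have Zi0 : 0 < Z i i by rewrite lt_neqAle eq_sym Zi dge.
pose w : 'cV[R]_m := \col_j (Z i j / Num.sqrt (Z i i)).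
pose Z' := Z - w *m w^T.
have wE a b : w a 0 * w b 0 = Z i a * Z i b / Z i i.
  rewrite !mxE mulrACA -invfM -expr2 sqr_sqrtr ?ltW//.
have Z'E a b : Z' a b = Z a b - w a 0 * w b 0.
  by rewrite !mxE big_ord1 !mxE.
have Z'psd : psd Z'.
  split.
    by apply/matrixP => a b; rewrite mxE !Z'E Zij mulrC.
  move=> v; rewrite -/(qf Z' v v).
  (* The shift along coordinate [i] that minimises the form of [Z]; the minimum is the value of the
     Schur complement at [v]. *)
  pose t := - (Z *m v) i 0 / Z i i.
  have -> : qf Z' v v = qf Z (v + t *: delta_mx i 0) (v + t *: delta_mx i 0).
    have -> : qf Z' v v = qf Z v v - (\sum_a w a 0 * v a 0) ^+ 2.
      rewrite !qfE expr2 mulr_suml -sumrB; apply: eq_bigr => a _.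
      rewrite mulr_sumr -sumrB; apply: eq_bigr => b _; rewrite Z'E; ring.
    have -> : \sum_a w a 0 * v a 0 = (Z *m v) i 0 / Num.sqrt (Z i i).
      rewrite mxE mulr_suml; apply: eq_bigr => a _; rewrite !mxE; ring.
    rewrite expr_div_n sqr_sqrtr ?ltW// !qfDl !qfDr !qfZl !qfZr qf_delta.
    rewrite (qf_sym v)// qf_deltal /t; field.
    by rewrite gt_eqF.
  exact: q0.
have [|ws wsE] := IH Z' _ Z'psd.
  rewrite -ltnS; apply: leq_trans leN; rewrite ltnS; apply: proper_card.
  apply/properP; split.
    apply/fintype.subsetP => a; rewrite !inE; apply: contra => /eqP a0.
    have : 0 <= Z' a a by rewrite -qf_delta; exact: (proj2 Z'psd).
    rewrite Z'E wE a0 sub0r oppr_ge0 => h; rewrite oppr_eq0.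
    by rewrite eq_le h divr_ge0// ?dge// -expr2 sqr_ge0.
  exists i; rewrite !inE ?Zi// negbK Z'E wE mulfK ?subrr//.
exists (w :: ws) => a b; rewrite big_cons -wsE Z'E; ring.
Qed.

Lemma psd_dotv_ge0 d Z (a : 'I_m -> 'rV[R]_d) : psd Z ->
  0 <= \sum_i \sum_j Z i j * dotv (a i) (a j).
Proof.
move=> [_ Zge].
rewrite (_ : \sum_i _ = \sum_l qf Z (\col_i a i 0 l) (\col_i a i 0 l)).
  by apply: sumr_ge0 => l _; exact: Zge.
under [RHS]eq_bigr do rewrite qfE.
rewrite [RHS]exchange_big/=; apply: eq_bigr => i _.
rewrite [RHS]exchange_big/=; apply: eq_bigr => j _.
by rewrite mulr_sumr; apply: eq_bigr => l _; rewrite !mxE mulrA.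
Qed.
End psd.

(** * Bounds on the semidefinite program *)

Section sdp.
Variable R : realType.

Section feasible.
Variables (s k : nat) (Z : 'M[R]_s).
Hypothesis ZF : sdp_feasible k Z.

Lemma sdp_rowsum i : \sum_j Z i j = 1.
Proof.
case: ZF => /matrixP /(_ i 0) + _ _ _; rewrite !mxE => <-.
by apply: eq_bigr => j _; rewrite mxE mulr1.
Qed.

Lemma sdp_sym i j : Z i j = Z j i.
Proof. by case: ZF => _ _ _ [ZT _]; rewrite -[in LHS]ZT mxE. Qed.

Lemma sdp_quad_form d (a : 'I_s -> 'rV[R]_d) :
  \sum_i \sum_j sqnorm (a i - a j) * Z i j =
  2 * \sum_i sqnorm (a i) - 2 * \sum_i \sum_j Z i j * dotv (a i) (a j).
Proof.
transitivity (\sum_i \sum_j (Z i j * sqnorm (a i)) +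
  \sum_i \sum_j (Z i j * sqnorm (a j)) - 2 * \sum_i \sum_j Z i j * dotv (a i) (a j)).
  rewrite mulr_sumr -big_split/= -sumrB; apply: eq_bigr => i _.
  rewrite mulr_sumr -big_split/= -sumrB; apply: eq_bigr => j _.
  by rewrite sqnormB; ring.
congr (_ - _); rewrite [X in _ + X]exchange_big/=.
have -> : \sum_j \sum_i Z i j * sqnorm (a j) = \sum_i sqnorm (a i).
  apply: eq_bigr => j _; under eq_bigr do rewrite sdp_sym.
  by rewrite -mulr_suml sdp_rowsum mul1r.
under eq_bigr do rewrite -mulr_suml sdp_rowsum mul1r.
ring.
Qed.

(** [Z] is symmetric and nonnegative with row sums 1, so [w^T Z w <= |w|^2] by the
    arithmetic-geometric mean inequality; summed over the rank-one pieces of [Z] this is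
    [tr (Z^2) <= tr Z = k]. *)
Lemma sdp_sum_sqr : \sum_i \sum_j Z i j ^+ 2 <= k%:R.
Proof.
case: (ZF) => _ trZ Z0 Zpsd; have [ws wsE] := psd_decomp Zpsd.
have -> : \sum_i \sum_j Z i j ^+ 2 =
    \sum_(w <- ws) \sum_i \sum_j Z i j * (w i 0 * w j 0).
  rewrite [RHS]exchange_big/=; apply: eq_bigr => i _.
  rewrite [RHS]exchange_big/=; apply: eq_bigr => j _.
  by rewrite -mulr_sumr -wsE expr2.
have -> : k%:R = \sum_(w <- ws) \sum_i w i 0 ^+ 2.
  rewrite -trZ exchange_big/=; apply: eq_bigr => i _; rewrite wsE.
  by apply: eq_bigr => w _; rewrite expr2.
apply: ler_sum => w _.
apply: (@le_trans _ _ (\sum_i \sum_j (Z i j * (w i 0 ^+ 2 / 2) + Z i j * (w j 0 ^+ 2 / 2)))).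
  apply: ler_sum => i _; apply: ler_sum => j _.
  rewrite -mulrDr ler_wpM2l//.
  have := sqr_ge0 (w i 0 - w j 0); nra.
under eq_bigr do rewrite big_split/=.
rewrite big_split/= [X in _ + X]exchange_big/=.
under eq_bigr do rewrite -mulr_suml sdp_rowsum mul1r.
under [X in _ + X]eq_bigr => j _.
  under eq_bigr do rewrite sdp_sym.
  rewrite -mulr_suml sdp_rowsum mul1r; over.
by rewrite -big_split/= le_eqVlt; apply/orP; left; apply/eqP/eq_bigr => i _; field.
Qed.

(** [Z] splits into pieces [w w^T] of total squared norm [k], and each contributes the squared norm
    of a projected combination of the [g i]. The hypothesis tests the noise against vectors [v], so
    it is moved to coefficients [w] by duality of the operator norm. *)
Lemma sdp_quad_le d (g : 'I_s -> 'rV[R]_d) (es : seq 'rV[R]_d) (lam : R) :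
  0 <= lam -> (forall v, \sum_i dotv (g i) v ^+ 2 <= lam * sqnorm v) ->
  (forall v, sqnorm (projc es v) <= sqnorm v) ->
  \sum_i \sum_j Z i j * dotv (projc es (g i)) (projc es (g j)) <= k%:R * lam.
Proof.
move=> lam0 glam Q1; case: (ZF) => _ trZ Z0 Zpsd; have [ws wsE] := psd_decomp Zpsd.
have -> : \sum_i \sum_j Z i j * dotv (projc es (g i)) (projc es (g j)) =
    \sum_(w <- ws) sqnorm (projc es (\sum_i w i 0 *: g i)).
  rewrite [RHS](eq_bigr (fun w : 'cV[R]_s => \sum_i \sum_j w i 0 * w j 0 *
      dotv (projc es (g i)) (projc es (g j)))); last first.
    move=> w _; rewrite projc_sum -dotvv dotv_suml; apply: eq_bigr => i _.
    rewrite dotvC dotv_suml; apply: eq_bigr => j _.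
    by rewrite dotvZl dotvZr [dotv (projc es (g j)) _]dotvC; ring.
  rewrite [RHS]exchange_big/=; apply: eq_bigr => i _.
  rewrite [RHS]exchange_big/=; apply: eq_bigr => j _.
  by rewrite -mulr_suml -wsE.
have -> : k%:R = \sum_(w <- ws) \sum_i w i 0 ^+ 2.
  rewrite -trZ exchange_big/=; apply: eq_bigr => i _; rewrite wsE.
  by apply: eq_bigr => w _; rewrite expr2.
rewrite mulr_suml; apply: ler_sum => w _; apply: le_trans (Q1 _) _.
set u := \sum_i _.
have [u0|un] := eqVneq (sqnorm u) 0.
  by rewrite u0 mulr_ge0//; apply: sumr_ge0 => i _; exact: sqr_ge0.
have up : 0 < sqnorm u by rewrite lt_neqAle sqnorm_ge0 eq_sym un.
rewrite -(ler_pM2r up) -expr2.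
have -> : sqnorm u = \sum_i w i 0 * dotv (g i) u.
  by rewrite -dotvv {1}/u dotv_suml; apply: eq_bigr => i _; rewrite dotvZl.
apply: le_trans (cauchy_schwarz_sum _ _) _.
have -> : \sum_i w i 0 * dotv (g i) u = sqnorm u.
  by rewrite -dotvv {2}/u dotv_suml; apply: eq_bigr => i _; rewrite dotvZl.
by rewrite -mulrA ler_wpM2l//; apply: sumr_ge0 => i _; exact: sqr_ge0.
Qed.
End feasible.

Lemma trace_DmatE d s (Y : 'I_s -> 'rV[R]_d) (Z : 'M[R]_s) : Z^T = Z ->
  \tr (Dmat Y *m Z) = \sum_i \sum_j sqnorm (Y i - Y j) * Z i j.
Proof.
move=> ZT; rewrite /mxtrace; apply: eq_bigr => i _; rewrite mxE.
by apply: eq_bigr => j _; rewrite mxE -[in LHS]ZT mxE.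
Qed.

Section assign.
Variables (s : nat) (L : finType) (p : 'I_s -> L).
Let c l : R := #|[set i | p i == l]%SET|%:R.
(** Orthogonal projection onto the vectors constant on the fibres of [p], hence positive
    semidefinite with trace the number of nonempty fibres. *)
Definition Zassign : 'M[R]_s :=
  \matrix_(i, j) ((p i == p j)%:R / #|[set i' | p i' == p j]%SET|%:R).

Let c_gt0 j : 0 < c (p j).
Proof. by rewrite ltr0n; apply/card_gt0P; exists j; rewrite inE. Qed.

Let ZE i j : Zassign i j = \sum_l (c l)^-1 * (p i == l)%:R * (p j == l)%:R.
Proof.
rewrite mxE (bigD1 (p j))//= eqxx mulr1 mulrC big1 ?addr0// => l.
by rewrite eq_sym => /negbTE ->; rewrite mulr0.
Qed.

Lemma Zassign_psd : psd Zassign.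
Proof.
split; first by apply/matrixP => i j; rewrite mxE !ZE; apply: eq_bigr => l _; rewrite mulrAC.
move=> v; rewrite -/(qf Zassign v v) qfE.
rewrite (_ : \sum_i _ = \sum_l (c l)^-1 * (\sum_i (p i == l)%:R * v i 0) ^+ 2).
  by apply: sumr_ge0 => l _; rewrite mulr_ge0 ?sqr_ge0// invr_ge0.
transitivity (\sum_i \sum_j \sum_l (c l)^-1 * ((p i == l)%:R * v i 0) * ((p j == l)%:R * v j 0)).
  apply: eq_bigr => i _; apply: eq_bigr => j _; rewrite ZE !mulr_suml.
  by apply: eq_bigr => l _; ring.
under eq_bigr do rewrite exchange_big/=.
rewrite exchange_big/=; apply: eq_bigr => l _.
rewrite expr2 mulrA [X in X * _]mulr_sumr mulr_suml; apply: eq_bigr => i _.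
by rewrite mulr_sumr.
Qed.

Lemma Zassign_row i : \sum_j Zassign i j = 1.
Proof.
have -> : \sum_j Zassign i j = \sum_(j | p j == p i) (c (p i))^-1.
  rewrite [RHS]big_mkcond; apply: eq_bigr => j _; rewrite mxE eq_sym.
  by case: eqP => [->|_]; rewrite ?mul1r ?mul0r.
by rewrite sumr_const -[X in X = _]mulr_natr -[RHS](mulVf (lt0r_neq0 (c_gt0 i))) /c cardsE.
Qed.

Lemma Zassign_trace : \tr Zassign = #|[set p i | i in 'I_s]%SET|%:R.
Proof.
rewrite /mxtrace.
have -> : \sum_i Zassign i i = \sum_i (c (p i))^-1.
  by apply: eq_bigr => i _; rewrite mxE eqxx mul1r.
rewrite (partition_big p (fun l => l \in [set p i | i in 'I_s]%SET))/=; last first.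
  by move=> i _; exact: imset_f.
rewrite -sum1_card natr_sum; apply: eq_bigr => l /imsetP[i0 _ ->].
rewrite (eq_bigr (fun=> (c (p i0))^-1)); last by move=> i /eqP ->.
by rewrite sumr_const -[LHS]mulr_natr -[RHS](mulVf (lt0r_neq0 (c_gt0 i0))) /c cardsE.
Qed.

Lemma sdp_assign_feasible (k : nat) : (#|[set p i | i in 'I_s]%SET| <= k <= s)%N ->
  exists al : R, 0 <= al <= 1 /\
    sdp_feasible k ((1 - al) *: Zassign + al *: 1%:M).
Proof.
set r := #|_| => /andP[rk ks].
have rs := leq_trans rk ks.
(* Mixing with the identity, of trace [s], raises the trace from [r] to exactly [k]. If [r = s] the
   quotient is 0 by convention, which is right because then [k = r]. *)
pose al : R := (k%:R - r%:R) / (s%:R - r%:R).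
have kr : 0 <= k%:R - r%:R :> R by rewrite subr_ge0 ler_nat.
have sk : k%:R - r%:R <= s%:R - r%:R :> R by rewrite lerD2r ler_nat.
have al01 : 0 <= al <= 1.
  rewrite divr_ge0 ?(le_trans kr)//=.
  have [e|ne] := eqVneq (s%:R - r%:R : R) 0; first by rewrite /al e invr0 mulr0.
  by rewrite ler_pdivrMr ?mul1r// lt_neqAle eq_sym ne (le_trans kr).
have /andP[a0 a1] := al01.
have [Zs Zq] := Zassign_psd.
exists al; split=> //; split.
- apply/matrixP => i j; rewrite mulmxDl -!scalemxAl mul1mx !mxE mulr1.
  under eq_bigr do rewrite [const_mx _ _ _]mxE mulr1.
  by rewrite Zassign_row; ring.
- rewrite mxtraceD !mxtraceZ mxtrace1 Zassign_trace -/r /al.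
  have [e|ne] := eqVneq (s%:R - r%:R : R) 0; last by field.
  rewrite e invr0 mulr0 subr0 mul1r mul0r addr0.
  by apply/eqP; rewrite eq_sym -subr_eq0 eq_le kr andbT -e.
- move=> i j; rewrite !mxE addr_ge0// mulr_ge0// ?subr_ge0// ?divr_ge0//.
- split; first by rewrite linearD/= !linearZ/= Zs trmx1.
  move=> v; rewrite (_ : (_ *m v) 0 0 = (1 - al) * qf Zassign v v + al * qf 1%:M v v); last first.
    by rewrite /qf mulmxDr mulmxDl -!scalemxAr -!scalemxAl [LHS]mxE; congr (_ + _); rewrite mxE.
  rewrite addr_ge0// mulr_ge0// ?subr_ge0//; first exact: Zq.
  by rewrite /qf mulmx1 mxE; apply: sumr_ge0 => i _; rewrite !mxE -expr2 sqr_ge0.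
Qed.
End assign.

Lemma sdp_value_ge0 d s k (Y : 'I_s -> 'rV[R]_d) (Z : 'M[R]_s) : sdp_feasible k Z ->
  0 <= (2 * s%:R)^-1 * \tr (Dmat Y *m Z).
Proof.
move=> [_ _ Z0 [ZT _]]; rewrite mulr_ge0 ?invr_ge0 ?mulr_ge0// trace_DmatE//.
by apply: sumr_ge0 => i _; apply: sumr_ge0 => j _; rewrite mulr_ge0// sqnorm_ge0.
Qed.

Lemma SDP_le d s k (Y : 'I_s -> 'rV[R]_d) (Z : 'M[R]_s) : sdp_feasible k Z ->
  SDP Y k <= (2 * s%:R)^-1 * \tr (Dmat Y *m Z).
Proof.
move=> ZF; apply: ge_inf; last by exists Z.
by exists 0 => _ [Z' /= Z'F <-]; exact: sdp_value_ge0 Z'F.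
Qed.

(** The infimum of the empty set is a default value, so a feasible point is needed as well; the
    one-cluster assignment supplies it. *)
Lemma SDP_ge d s k (Y : 'I_s -> 'rV[R]_d) (x : R) : (0 < k <= s)%N ->
  (forall Z, sdp_feasible k Z -> x <= (2 * s%:R)^-1 * \tr (Dmat Y *m Z)) ->
  x <= SDP Y k.
Proof.
move=> /andP[k0 ks] H; apply: lb_le_inf.
  have /(sdp_assign_feasible (p := fun _ : 'I_s => tt)) [al [_ F]] :
      (#|[set (fun _ : 'I_s => tt) i | i in 'I_s]%SET| <= k <= s)%N.
    by rewrite ks andbT (leq_trans _ k0)// (leq_trans (max_card _))// card_unit.
  by eexists; exists ((1 - al) *: Zassign (fun _ : 'I_s => tt) + al *: 1%:M).
by move=> _ [Z /= ZF <-]; exact: H.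
Qed.

Lemma SDP_ge0 d s k (Y : 'I_s -> 'rV[R]_d) : (0 < k <= s)%N -> 0 <= SDP Y k.
Proof. by move=> ks; apply: SDP_ge => // Z; exact: sdp_value_ge0. Qed.

(** Inside a fibre [Y i - Y j] is a difference of residuals [a i - a j], so the trace against
    [Zassign] is twice the assignment cost minus a positive semidefinite form, for any centers [C].
    The identity part of the mixture only meets zero distances. *)
Lemma SDP_le_assign d s k (L : finType) (p : 'I_s -> L) (C : L -> 'rV[R]_d)
    (Y : 'I_s -> 'rV[R]_d) :
  (#|[set p i | i in 'I_s]%SET| <= k <= s)%N ->
  SDP Y k <= s%:R^-1 * \sum_i sqnorm (Y i - C (p i)).
Proof.
move=> /[dup] pk /sdp_assign_feasible[al [/andP[a0 a1] F]].
apply: le_trans (SDP_le Y F) _.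
have [_ _ _ [ZT _]] := F.
rewrite trace_DmatE// invfM [2^-1 * _]mulrC -mulrA ler_wpM2l ?invr_ge0//.
rewrite ler_pdivrMl//.
pose a i := Y i - C (p i).
have -> : \sum_i \sum_j sqnorm (Y i - Y j) * ((1 - al) *: Zassign p + al *: 1%:M) i j =
    (1 - al) * \sum_i \sum_j sqnorm (a i - a j) * Zassign p i j.
  rewrite mulr_sumr; apply: eq_bigr => i _; rewrite mulr_sumr; apply: eq_bigr => j _.
  rewrite !mxE; have [->|ij] := eqVneq i j.
    by rewrite !subrr sqnorm0 !mul0r mulr0.
  rewrite /a mulr0 addr0; have [->|pij] := eqVneq (p i) (p j).
    by rewrite opprB addrA subrK mulrCA.
  by rewrite !mul0r !mulr0.
have E : \sum_i \sum_j sqnorm (a i - a j) * Zassign p i j <= 2 * \sum_i sqnorm (a i).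
  have -> : \sum_i \sum_j sqnorm (a i - a j) * Zassign p i j =
    2 * \sum_i sqnorm (a i) - 2 * \sum_i \sum_j Zassign p i j * dotv (a i) (a j).
    apply: (@sdp_quad_form _ #|[set p i | i in 'I_s]%SET|).
    have [Zs Zq] := Zassign_psd p; split => //.
    + by apply/matrixP => i j; rewrite !mxE -[RHS](Zassign_row p i); apply: eq_bigr => l _; rewrite [const_mx _ _ _]mxE mulr1.
    + exact: Zassign_trace.
    + by move=> i j; rewrite mxE divr_ge0.
  by rewrite gerBl mulr_ge0//; apply: psd_dotv_ge0; exact: Zassign_psd.
have E0 : 0 <= 2 * \sum_i sqnorm (a i).
  by rewrite mulr_ge0//; apply: sumr_ge0 => i _; exact: sqnorm_ge0.
have a1' : 0 <= 1 - al by rewrite subr_ge0.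
apply: le_trans (ler_wpM2l a1' E) _.
by rewrite ler_piMl// gerBl.
Qed.

(** Projecting off the means shortens distances and erases the labels. The loss has two equal
    halves: the noise energy along at most [k] unit vectors, and the trace of [Z] against the Gram
    matrix of the projected noise. *)
Lemma SDP_spectral_lower d s k (mu : 'I_k -> 'rV[R]_d) (tau : 'I_s -> 'I_k)
    (g : 'I_s -> 'rV[R]_d) (lam : R) : (0 < k <= s)%N -> 0 <= lam ->
  (forall v, \sum_i dotv (g i) v ^+ 2 <= lam * sqnorm v) ->
  s%:R^-1 * (\sum_i sqnorm (g i) - 2 * k%:R * lam) <= SDP (fun i => mu (tau i) + g i) k.
Proof.
move=> ks lam0 glam; apply: SDP_ge => // Z ZF.
have [_ _ Z0 [ZT _]] := ZF.
have [es [es1 es2 es3 es4]] := gram_schmidt [seq mu t | t <- enum 'I_k].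
rewrite trace_DmatE// invfM [2^-1 * _]mulrC -[leRHS]mulrA ler_wpM2l ?invr_ge0//.
rewrite ler_pdivlMl//.
have Q1 v : sqnorm (projc es v) <= sqnorm v.
  by rewrite es3 gerBl; apply: sumr_ge0 => e _; exact: sqr_ge0.
apply: (@le_trans _ _ (\sum_i \sum_j sqnorm (projc es (g i) - projc es (g j)) * Z i j)); last first.
  apply: ler_sum => i _; apply: ler_sum => j _; rewrite ler_wpM2r//.
  have mu0 t : projc es (mu t) = 0 by apply: es4; apply: map_f; rewrite mem_enum.
  rewrite -projcB (_ : projc es (g i - g j) = projc es ((mu (tau i) + g i) - (mu (tau j) + g j)))//.
  apply/eqP; rewrite -subr_eq0 -projcB.
  have -> : g i - g j - (mu (tau i) + g i - (mu (tau j) + g j)) = mu (tau j) - mu (tau i).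
    by apply/rowP => l; rewrite !mxE; ring.
  by rewrite projcB !mu0 subrr.
rewrite (sdp_quad_form ZF).
have h1 := sdp_quad_le ZF lam0 glam Q1.
have h2 : \sum_i sqnorm (projc es (g i)) >= \sum_i sqnorm (g i) - k%:R * lam.
  rewrite [leRHS](eq_bigr _ (fun i _ => es3 (g i))).
  rewrite sumrB lerD2l lerN2 exchange_big/=.
  apply: (@le_trans _ _ (\sum_(e <- es) lam)).
    rewrite big_seq [leRHS]big_seq; apply: ler_sum => e /es2 e1.
    by rewrite -[leRHS]mulr1 -e1.
  have -> : \sum_(e <- es) lam = (size es)%:R * lam.
    by rewrite big_const_seq count_predT iter_addr_0 mulr_natl.
  rewrite ler_wpM2r ?ler_nat//.
  by rewrite (leq_trans es1)// size_map size_enum_ord.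
lra.
Qed.

(** [x >= 4 * (1 - exp (- x / 4))] replaces distances by a kernel, and Cauchy-Schwarz with the
    Frobenius bound [sqrt k] separates it from [Z]. At this scale the squared kernel is
    [exp (- x / 2)], whose mean at two standard normal points is [3^(-d/2)]. *)
Lemma SDP_kernel_lower d s k (Y : 'I_s -> 'rV[R]_d) : (0 < k <= s)%N ->
  2 * (1 - Num.sqrt (k%:R * (s%:R ^- 2 *
    \sum_i \sum_j expR (- (sqnorm (Y i - Y j) / 2))))) <= SDP Y k.
Proof.
move=> /[dup] ks /andP[k0 ks']; apply: SDP_ge => // Z ZF.
have [_ _ Z0 [ZT _]] := ZF.
have s0 : 0 < s%:R :> R by rewrite ltr0n (leq_trans k0).
pose D i j := sqnorm (Y i - Y j); pose e i j := expR (- (D i j / 4)).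
rewrite trace_DmatE//.
have h1 : \sum_i \sum_j sqnorm (Y i - Y j) * Z i j >=
    4 * s%:R - 4 * \sum_i \sum_j e i j * Z i j.
  have -> : 4 * s%:R = 4 * \sum_i \sum_j Z i j.
    congr (_ * _); under eq_bigr do rewrite (sdp_rowsum ZF).
    by rewrite sumr_const card_ord.
  rewrite -mulrBr -sumrB mulr_sumr; apply: ler_sum => i _.
  rewrite -sumrB mulr_sumr; apply: ler_sum => j _.
  have := expR_ge1Dx (- (D i j / 4)); rewrite -/(e i j) -/(D i j) => he.
  by have := Z0 i j; nra.
set T := \sum_i \sum_j expR _.
have h2 : \sum_i \sum_j e i j * Z i j <= Num.sqrt (k%:R * T).
  rewrite pair_big/= -[leLHS]ger0_norm; last first.
    by apply: sumr_ge0 => i _; rewrite mulr_ge0// expR_ge0.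
  rewrite -sqrtr_sqr ler_wsqrtr//.
  apply: le_trans (cauchy_schwarz_sum _ _) _.
  rewrite mulrC -(pair_big predT predT (fun i j => e i j ^+ 2))/=.
  rewrite -(pair_big predT predT (fun i j => Z i j ^+ 2))/=.
  have -> : \sum_i \sum_j e i j ^+ 2 = T.
    apply: eq_bigr => i _; apply: eq_bigr => j _.
    by rewrite /e -expRM_natl; congr expR; rewrite /D; field.
  rewrite ler_wpM2r ?(sdp_sum_sqr ZF)//.
  by apply: sumr_ge0 => i _; apply: sumr_ge0 => j _; exact: expR_ge0.
rewrite ler_pdivlMl ?mulr_gt0//.
have -> : Num.sqrt (k%:R * (s%:R ^- 2 * T)) = Num.sqrt (k%:R * T) / s%:R.
  rewrite mulrCA mulrC sqrtrM ?mulr_ge0//; last first.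
    by apply: sumr_ge0 => i _; apply: sumr_ge0 => j _; exact: expR_ge0.
  by congr (_ * _); rewrite -exprVn sqrtr_sqr ger0_norm// invr_ge0 ltW.
set q := Num.sqrt _ in h2 *.
have -> : 2 * s%:R * (2 * (1 - q / s%:R)) = 4 * s%:R - 4 * q by field; rewrite gt_eqF.
by apply: le_trans h1; rewrite lerD2l lerN2 ler_wpM2l.
Qed.
End sdp.

(** * The k-means optimum and the greedy centers *)

Section ip.
Variable R : realType.

Lemma cmean_optimal d m (Y : 'I_m -> 'rV[R]_d) (S : {set 'I_m}) (C : 'rV[R]_d) :
  \sum_(j in S) sqnorm (Y j - cmean Y S) <= \sum_(j in S) sqnorm (Y j - C).
Proof.
have [->|S0] := eqVneq S finset.set0; first by rewrite !big_set0.
have cS : #|S|%:R != 0 :> R by rewrite pnatr_eq0 cards_eq0.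
set c := cmean Y S.
have -> : \sum_(j in S) sqnorm (Y j - C) =
   \sum_(j in S) sqnorm (Y j - c) + #|S|%:R * sqnorm (c - C).
  transitivity (\sum_(j in S) (sqnorm (Y j - c) + (2 * dotv (Y j - c) (c - C) + sqnorm (c - C)))).
    apply: eq_bigr => j _; rewrite addrA -sqnormD; congr sqnorm.
    by rewrite addrA subrK.
  rewrite big_split/=; congr (_ + _); rewrite big_split/= sumr_const -mulr_natl.
  rewrite -mulr_sumr -dotv_suml.
  have -> : \sum_(j in S) (Y j - c) = 0.
    rewrite sumrB sumr_const -scaler_nat /c /cmean scalerA mulfV// scale1r subrr//.
  by rewrite dotv0l mulr0 add0r mulr_natl.
by rewrite lerDl mulr_ge0 ?sqnorm_ge0.
Qed.

Lemma IPcost_ge0 d m (Y : 'I_m -> 'rV[R]_d) G : 0 <= IPcost Y G.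
Proof.
rewrite mulr_ge0 ?invr_ge0//; apply: sumr_ge0 => S _; apply: sumr_ge0 => j _.
exact: sqnorm_ge0.
Qed.

(** [IP] asks for exactly [k] nonempty blocks while an assignment may use fewer. While fewer than
    [k <= n] labels occur, two points share one, and moving one of them to the fresh label [None]
    adds a block and only refines. *)
Lemma refine_assignment n (k : nat) : forall (L : finType) (p : 'I_n -> L),
  (#|[set p i | i in 'I_n]%SET| <= k <= n)%N ->
  exists (L' : finType) (q : 'I_n -> L'),
    #|[set q i | i in 'I_n]%SET| = k /\ (forall i j, q i = q j -> p i = p j).
Proof.
move=> L p; move: {2}(k - #|[set p i | i in 'I_n]%SET|)%N (erefl (k - #|[set p i | i in 'I_n]%SET|)%N) => N.
elim: N L p => [|N IH] L p.
  move=> /eqP; rewrite subn_eq0 => k1 /andP[k2 _]; exists L, p; split => //.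
  by apply/eqP; rewrite eqn_leq k2.
set r := #|_| => rk /andP[rk' kn].
have rltk : (r < k)%N by rewrite -subn_gt0 rk.
have /injectivePn[i [j ij pij]] : ~~ injectiveb p.
  apply/negP => /injectiveP pinj; have := card_imset 'I_n pinj.
  rewrite -/r card_ord => rn; move: rltk; rewrite rn ltnNge kn//.
pose q (a : 'I_n) : option L := if a == i then None else Some (p a).
have qcard : #|[set q a | a in 'I_n]%SET| = r.+1.
  have -> : [set q a | a in 'I_n]%SET = (None |: (Some @: [set p a | a in 'I_n]))%SET.
    apply/setP => -[l|]; rewrite !inE/=.
      rewrite (mem_imset _ _ (@Some_inj _)); apply/imsetP/imsetP => -[a _].
        by rewrite /q; case: eqP => // _ [->]; exists a.
      move=> ->; have [->|ai] := eqVneq a i.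
        by exists j => //; rewrite /q eq_sym (negbTE ij) pij.
      by exists a => //; rewrite /q (negbTE ai).
    by apply/imsetP; exists i => //; rewrite /q eqxx.
  rewrite cardsU1 (card_imset _ (@Some_inj _)) -/r.
  by case: imsetP => // -[].
have [||L' [q' [c1 c2]]] := IH _ q.
- by rewrite qcard subnS rk.
- by rewrite qcard rltk kn.
exists L', q'; split => // a b /c2; rewrite /q.
have [->|ai] := eqVneq a i; have [->|bi] := eqVneq b i => //.
by move=> [].
Qed.

Lemma card_preim_partition n (L : finType) (q : 'I_n -> L) :
  #|preim_partition q [set: 'I_n]%SET| = #|[set q i | i in 'I_n]%SET|.
Proof.
pose f (l : L) : {set 'I_n} := [set i | q i == l]%SET.
have -> : preim_partition q [set: 'I_n]%SET = [set f l | l in [set q i | i in 'I_n]]%SET.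
  apply/setP => S; apply/imsetP/imsetP => [[i _ ->]|[_ /imsetP[i _ ->] ->]].
    by exists (q i); [exact: imset_f|apply/setP => j; rewrite !inE eq_sym].
  by exists i => //; apply/setP => j; rewrite !inE eq_sym.
rewrite card_in_imset// => _ _ /imsetP[a _ ->] /imsetP[b _ ->] /setP /(_ a).
by rewrite !inE eqxx => /esym /eqP.
Qed.

Lemma IP_le_assign d n k (L : finType) (p : 'I_n -> L) (C : L -> 'rV[R]_d)
    (X : 'I_n -> 'rV[R]_d) :
  (#|[set p i | i in 'I_n]%SET| <= k <= n)%N ->
  IP X k <= n%:R^-1 * \sum_i sqnorm (X i - C (p i)).
Proof.
move=> /refine_assignment[L' [q [qk qp]]].
pose G := preim_partition q [set: 'I_n]%SET.
have Gpart : finset.partition G [set: 'I_n]%SET := preim_partitionP q _.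
apply: (@le_trans _ _ (IPcost X G)).
  apply: ge_inf; first by exists 0 => _ [G' _ <-]; exact: IPcost_ge0.
  exists G => //; split => //.
  by rewrite card_preim_partition.
rewrite /IPcost ler_wpM2l ?invr_ge0//.
have -> : \sum_i sqnorm (X i - C (p i)) = \sum_(S in G) \sum_(i in S) sqnorm (X i - C (p i)).
  have /and3P[/eqP cG tG _] := Gpart.
  rewrite -(finset.big_trivIset _ tG)/= cG; apply: eq_bigl => i; by rewrite inE.
apply: ler_sum => S SG.
have /imsetP[i0 _ SE] := SG.
rewrite [leRHS](eq_bigr (fun i => sqnorm (X i - C (p i0)))) ?cmean_optimal//.
by move=> i; rewrite SE !inE/= => /eqP h; rewrite (qp i0 i h).
Qed.

Lemma IP_ge d n k (X : 'I_n -> 'rV[R]_d) (x : R) : (0 < k <= n)%N ->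
  (forall (p : 'I_n -> {set 'I_n}) (C : {set 'I_n} -> 'rV[R]_d),
     (#|[set p i | i in 'I_n]%SET| <= k)%N ->
     x <= n%:R^-1 * \sum_i sqnorm (X i - C (p i))) ->
  x <= IP X k.
Proof.
move=> /andP[k0 kn] H; apply: lb_le_inf.
  have /refine_assignment[L' [q [qk _]]] :
      (#|[set (fun _ : 'I_n => tt) i | i in 'I_n]%SET| <= k <= n)%N.
    by rewrite kn andbT (leq_trans _ k0)// (leq_trans (max_card _))// card_unit.
  eexists; exists (preim_partition q [set: 'I_n]%SET) => //; split; first exact: preim_partitionP.
  by rewrite card_preim_partition.
move=> _ [G /= [Gp Gk] <-].
have /and3P[/eqP cG tG _] := Gp.
have Gin i : finset.pblock G i \in G by apply: finset.pblock_mem; rewrite cG inE.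
apply: le_trans (H (finset.pblock G) (cmean X) _) _.
  rewrite -Gk; apply: subset_leq_card; apply/fintype.subsetP => S /imsetP[i _ ->].
  exact: Gin.
rewrite /IPcost ler_wpM2l ?invr_ge0//.
rewrite le_eqVlt; apply/orP; left; apply/eqP.
transitivity (\sum_(i in finset.cover G) sqnorm (X i - cmean X (finset.pblock G i))).
  by apply: eq_bigl => i; rewrite cG inE.
rewrite (finset.big_trivIset _ tG)/=; apply: eq_bigr => S SG; apply: eq_bigr => i iS.
by rewrite (finset.def_pblock tG SG iS).
Qed.

Lemma mindist_le d n k (X : 'I_n -> 'rV[R]_d) (c : 'I_k -> 'I_n) t x (j : 'I_k) :
  (j < t)%N -> mindist X c t x <= dist x (X (c j)).
Proof.
move=> jt; apply: ge_inf; last by exists j.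
by exists 0 => _ [i _ <-]; exact: sqrtr_ge0.
Qed.

Lemma mindist_ge d n k (X : 'I_n -> 'rV[R]_d) (c : 'I_k -> 'I_n) t x (y : R) :
  (0 < t)%N -> (0 < k)%N -> (forall j : 'I_k, (j < t)%N -> y <= dist x (X (c j))) ->
  y <= mindist X c t x.
Proof.
move=> t0 k0 H; apply: lb_le_inf.
  by eexists; exists (Ordinal k0).
by move=> _ [j /= jt <-]; exact: H.
Qed.

Lemma dist_sqr d (x y : 'rV[R]_d) : dist x y ^+ 2 = sqnorm (x - y).
Proof. by rewrite sqr_sqrtr// sqnorm_ge0. Qed.

Lemma sqnorm_le_kpp_b d n k (X : 'I_n -> 'rV[R]_d) (c : 'I_k -> 'I_n) (i : 'I_n) :
  (0 < k)%N -> exists j : 'I_k, sqnorm (X i - X (c j)) <= kpp_b X c.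
Proof.
move=> k0; pose j0 := Ordinal k0.
case: (@arg_minP _ _ _ j0 predT (fun j => dist (X i) (X (c j)))) => // j _ jmin.
exists j; rewrite -dist_sqr.
apply: (@le_trans _ _ (mindist X c k (X i) ^+ 2)).
  rewrite lerXn2r ?nnegrE ?sqrtr_ge0//.
    by apply: mindist_ge => // j' _; exact: sqrtr_ge0.
  by apply: mindist_ge => // j' _; exact: jmin.
apply: ub_le_sup; last by exists i.
exists (\sum_i' mindist X c k (X i') ^+ 2) => _ [i' _ <-].
by rewrite (bigD1 i')//= lerDl; apply: sumr_ge0 => a _; exact: sqr_ge0.
Qed.

Lemma kpp_b_ge0 d n k (X : 'I_n -> 'rV[R]_d) (c : 'I_k -> 'I_n) :
  (0 < n)%N -> (0 < k)%N -> 0 <= kpp_b X c.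
Proof.
move=> n0 k0; have [j] := sqnorm_le_kpp_b X c (Ordinal n0) k0.
by apply: le_trans; exact: sqnorm_ge0.
Qed.

Lemma sqnorm_sub_le d (u v : 'rV[R]_d) (r : R) : sqnorm u <= r -> sqnorm v <= r ->
  sqnorm (u - v) <= 4 * r.
Proof.
move=> ur vr; have := sqnorm_ge0 (u + v).
by rewrite sqnormD sqnormB; lra.
Qed.

(* Farthest-first traversal: if some point were at squared distance more than [4 r] from
   all centers, that point and the k centers would be k+1 points that are pairwise too
   far apart to share one of the k labels. *)
Lemma kpp_b_le d n k (mu : 'I_k -> 'rV[R]_d) (tau : 'I_n -> 'I_k) (g : 'I_n -> 'rV[R]_d)
    (c : 'I_k -> 'I_n) (r : R) : (0 < n)%N -> (0 < k)%N ->
  kpp_run (fun i => mu (tau i) + g i) c -> (forall i, sqnorm (g i) <= r) ->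
  kpp_b (fun i => mu (tau i) + g i) c <= 4 * r.
Proof.
set X := fun i => _ => n0 k0 [_ run] gr.
have r0 : 0 <= r by apply: le_trans (gr (Ordinal n0)); exact: sqnorm_ge0.
have same i i' : tau i = tau i' -> sqnorm (X i - X i') <= 4 * r.
  move=> e; rewrite /X e opprD addrACA subrr add0r; exact: sqnorm_sub_le.
apply: ge_sup; first by eexists; exists (Ordinal n0).
move=> _ [i _ <-].
have mk0 t x : (0 < t)%N -> 0 <= mindist X c t x.
  by move=> t0; apply: mindist_ge => // j _; exact: sqrtr_ge0.
rewrite leNgt; apply/negP => far.
have farj (j : 'I_k) : 4 * r < sqnorm (X i - X (c j)).
  apply: lt_le_trans far _; rewrite -dist_sqr lerXn2r ?nnegrE ?sqrtr_ge0 ?mk0//.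
  exact: mindist_le.
have farc (j t : 'I_k) : (j < t)%N -> 4 * r < sqnorm (X (c t) - X (c j)).
  move=> jt; apply: lt_le_trans far _; rewrite -dist_sqr lerXn2r ?nnegrE ?sqrtr_ge0 ?mk0//.
  have t0 : (0 < t)%N by exact: leq_ltn_trans jt.
  apply: le_trans (mindist_le _ _ _ jt); apply: le_trans (run t t0 i).
  by apply: mindist_ge => // j' j't; exact: mindist_le.
have inj : injective (fun j => tau (c j)).
  move=> j t /same e; apply/eqP; rewrite -val_eqE; apply/negPn/negP.
  rewrite neq_ltn => /orP[|] /farc; rewrite ltNge.
    by rewrite -sqnormN opprB e.
  by rewrite e.
have /codomP[j ej] : tau i \in codom (fun j => tau (c j)).
  by rewrite inj_card_onto// card_ord.
by have := farj j; rewrite ltNge same.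
Qed.
End ip.

(** * Finite averages and Hoeffding's inequality *)

Section averages.
Variable R : realType.

Definition avg (A : finType) (f : A -> R) : R := #|A|%:R^-1 * \sum_a f a.

Lemma le_avg (A : finType) (f g : A -> R) : (forall a, f a <= g a) -> avg f <= avg g.
Proof. by move=> fg; rewrite ler_wpM2l ?invr_ge0//; apply: ler_sum. Qed.

Lemma eq_avg (A : finType) (f g : A -> R) : f =1 g -> avg f = avg g.
Proof. by move=> /funext ->. Qed.

Lemma avg_const (A : finType) (x : R) : (0 < #|A|)%N -> avg (fun _ : A => x) = x.
Proof.
move=> A0; rewrite /avg; have -> : \sum_(a : A) x = #|A|%:R * x.
  by rewrite sumr_const mulr_natl; congr (_ *+ _); exact: eq_card.
by rewrite mulKf// pnatr_eq0 -lt0n.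
Qed.

Lemma avgD (A : finType) (f g : A -> R) : avg (fun a => f a + g a) = avg f + avg g.
Proof. by rewrite /avg big_split mulrDr. Qed.

Lemma avgZ (A : finType) (x : R) (f : A -> R) : avg (fun a => x * f a) = x * avg f.
Proof. by rewrite /avg -mulr_sumr mulrCA. Qed.

Lemma avg_sum (A J : finType) (P : pred J) (f : J -> A -> R) :
  avg (fun a => \sum_(j | P j) f j a) = \sum_(j | P j) avg (f j).
Proof. by rewrite /avg exchange_big/= mulr_sumr. Qed.

Lemma avg_reindex (A : finType) (h : A -> A) (f : A -> R) :
  injective h -> avg (fun a => f (h a)) = avg f.
Proof. by move=> hi; rewrite /avg [in RHS](reindex_inj hi). Qed.

Lemma avg_exchange (A B : finType) (f : A -> B -> R) :
  avg (fun a => avg (fun b => f a b)) = avg (fun b => avg (fun a => f a b)).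
Proof.
rewrite /avg; under eq_bigr do rewrite mulr_sumr.
rewrite exchange_big/= !mulr_sumr; apply: eq_bigr => b _.
by rewrite -mulr_sumr mulrCA.
Qed.

Lemma avg_ge0 (A : finType) (f : A -> R) : (forall a, 0 <= f a) -> 0 <= avg f.
Proof. by move=> f0; rewrite mulr_ge0 ?invr_ge0// sumr_ge0. Qed.

Lemma expR_avg (A : finType) (f : A -> R) : (0 < #|A|)%N ->
  expR (avg f) <= avg (fun a => expR (f a)).
Proof.
move=> A0; rewrite -[leLHS](avg_const _ A0) -[leLHS]addr0.
have -> : 0 = expR (avg f) * avg (fun a => f a - avg f).
  by rewrite avgD avg_const// subrr mulr0.
rewrite -avgZ -avgD; apply: le_avg => a.
rewrite -{1}[expR (avg f)]mulr1 -mulrDr.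
have -> : expR (f a) = expR (avg f) * expR (f a - avg f) by rewrite -expRD addrC subrK.
by rewrite ler_wpM2l ?expR_ge0// expR_ge1Dx.
Qed.

Lemma avg_ffun_prod (I A : finType) (f : I -> A -> R) :
  avg (fun r : {ffun I -> A} => \prod_i f i (r i)) = \prod_i avg (f i).
Proof.
rewrite /avg big_split/= prodr_const card_ffun natrX exprVn; congr (_ * _).
by rewrite bigA_distr_bigA.
Qed.

Lemma avg_ffun_eval (I A : finType) (i0 : I) (f : A -> R) : (0 < #|A|)%N ->
  avg (fun r : {ffun I -> A} => f (r i0)) = avg f.
Proof.
move=> A0.
rewrite (eq_avg (g := fun r : {ffun I -> A} => \prod_i (if i == i0 then f (r i) else 1))); last first.
  by move=> r; rewrite -big_mkcond/= big_pred1_eq.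
rewrite (avg_ffun_prod (fun i a => if i == i0 then f a else 1)) (bigD1 i0)//= eqxx.
by rewrite big1 ?mulr1// => i /negbTE ->; rewrite avg_const.
Qed.

Lemma avg_ffun_eval2 (I A : finType) (i0 i1 : I) (f : A -> A -> R) : (0 < #|A|)%N ->
  i0 != i1 ->
  avg (fun r : {ffun I -> A} => f (r i0) (r i1)) = avg (fun a => avg (f a)).
Proof.
move=> A0 i01; have i10 : i1 != i0 by rewrite eq_sym.
(* Summing over the value [a] of [r i0] turns a function of two coordinates into a sum of products
   over coordinates. *)
rewrite (eq_avg (g := fun r : {ffun I -> A} => \sum_a (\prod_i (if i == i0 then (r i == a)%:R else
   if i == i1 then f a (r i) else 1)))); last first.
  move=> r; rewrite (bigD1 (r i0))//= (bigD1 i0)//= eqxx eqxx mul1r.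
  rewrite (bigD1 i1)//= (negbTE i10) eqxx.
  rewrite big1 ?mulr1; last by move=> i /andP[/negbTE -> /negbTE ->].
  rewrite big1 ?addr0// => a ane.
  by rewrite (bigD1 i0)//= eqxx eq_sym (negbTE ane) mul0r.
rewrite avg_sum; transitivity (\sum_a (#|A|%:R^-1 * avg (f a))); last by rewrite -mulr_sumr.
apply: eq_bigr => a _.
rewrite (avg_ffun_prod (fun i b => if i == i0 then (b == a)%:R else
   if i == i1 then f a b else 1)) (bigD1 i0)//= eqxx; congr (_ * _).
  by rewrite /avg -[RHS]mulr1; congr (_ * _); rewrite (bigD1 a)//= eqxx big1 ?addr0// => b /negbTE ->.
rewrite (bigD1 i1)//= (negbTE i10) eqxx.
by rewrite big1 ?mulr1// => i /andP[/negbTE -> /negbTE ->]; rewrite avg_const.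
Qed.
End averages.

Section hoeffding.
Variable R : realType.

Lemma ge0_of_derive (f f' : R -> R) (x : R) : 0 <= x ->
  (forall y : R, is_derive y (1 : R) f (f' y)) -> (forall y, 0 <= y -> 0 <= f' y) -> f 0 <= f x.
Proof.
move=> x0 fd fge; have [->//|xn0] := eqVneq x 0.
have xp : 0 < x by rewrite lt_neqAle eq_sym xn0.
have [|c cx] := MVT xp (fun y _ => fd y).
  apply: derivable_within_continuous => y _; exact: ex_derive.
move=> h; rewrite -subr_ge0 h mulr_ge0 ?subr0// fge//.
by move: cx; rewrite in_itv/= => /andP[/ltW].
Qed.

(** [g] is the logarithm of the right side over the left. It and its derivative [g1] vanish at 0,
    and its second derivative is [1/4 - q (1 - q) >= 0] with [q = p e^y / (1 - p + p e^y)]. *)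
Let hoeffding_lemma_pos (p h : R) : 0 <= p <= 1 -> 0 <= h ->
  1 - p + p * expR h <= expR (p * h + h ^+ 2 / 8).
Proof.
move=> /andP[p0 p1] h0.
have Dp y : 0 < 1 - p + p * expR y.
  have [->|pn] := eqVneq p 1; first by rewrite subrr add0r mul1r expR_gt0.
  by rewrite ltr_pwDl ?mulr_ge0 ?expR_ge0// subr_gt0 lt_neqAle pn.
have dD (y : R) : is_derive y (1 : R) (fun y : R => 1 - p + p * expR y) (p * expR y).
  by apply: is_derive_eq; rewrite /GRing.scale/=; ring.
pose g1 (y : R) := y / 4 + p - p * expR y / (1 - p + p * expR y).
have g1d (y : R) : is_derive y (1 : R) g1
   (1 / 4 - (p * expR y * (1 - p)) / (1 - p + p * expR y) ^+ 2).
  have dV := @is_deriveV R (fun y : R => 1 - p + p * expR y) y _ 1 (lt0r_neq0 (Dp y)) (dD y).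
  have H := is_deriveB (is_deriveD (is_deriveM (is_derive_id y (1 : R)) (is_derive_cst (4^-1 : R) y (1 : R))) (is_derive_cst p y (1 : R)))
    (is_deriveM (is_deriveM (is_derive_cst p y (1 : R)) (is_derive_expR y)) dV).
  apply: (is_derive_eq H); rewrite /GRing.scale/= /cst.
  have -> : ((fun=> p) * expR) y = p * expR y by [].
  by field; rewrite gt_eqF ?Dp.
have g1p y : 0 <= y -> 0 <= g1 y.
  move=> y0.
  have <- : g1 0 = 0 by rewrite /g1 expR0 mul0r mulr1 addrNK divr1; ring.
  apply: ge0_of_derive y0 g1d _ => z _.
  rewrite subr_ge0 ler_pdivrMr ?exprn_gt0//.
  have := sqr_ge0 (1 - p - p * expR z); nra.
pose g (y : R) := y ^+ 2 / 8 + p * y - ln (1 - p + p * expR y).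
have gd (y : R) : is_derive y (1 : R) g (g1 y).
  have dl := @is_derive1_comp R (@ln R) (fun y : R => 1 - p + p * expR y) y _ _ (is_derive1_ln (Dp y)) (dD y).
  have H : is_derive y (1 : R) (fun y : R => y ^+ 2 / 8 + p * y) (y / 4 + p).
    by apply: is_derive_eq; rewrite /GRing.scale/=; field.
  have K := is_deriveB H dl.
  apply: (is_derive_eq K); rewrite /g1.
  by field; rewrite gt_eqF ?Dp.
have : g 0 <= g h by apply: (ge0_of_derive h0 gd g1p).
rewrite /g expR0 mulr1 subrK ln1 expr0n/= mul0r mulr0 addr0 subr0 subr_ge0 => lnle.
by rewrite -[leLHS]lnK ?posrE ?Dp// ler_expR [leRHS]addrC.
Qed.

Lemma hoeffding_lemma (p h : R) : 0 <= p <= 1 ->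
  1 - p + p * expR h <= expR (p * h + h ^+ 2 / 8).
Proof.
move=> p01; have [h0|h0] := leP 0 h; first exact: hoeffding_lemma_pos.
have := @hoeffding_lemma_pos (1 - p) (- h).
have -> : 0 <= 1 - p <= 1 by move: p01 => /andP[? ?]; apply/andP; split; lra.
move=> /(_ isT); rewrite oppr_ge0 ltW// => /(_ isT) H.
have -> : p * h + h ^+ 2 / 8 = h + ((1 - p) * - h + (- h) ^+ 2 / 8) by field.
rewrite expRD; apply: le_trans (ler_wpM2l (expR_ge0 h) H).
rewrite mulrDr [(1 - p) * _]mulrC [X in _ <= _ + X]mulrA -expRD subrr expR0 mul1r.
by rewrite le_eqVlt; apply/orP; left; apply/eqP; ring.
Qed.

Lemma expR_chord (t x : R) : 0 <= t <= 1 -> expR (t * x) <= 1 - t + t * expR x.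
Proof.
move=> /andP[t0 t1].
have h1 := expR_ge1Dx (- (t * x)); have h2 := expR_ge1Dx (x - t * x).
have e0 := expR_ge0 (t * x).
have E1 : 1 = expR (t * x) * expR (- (t * x)) by rewrite -expRD subrr expR0.
have E2 : expR x = expR (t * x) * expR (x - t * x) by rewrite -expRD addrC subrK.
rewrite [X in X - t]E1 E2.
have -> : expR (t * x) * expR (- (t * x)) - t + t * (expR (t * x) * expR (x - t * x)) =
    expR (t * x) * ((1 - t) * expR (- (t * x)) + t * expR (x - t * x)).
  by rewrite -[X in _ - X]mulr1 [in X in _ - X]E1; ring.
rewrite -[leLHS]mulr1 ler_wpM2l//.
by nra.
Qed.

(** Convexity replaces the exponential by its chord over [[0, b]], so the moment is at most that of
    a variable with values 0 and [b] and the same mean. *)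
Lemma hoeffding_mgf (A : finType) (f : A -> R) (b lam : R) : (0 < #|A|)%N -> 0 < b ->
  (forall a, 0 <= f a <= b) ->
  avg (fun a => expR (lam * (f a - avg f))) <= expR (lam ^+ 2 * b ^+ 2 / 8).
Proof.
move=> A0 b0 fb.
have m0 : 0 <= avg f by apply: avg_ge0 => a; case/andP: (fb a).
have mb : avg f <= b.
  by rewrite -(avg_const b A0); apply: le_avg => a; case/andP: (fb a).
pose p := avg f / b.
have p01 : 0 <= p <= 1 by rewrite /p divr_ge0 ?(ltW b0)//= ler_pdivrMr ?mul1r.
have chord a : expR (lam * f a) <= 1 + f a * ((expR (lam * b) - 1) / b).
  have /andP[fa0 fab] := fb a.
  have t01 : 0 <= f a / b <= 1 by rewrite divr_ge0 ?(ltW b0)//= ler_pdivrMr ?mul1r.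
  have /andP[t0 t1] := t01.
  have -> : lam * f a = f a / b * (lam * b) by field; rewrite gt_eqF.
  apply: le_trans (expR_chord (lam * b) t01) _.
  by rewrite le_eqVlt; apply/orP; left; apply/eqP; field; rewrite gt_eqF.
apply: (@le_trans _ _ (expR (- (lam * avg f)) * (1 - p + p * expR (lam * b)))).
  rewrite (eq_avg (g := fun a => expR (- (lam * avg f)) * expR (lam * f a))); last first.
    by move=> a; rewrite -expRD; congr expR; ring.
  rewrite avgZ ler_wpM2l ?expR_ge0//; apply: le_trans (le_avg chord) _.
  rewrite avgD avg_const// (eq_avg (g := fun a => ((expR (lam * b) - 1) / b) * f a)); last first.
    by move=> a; rewrite mulrC.
  by rewrite avgZ /p le_eqVlt; apply/orP; left; apply/eqP; field; rewrite gt_eqF.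
apply: le_trans (ler_wpM2l (expR_ge0 _) (hoeffding_lemma (lam * b) p01)) _.
rewrite -expRD ler_expR /p le_eqVlt; apply/orP; left; apply/eqP.
by field; rewrite gt_eqF.
Qed.

Definition row_of (n s l : nat) (J : {ffun 'I_l * 'I_s -> 'I_n}) (i : 'I_l) :
  {ffun 'I_s -> 'I_n} := [ffun j => J (i, j)].

Lemma avg_rows_prod (n s l : nat) (f : 'I_l -> {ffun 'I_s -> 'I_n} -> R) :
  avg (fun J : {ffun 'I_l * 'I_s -> 'I_n} => \prod_i f i (row_of J i)) =
  \prod_i avg (f i).
Proof.
rewrite -avg_ffun_prod /avg; congr (_ * _).
  by rewrite !card_ffun !card_prod !card_ord expnM expnAC.
pose unc (K : {ffun 'I_l -> {ffun 'I_s -> 'I_n}}) : {ffun 'I_l * 'I_s -> 'I_n} :=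
  [ffun p => K p.1 p.2].
rewrite (reindex unc)/=.
  apply: eq_bigr => K _; apply: eq_bigr => i _; congr (f i _).
  by apply/ffunP => j; rewrite !ffunE.
exists (fun J => [ffun i => row_of J i]) => [K|J] _.
  by apply/ffunP => i; apply/ffunP => j; rewrite !ffunE.
by apply/ffunP => -[i j]; rewrite !ffunE.
Qed.

(** Markov's inequality: [G] dominates the indicator of failure. *)
Lemma proc_prob_ge (n s l : nat) (E : {ffun 'I_l * 'I_s -> 'I_n} -> bool)
    (G : {ffun 'I_l * 'I_s -> 'I_n} -> R) (eps : R) : (0 < n)%N ->
  (forall J, 0 <= G J) -> (forall J, ~~ E J -> 1 <= G J) -> avg G <= eps ->
  1 - eps <= proc_prob n s l E.
Proof.
move=> n0 G0 GE Geps.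
have C0 : 0 < #|{: {ffun 'I_l * 'I_s -> 'I_n}}|%:R :> R.
  by rewrite ltr0n card_ffun expn_gt0 card_ord n0.
have -> : proc_prob n s l E = 1 - avg (fun J => (~~ E J)%:R) :> R.
  rewrite /proc_prob /avg mulrC; apply/eqP; rewrite eq_sym subr_eq -mulrDr.
  rewrite -[X in _ == _ * (X%:R + _)]sum1_card natr_sum big_mkcond/= -big_split/=.
  rewrite (eq_bigr (fun=> 1)); first by rewrite sumr_const mulVf// gt_eqF.
  move=> J _; case: (boolP (E J)) => EJ.
    by rewrite mem_set// addr0.
  by rewrite memNset ?add0r//; exact/negP.
rewrite lerD2l lerN2; apply: le_trans Geps; apply: le_avg => J.
by case: (boolP (E J)) => [_|/GE].
Qed.

Lemma hoeffding_upper (n s l : nat) (F : {ffun 'I_s -> 'I_n} -> R) (b eps : R) :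
  (0 < n)%N -> (0 < l)%N -> 0 < eps < 1 -> (forall r, 0 <= F r <= b) ->
  1 - eps <= proc_prob n s l (fun J => l%:R^-1 * \sum_i F (row_of J i) <=
     avg F + Num.sqrt (b ^+ 2 / (2 * l%:R) * ln eps^-1)).
Proof.
move=> n0 l0 /andP[e0 e1] Fb.
have A0 : (0 < #|{: {ffun 'I_s -> 'I_n}}|)%N by rewrite card_ffun expn_gt0 card_ord n0.
have lR : 0 < l%:R :> R by rewrite ltr0n.
have ln0 : 0 < ln eps^-1 by rewrite ln_gt0// invf_gt1.
have [b0|b0] := ltP 0 b; last first.
  have F0 r : F r = 0.
    by apply/eqP; rewrite eq_le; case/andP: (Fb r) => -> /le_trans -> //.
  apply: (@proc_prob_ge _ _ _ _ (fun=> 0)) => //.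
    move=> J; rewrite big1 ?mulr0; last by move=> i _; rewrite F0.
    by rewrite addr_ge0 ?sqrtr_ge0// avg_ge0// => r; rewrite F0.
  by rewrite /avg big1 ?mulr0// ltW.
set t := Num.sqrt _.
have t2 : t ^+ 2 = b ^+ 2 / (2 * l%:R) * ln eps^-1.
  by rewrite sqr_sqrtr// mulr_ge0 ?divr_ge0 ?sqr_ge0 ?mulr_ge0// ltW.
(* Minimises [- lam * l * t + l * lam^2 * b^2 / 8]; the minimum [- 2 * l * t^2 / b^2] equals
   [ln eps] by the choice of [t]. *)
pose lam := 4 * t / b ^+ 2.
have lam0 : 0 <= lam by rewrite divr_ge0 ?sqr_ge0// mulr_ge0// sqrtr_ge0.
apply: (@proc_prob_ge _ _ _ _
  (fun J => expR (- (lam * l%:R * t)) * \prod_i expR (lam * (F (row_of J i) - avg F)))) => //.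
- by move=> J; rewrite mulr_ge0 ?expR_ge0// prodr_ge0// => i _; exact: expR_ge0.
- move=> J; rewrite -ltNge => h; rewrite -expR_sum -expRD -[leLHS]expR0 ler_expR.
  rewrite -mulr_sumr sumrB sumr_const card_ord -mulr_natl.
  have : l%:R * (avg F + t) <= \sum_i F (row_of J i) by rewrite -ler_pdivlMl// ltW.
  by move=> h2; nra.
rewrite avgZ (avg_rows_prod (fun i r => expR (lam * (F r - avg F)))).
rewrite prodr_const card_ord.
apply: (@le_trans _ _ (expR (- (lam * l%:R * t)) * (expR (lam ^+ 2 * b ^+ 2 / 8)) ^+ l)).
  rewrite ler_wpM2l ?expR_ge0// lerXn2r ?nnegrE ?expR_ge0//.
    by apply: avg_ge0 => r; exact: expR_ge0.
  exact: hoeffding_mgf.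
rewrite -expRM_natl -expRD.
have -> : - (lam * l%:R * t) + l%:R * (lam ^+ 2 * b ^+ 2 / 8) = - (2 * l%:R / b ^+ 2) * t ^+ 2.
  by rewrite /lam; field; rewrite gt_eqF.
rewrite t2 (_ : _ * _ = - ln eps^-1); last by field; rewrite !gt_eqF.
by rewrite lnV ?posrE// opprK lnK.
Qed.

Lemma hoeffding_lower (n s l : nat) (F : {ffun 'I_s -> 'I_n} -> R) (b eps : R) :
  (0 < n)%N -> (0 < l)%N -> 0 < eps < 1 -> (forall r, 0 <= F r <= b) ->
  1 - eps <= proc_prob n s l (fun J =>
     avg F - Num.sqrt (b ^+ 2 / (2 * l%:R) * ln eps^-1) <= l%:R^-1 * \sum_i F (row_of J i)).
Proof.
move=> n0 l0 e01 Fb.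
have A0 : (0 < #|{: {ffun 'I_s -> 'I_n}}|)%N by rewrite card_ffun expn_gt0 card_ord n0.
have := @hoeffding_upper n s l (fun r => b - F r) b eps n0 l0 e01.
have Fb' r : 0 <= b - F r <= b by case/andP: (Fb r) => ? ?; apply/andP; split; lra.
move=> /(_ Fb') /le_trans; apply; rewrite le_eqVlt; apply/orP; left; apply/eqP.
congr (_%:R / _); apply: eq_card => J.
have -> : avg (fun r => b - F r) = b - avg F.
  rewrite avgD avg_const//; congr (_ + _).
  by rewrite (eq_avg (g := fun r => -1 * F r)) ?avgZ ?mulN1r// => r; rewrite mulN1r.
have lE : l%:R^-1 * \sum_(i < l) (b - F (row_of J i)) =
    b - l%:R^-1 * \sum_(i < l) F (row_of J i).
  by rewrite sumrB sumr_const card_ord mulrBr -[b *+ l]mulr_natl mulKf// pnatr_eq0 -lt0n.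
by apply/idP/idP => /set_mem/= h; apply/mem_set => /=; move: h; rewrite lE; lra.
Qed.
End hoeffding.

(** * Multiplicities when sampling with replacement *)

Section multiplicity.
Variables (R : realType) (n s : nat).
Implicit Type r : {ffun 'I_s -> 'I_n}.

Definition mult r i : nat := #|[set j | r j == i]%SET|.
Definition max_mult r : nat := \max_i mult r i.

Lemma mult_le r i : (mult r i <= max_mult r)%N.
Proof. exact: (leq_bigmax_cond (F := mult r)). Qed.

Lemma sum_mult r : (\sum_i mult r i = s)%N.
Proof.
transitivity (\sum_(j < s) 1)%N; last by rewrite sum1_card card_ord.
rewrite (partition_big r predT)//=; apply: eq_bigr => i _.
by rewrite /mult -sum1_card; apply: eq_bigl => j; rewrite inE.
Qed.

Lemma bernoulli_ineq (c : R) (N : nat) : 0 <= c -> 1 + c * N%:R <= (1 + c) ^+ N.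
Proof.
move=> c0; elim: N => [|N IH]; first by rewrite mulr0 addr0 expr0.
rewrite exprS -natr1.
have h : (1 + c) * (1 + c * N%:R) <= (1 + c) * (1 + c) ^+ N.
  by rewrite ler_wpM2l// addr_ge0.
apply: le_trans h; have : 0 <= c * c * N%:R by rewrite !mulr_ge0.
by nra.
Qed.

(** With [1 + c = exp tau], the function [psi N = (1 + c)^N - 1 - c N] vanishes at 0 and 1, so only
    indices drawn at least twice count, and the mean of its sum is of order [s^2 / n] rather than
    [s]. That sum over all indices dominates the exponential of the maximum. *)
Lemma avg_max_mult (tau : R) : (0 < n)%N -> (s <= n)%N -> 0 < tau -> 2 <= expR tau ->
  avg (fun r => (max_mult r)%:R) <=
  1 + tau^-1 * ln (1 + (expR tau - 1) ^+ 2 * expR (expR tau - 1) * (s%:R ^+ 2 / n%:R)).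
Proof.
move=> n0 sn tau0 E2.
set c := expR tau - 1; have c1 : 1 <= c by rewrite lerBrDr (_ : 1 + 1 = 2).
have c0 : 0 <= c by apply: le_trans c1.
have Ec : expR tau = 1 + c by rewrite /c addrC subrK.
have nR : 0 < n%:R :> R by rewrite ltr0n.
have A0 : (0 < #|{: {ffun 'I_s -> 'I_n}}|)%N by rewrite card_ffun expn_gt0 card_ord n0.
set y0 := 1 + c ^+ 2 * expR c * (s%:R ^+ 2 / n%:R).
have y00 : 0 < y0.
  by rewrite ltr_pwDl// mulr_ge0 ?mulr_ge0 ?sqr_ge0 ?expR_ge0 ?divr_ge0 ?sqr_ge0.
pose psi (N : nat) : R := (1 + c) ^+ N - 1 - c * N%:R.
have psi0 N : 0 <= psi N by rewrite /psi -addrA -opprD subr_ge0 bernoulli_ineq.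
have key r : expR (tau * ((max_mult r)%:R - 1)) <= 1 + \sum_i psi (mult r i).
  have [e|m0] := posnP (max_mult r).
    apply: (@le_trans _ _ 1); last by rewrite lerDl sumr_ge0.
    by rewrite -[leRHS]expR0 ler_expR e sub0r mulrN1 oppr_le0 ltW.
  have [i0 mi] : exists i0, max_mult r = mult r i0.
    by have [|i0 e] := bigop.eq_bigmax (mult r); [rewrite card_ord|exists i0; exact: e].
  apply: (@le_trans _ _ (1 + psi (mult r i0))); last first.
    by rewrite lerD2l (bigD1 i0)//= lerDl sumr_ge0.
  rewrite -mi; move: m0; case: (max_mult r) => // m _.
  rewrite -natr1 addrK mulrC expRM_natl Ec /psi.
  have h : m.+1%:R <= (1 + c) ^+ m.
    apply: le_trans (_ : (1 + 1) ^+ m <= _); last first.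
      by apply: lerXn2r; rewrite ?nnegrE; lra.
    by have := bernoulli_ineq m (@ler01 R); rewrite mul1r -natr1 addrC.
  rewrite exprS -natr1; rewrite -natr1 in h.
  have : c * (m%:R + 1) <= c * (1 + c) ^+ m by rewrite ler_wpM2l.
  by nra.
have avgkey : avg (fun r => 1 + \sum_i psi (mult r i)) <= y0.
  rewrite avgD avg_const// lerD2l.
  have -> : avg (fun r => \sum_i psi (mult r i)) =
      n%:R * (1 + c / n%:R) ^+ s - n%:R - c * s%:R.
    rewrite (eq_avg (g := fun r => (\sum_i (1 + c) ^+ mult r i) + (- (n%:R + c * s%:R)))); last first.
      move=> r; rewrite /psi !sumrB sumr_const card_ord -mulr_sumr -natr_sum sum_mult.
      by ring.
    rewrite avgD avg_const// opprD addrA; congr (_ - _ - _).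
    rewrite avg_sum (eq_bigr (fun=> (1 + c / n%:R) ^+ s)); last first.
      move=> i _.
      rewrite (eq_avg (g := fun r : {ffun 'I_s -> 'I_n} => \prod_j (if r j == i then 1 + c else 1))); last first.
        move=> r; rewrite -big_mkcond/= prodr_const /mult; congr (_ ^+ _).
        by apply: eq_card => j; rewrite inE.
      rewrite (avg_ffun_prod (fun j a => if a == i then 1 + c else 1)) prodr_const card_ord.
      congr (_ ^+ _); rewrite /avg (bigD1 i)//= eqxx.
      rewrite (eq_bigr (fun=> 1)); last by move=> j /negbTE ->.
      have nE : n%:R = n.-1%:R + 1 :> R by rewrite natr1 prednK.
      rewrite sumr_const cardC1 card_ord nE; field.
      by rewrite -nE gt_eqF.
    by rewrite sumr_const card_ord mulr_natl.
  pose y := c * s%:R / n%:R.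
  have y_ge0 : 0 <= y by rewrite /y !mulr_ge0 ?invr_ge0.
  have yc : y <= c.
    by rewrite /y -mulrA ler_piMr// ler_pdivrMr// mul1r ler_nat.
  have pw : (1 + c / n%:R) ^+ s <= expR y.
    have -> : y = s%:R * (c / n%:R) by rewrite /y; ring.
    rewrite expRM_natl lerXn2r ?nnegrE ?expR_ge0 ?expR_ge1Dx//.
    by rewrite addr_ge0// divr_ge0.
  have ey : expR y - 1 <= y * expR y.
    have := expR_ge1Dx (- y); rewrite expRN => h.
    have e0 := expR_gt0 y.
    have : expR y * (1 - y) <= expR y * (expR y)^-1 by rewrite ler_wpM2l// ltW.
    by rewrite mulfV ?gt_eqF//; lra.
  have eyc : expR y <= expR c by rewrite ler_expR.
  apply: (@le_trans _ _ (n%:R * (expR y - 1 - y))).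
    have -> : c * s%:R = n%:R * y by rewrite /y; field; rewrite gt_eqF.
    have := ler_wpM2l (ltW nR) pw; nra.
  have -> : c ^+ 2 * expR c * (s%:R ^+ 2 / n%:R) = n%:R * (y ^+ 2 * expR c).
    by rewrite /y; field; rewrite gt_eqF.
  apply: ler_wpM2l; first exact: ltW.
  apply: (@le_trans _ _ (y * (expR y - 1))); first by nra.
  rewrite expr2 -mulrA ler_wpM2l//.
  by apply: le_trans ey _; rewrite ler_wpM2l.
(* Jensen for the logarithm, as a pointwise tangent bound at [y0]; averaging it is linear. *)
have H r : (max_mult r)%:R <= (1 + tau^-1 * (ln y0 - 1)) +
     (tau^-1 / y0) * (1 + \sum_i psi (mult r i)).
  have h : 1 + (tau * ((max_mult r)%:R - 1) - ln y0) <= (1 + \sum_i psi (mult r i)) / y0.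
    apply: le_trans (expR_ge1Dx _) _.
    by rewrite expRB lnK ?posrE// ler_wpM2r ?invr_ge0 ?(ltW y00)// key.
  have ti : 0 <= tau^-1 by rewrite invr_ge0 ltW.
  have := ler_wpM2l ti h; set S := \sum_i _ => h2.
  have -> : (max_mult r)%:R = 1 + tau^-1 * (ln y0 - 1) + tau^-1 * (1 + (tau * ((max_mult r)%:R - 1) - ln y0)) :> R.
    by field; rewrite gt_eqF.
  by rewrite lerD2l -mulrA [y0^-1 * _]mulrC.
apply: le_trans (le_avg H) _.
rewrite avgD avg_const// avgZ.
have h : tau^-1 / y0 * avg (fun r => 1 + \sum_i psi (mult r i)) <= tau^-1 / y0 * y0.
  by rewrite ler_wpM2l// divr_ge0 ?invr_ge0 ?(ltW tau0)// ltW.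
rewrite divfK ?gt_eqF// in h; lra.
Qed.

Definition level r (t : 'I_s) : {set 'I_n} := [set i | (t < mult r i)%N]%SET.

Lemma mult_le_s r i : (mult r i <= s)%N.
Proof. by rewrite -[leqRHS]card_ord; exact: max_card. Qed.

(** Layer-cake identity: a sample with repetitions becomes a sum over sets without repetitions, to
    which bounds on random subsets apply. *)
Lemma sum_level (r : {ffun 'I_s -> 'I_n}) (f : 'I_n -> R) :
  \sum_j f (r j) = \sum_t \sum_(i in level r t) f i.
Proof.
have -> : \sum_t \sum_(i in level r t) f i = \sum_i (mult r i)%:R * f i.
  under eq_bigr do rewrite big_mkcond/=.
  rewrite exchange_big/=; apply: eq_bigr => i _.
  under eq_bigr do rewrite inE.
  rewrite -big_mkcond/= sumr_const mulr_natl; congr (_ *+ _).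
  rewrite -[RHS]card_ord -[RHS]sum1_card (big_ord_widen s (fun=> 1%N) (mult_le_s r i)).
  by rewrite sum1_card; apply: eq_card.
rewrite (partition_big r predT)//=; apply: eq_bigr => i _.
rewrite (eq_bigr (fun=> f i)); last by move=> j /eqP ->.
by rewrite sumr_const mulr_natl /mult cardsE.
Qed.

Lemma card_level_nonempty r : #|[set t | level r t != finset.set0]%SET| = max_mult r.
Proof.
have ms : (max_mult r <= s)%N by apply/bigmax_leqP => i _; exact: mult_le_s.
have -> : #|[set t | level r t != finset.set0]%SET| = (\sum_(t < s | (t < max_mult r)%N) 1)%N.
  rewrite -sum1_card; apply: eq_bigl => t; rewrite inE.
  apply/set0Pn/idP => [[i]|tm]; first by rewrite /level inE => /leq_trans; apply; exact: mult_le.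
  have n0 : (0 < #|'I_n|)%N.
    rewrite lt0n; apply: contraL tm => /eqP c0; rewrite -leqNgt.
    by apply/bigmax_leqP => i _; have := fintype0 i c0.
  by have [i0 e] := bigop.eq_bigmax (mult r) n0; exists i0; rewrite /level inE -e.
by rewrite -(big_ord_widen s (fun=> 1%N) ms) sum1_card card_ord.
Qed.
End multiplicity.

(** * Gaussian integrals under the joint law *)

Section gauss_integral_sec.
Variable R : realType.
Local Notation mu := (@lebesgue_measure R).
Local Notation gam := (normal_prob (0 : R) 1).

Import HBNNSimple.

Lemma ge0_integral_normal_prob (f : measurableTypeR R -> \bar R) :
  measurable_fun setT f -> (forall x, 0 <= f x)%E ->
  (\int[gam]_x f x = \int[mu]_x (f x * (normal_pdf 0 1 x)%:E))%E.
Proof.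
move=> mf f0.
have mpdf : measurable_fun setT (fun x : measurableTypeR R => (normal_pdf 0 1 x)%:E).
  by apply/measurable_EFinP; exact: measurable_normal_pdf.
have pdf0 x : (0 <= (normal_pdf (0 : R) 1 x)%:E)%E by rewrite lee_fin normal_pdf_ge0.
pose g := nnsfun_approx measurableT mf.
have simple n : (\int[gam]_x (g n x)%:E = \int[mu]_x ((g n x)%:E * (normal_pdf 0 1 x)%:E))%E.
  transitivity (\sum_(k \in range (g n))
      \int[mu]_x ((k * \1_(g n @^-1` [set k]) x)%:E * (normal_pdf 0 1 x)%:E))%E; last first.
    rewrite -ge0_integral_fsum//=; last 2 first.
    - move=> k; apply: emeasurable_funM => //; exact/measurable_EFinP/measurable_funM.
    - by move=> k x _; rewrite mule_ge0// nnfun_muleindic_ge0.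
    apply: eq_integral => x _.
    rewrite -ge0_mule_fsuml; last by move=> k; rewrite nnfun_muleindic_ge0.
    by congr (_ * _)%E; rewrite [in LHS]fsumEFin// -fimfunE.
  under eq_integral do rewrite fimfunE -fsumEFin//.
  rewrite ge0_integral_fsum//; last 2 first.
  - by move=> k; exact/measurable_EFinP/measurable_funM.
  - by move=> k x _; rewrite nnfun_muleindic_ge0.
  apply: eq_fsbigr => k _.
  rewrite integralZl_indic_nnsfun// integral_indic//= setIT.
  under [RHS]eq_integral do rewrite EFinM -muleA.
  have [k0|k0] := leP 0 k; last first.
    rewrite preimage_nnfun0// measure0 mule0 integral0_eq// => x _.
    by rewrite indicE in_set0 mul0e mule0.
  rewrite ge0_integralZl_EFin//=; last 2 first.
  - by move=> x _; rewrite mule_ge0// lee_fin indicE.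
  - by apply: emeasurable_funM => //; exact/measurable_EFinP.
  congr (_ * _)%E; rewrite /normal_prob integral_mkcond/=; apply: eq_integral => x _.
  by rewrite patchE indicE; case: ifPn => _; rewrite ?mul1e// mul0e.
transitivity (limn (fun n => \int[gam]_x (g n x)%:E)%E).
  rewrite -monotone_convergence//.
  - apply: eq_integral => x _; apply/esym/cvg_lim => //.
    exact: cvg_nnsfun_approx.
  - by move=> n; exact/measurable_EFinP.
  - by move=> n x _; rewrite lee_fin.
  - by move=> x _ m n mn; rewrite lee_fin; exact/lefP/nd_nnsfun_approx.
under eq_fun do rewrite simple.
rewrite -monotone_convergence//.
- apply: eq_integral => x _; apply/cvg_lim => //.
  apply: cvgeZr => //; exact: cvg_nnsfun_approx.
- by move=> n; apply: emeasurable_funM => //; exact/measurable_EFinP.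
- by move=> n x _; rewrite mule_ge0// lee_fin.
- move=> x _ m n mn; rewrite lee_wpmul2r// lee_fin.
  exact/lefP/nd_nnsfun_approx.
Qed.

Lemma gauss_quad_integral (al r v : R) : 0 < 1 + 2 * al * v ^+ 2 ->
  (\int[gam]_z (expR (- al * (r + v * z) ^+ 2))%:E =
   ((Num.sqrt (1 + 2 * al * v ^+ 2))^-1 *
      expR (- (al / (1 + 2 * al * v ^+ 2)) * r ^+ 2))%:E)%E.
Proof.
set D := 1 + _ => D0.
have D1 : D != 0 by rewrite gt_eqF.
rewrite ge0_integral_normal_prob//; last first.
  apply/measurable_EFinP; apply: measurableT_comp => //=.
  apply: measurable_funM => //; apply: measurable_funX => //.
  by apply: measurable_funD => //; apply: measurable_funM.
(* Completing the square: the integrand times the standard density is a constant times the normal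
   density of mean [m] and standard deviation [sg]. *)
pose sg := (Num.sqrt D)^-1; pose m := - 2 * al * v * r / D.
have sg0 : 0 < sg by rewrite invr_gt0 sqrtr_gt0.
have sgE : sg ^+ 2 = D^-1 by rewrite exprVn sqr_sqrtr// ltW.
transitivity (\int[mu]_z ((sg * expR (- (al / D) * r ^+ 2))%:E * (normal_pdf m sg z)%:E))%E.
  apply: eq_integral => z _; rewrite -!EFinM; congr (_%:E).
  have peakE : normal_peak sg = (Num.sqrt D) * normal_peak (1 : R).
    rewrite /normal_peak sgE expr1n mul1r -mulrnAr sqrtrM ?invr_ge0 ?ltW//.
    by rewrite sqrtrV ?ltW// invfM invrK.
  rewrite !normal_pdfE ?gt_eqF// peakE /normal_fun.
  rewrite mulrCA -expRD.
  transitivity (sg * Num.sqrt D * normal_peak 1 *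
    (expR (- (al / D) * r ^+ 2) * expR (- (z - m) ^+ 2 / (sg ^+ 2 *+ 2)))); last by ring.
  rewrite /sg mulVf ?mul1r ?gt_eqF ?sqrtr_gt0// -/sg -expRD; congr (_ * expR _).
  have -> : - (z - m) ^+ 2 / (sg ^+ 2 *+ 2) = - (z - m) ^+ 2 * D / 2.
    by rewrite sgE -mulr_natr; field.
  by rewrite /m -mulr_natr expr1n /D; field; rewrite -/D D1.
rewrite ge0_integralZl_EFin//=; last 3 first.
- by move=> x _; rewrite lee_fin normal_pdf_ge0.
- by apply/measurable_EFinP; exact: measurable_normal_pdf.
- by rewrite mulr_ge0 ?expR_ge0// ltW.
by rewrite integral_normal_pdf mule1.
Qed.
End gauss_integral_sec.

Section measurable_finite.
Context d (T : measurableType d) (R : realType) (J : finType).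

Lemma measurable_fin_sum (P : pred J) (h : J -> T -> R) :
  (forall j, measurable_fun setT (h j)) ->
  measurable_fun setT (fun x => \sum_(j | P j) h j x).
Proof.
move=> mh; rewrite (_ : (fun x => _) = fun x => \sum_(j <- enum P) h j x).
  exact: measurable_sum.
by apply/funext => x; rewrite big_enum.
Qed.

Lemma measurable_fin_prod (P : pred J) (h : J -> T -> R) :
  (forall j, measurable_fun setT (h j)) ->
  measurable_fun setT (fun x => \prod_(j | P j) h j x).
Proof.
move=> mh; rewrite (_ : (fun x => _) = fun x => \prod_(j <- enum P) h j x).
  by apply: measurable_prod => j _.
by apply/funext => x; rewrite big_enum.
Qed.
End measurable_finite.

(** * Gaussian product laws, integrated one coordinate at a time *)

Section resampling.
Variables (R : realType) (I : finType).
Local Notation gam := (normal_prob (0 : R) 1).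

Definition rect (B : I -> set R) : set (I -> R) := [set f | forall a, B a (f a)].

Definition rects : set (set (I -> R)) :=
  [set rect B | B in [set B | forall a, measurable (B a)]].

Local Notation cylType := (g_sigma_algebraType rects).

Definition upd (f : I -> R) (a : I) (z : R) : I -> R :=
  fun b => if b == a then z else f b.

Lemma measurable_rect B : (forall a, measurable (B a)) ->
  measurable (rect B : set cylType).
Proof. by move=> mB; apply: sub_sigma_algebra; exists B. Qed.

Lemma measurable_proj (a : I) : measurable_fun setT (fun f : cylType => f a : R).
Proof.
move=> _ A mA; rewrite setTI.
rewrite (_ : _ @^-1` _ = rect (fun b => if b == a then A else setT)).
  by apply: measurable_rect => b; case: ifP.
apply/seteqP; split => f /=.
  by move=> Aa b; case: eqP => // ->.
by move=> /(_ a); rewrite eqxx.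
Qed.

Lemma measurable_cyl d (T : measurableType d) (h : T -> cylType) :
  (forall a, measurable_fun setT (fun x => h x a : R)) -> measurable_fun setT h.
Proof.
move=> mh; refine (@measurability _ _ _ _ setT h rects _ _) => //.
move=> _ [_ [B mB <-] <-]; rewrite setTI.
rewrite (_ : _ @^-1` _ = \big[setI/setT]_(a : I) ((fun x => h x a) @^-1` B a)).
  by apply: bigsetI_measurable => a _; rewrite -[X in measurable X]setTI; exact: mh.
rewrite -bigcap_seq.
by apply/seteqP; split => x /= hx a; [move=> _; exact: hx|exact: hx (mem_index_enum a)].
Qed.

Lemma measurable_upd (a : I) :
  measurable_fun setT (fun p : cylType * measurableTypeR R => upd p.1 a p.2 : cylType).
Proof.
apply: measurable_cyl => b; rewrite /upd; case: (b == a).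
  exact: measurable_snd.
exact: (measurableT_comp (measurable_proj b) measurable_fst).
Qed.

Lemma cyl_measure_unique (m1 m2 : {measure set cylType -> \bar R}) :
  (m1 setT < +oo)%E ->
  (forall B, (forall a, measurable (B a)) -> m1 (rect B) = m2 (rect B)) ->
  forall A, measurable A -> m1 A = m2 A.
Proof.
move=> m1T m12 A mA.
have rT : rect (fun=> setT) = setT by apply/seteqP.
refine (@measure_unique _ R cylType rects (fun=> setT) _ _ _ _ m1 m2 _ _ A mA) => //.
- move=> _ _ [B1 mB1 <-] [B2 mB2 <-]; exists (fun a => B1 a `&` B2 a).
    by move=> a; exact: measurableI.
  apply/seteqP; split => f /=.
    by move=> h; split=> a; have [] := h a.
  by move=> [h1 h2] a; split.
- by move=> _; exists (fun=> setT).
- by rewrite bigcup_const//; exists 0%N.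
- by move=> _ [B mB <-]; exact: m12.
Qed.

Section one.
Variables (L : {finite_measure set cylType -> \bar R}) (cL : \bar R).
Hypothesis LE : forall B, (forall a, measurable (B a)) ->
  (L (rect B) = cL * \prod_a gam (B a))%E.

(** On boxes, redrawing coordinate [a] as a fresh normal does not change [L], and boxes determine a
    finite measure. Tonelli then lets the fresh coordinate be integrated first. *)
Lemma resample (a : I) (F : cylType -> \bar R) :
  measurable_fun setT F -> (forall f, 0 <= F f)%E ->
  (\int[L]_f F f = \int[L]_f \int[gam]_z F (upd f a z))%E.
Proof.
move=> mF F0.
have mu := measurable_upd a.
have LL' A : measurable A -> L A = pushforward (L \x gam)%E (fun p => upd p.1 a p.2 : cylType) A.
  apply: (@cyl_measure_unique L (pushforward (L \x gam)%E (fun p => upd p.1 a p.2 : cylType))).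
    exact: fin_num_fun_lty.
  move=> B mB; rewrite [LHS]LE//= /pushforward.
  rewrite (_ : _ @^-1` _ = rect (fun b => if b == a then setT else B b) `*` B a).
    rewrite product_measure1E; [|by refine (measurable_rect _) => b; case: ifP|exact: mB].
    rewrite [X in (_ = X * _)%E]LE; last by move=> b; case: ifP.
    rewrite (bigD1 a)//= [in RHS](bigD1 a)//= eqxx probability_setT mul1e.
    rewrite -muleA; congr (_ * _)%E; rewrite muleC; congr (_ * _)%E.
    by apply: eq_bigr => b /negbTE ->.
  apply/seteqP; split => -[f z] /=; rewrite /rect/upd/=.
    move=> h; split; last by have := h a; rewrite eqxx.
    by move=> b; have := h b; case: ifP.
  by move=> [h1 h2] b; have := h1 b; case: eqP => // ->.
rewrite (eq_measure_integral (pushforward (L \x gam)%E (fun p => upd p.1 a p.2 : cylType))); last first.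
  by move=> A mA _; exact: LL'.
rewrite ge0_integral_pushforward//.
rewrite preimage_setT fubini_tonelli1//; [exact: measurableT_comp|by move=> x; exact: F0].

Qed.

Section quad.
Variables (C : finType) (kap : I -> C) (v : I -> R) (al m : C -> R).
Hypothesis D_gt0 : forall c, 0 < 1 + 2 * al c * \sum_(a | kap a == c) v a ^+ 2.

(** [E s c] is the factor of class [c] once the coordinates in [s] are integrated out: [D] carries
    their variance, and [Q] is what remains of the affine form. *)
Let D (s : seq I) c := 1 + 2 * al c * \sum_(a | (kap a == c) && (a \in s)) v a ^+ 2.
Let Q (s : seq I) c (f : I -> R) := m c + \sum_(a | (kap a == c) && (a \notin s)) v a * f a.
Let E (s : seq I) c (f : I -> R) :=
  (Num.sqrt (D s c))^-1 * expR (- (al c / D s c) * Q s c f ^+ 2).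

Let Ds_gt0 s c : 0 < D s c.
Proof.
have [a0|a0] := leP 0 (al c).
  rewrite ltr_wpDr// mulr_ge0 ?mulr_ge0// sumr_ge0// => a _; exact: sqr_ge0.
apply: lt_le_trans (D_gt0 c) _.
rewrite lerD2l ler_wnM2l//; first by rewrite mulr_ge0_le0// ltW.
rewrite (bigID (fun a => a \in s) (fun a => kap a == c))/= lerDl.
by apply: sumr_ge0 => a _; exact: sqr_ge0.
Qed.

Let E_ge0 s c f : 0 <= E s c f.
Proof. by rewrite mulr_ge0 ?expR_ge0// invr_ge0 sqrtr_ge0. Qed.

Let mE s c : measurable_fun setT (fun f : cylType => E s c f).
Proof.
apply: measurable_funM => //; apply: measurableT_comp => //=.
apply: measurable_funM => //; apply: measurable_funX => //.
apply: measurable_funD => //.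
by apply: measurable_fin_sum => a; apply: measurable_funM => //; exact: measurable_proj.
Qed.

Let step a s : a \notin s ->
  (\int[L]_f (\prod_c E s c f)%:E = \int[L]_f (\prod_c E (a :: s) c f)%:E)%E.
Proof.
move=> as_.
rewrite (resample a); last 2 first.
- apply/measurable_EFinP.
  by apply: measurable_fin_prod => c; exact: mE.
- by move=> f; rewrite lee_fin prodr_ge0.
apply: eq_integral => f _.
have Eneq c z : c != kap a -> E s c (upd f a z) = E (a :: s) c f.
  move=> ca.
  have e (b : I) : (kap b == c) && (b \notin a :: s) = (kap b == c) && (b \notin s).
    rewrite inE negb_or; case: (altP (b =P a)) => //= ->.
    by rewrite eq_sym (negbTE ca).
  have e' (b : I) : (kap b == c) && (b \in a :: s) = (kap b == c) && (b \in s).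
    rewrite inE; case: (altP (b =P a)) => //= ->.
    by rewrite eq_sym (negbTE ca).
  have De : D (a :: s) c = D s c by rewrite /D (eq_bigl _ _ e').
  have Qe : Q s c (upd f a z) = Q (a :: s) c f.
    rewrite /Q (eq_bigl _ _ e); congr (_ + _).
    apply: eq_bigr => b /andP[/eqP kb _]; rewrite /upd.
    by case: eqP => // ba; rewrite -kb ba eqxx in ca.
  by rewrite /E De Qe.
under eq_integral => z _.
  rewrite (bigD1 (kap a))//= (eq_bigr (fun c => E (a :: s) c f)); last first.
    by move=> c ca; rewrite Eneq.
  rewrite mulrC EFinM; over.
rewrite ge0_integralZl_EFin//; last 3 first.
- by move=> z _; rewrite lee_fin.
- apply/measurable_EFinP.
  apply: (@measurableT_comp _ _ _ _ _ _ (fun g : cylType => E s (kap a) g)) => //.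
  apply: measurable_cyl => b; rewrite /upd; case: (b == a) => //.
- exact: prodr_ge0.
rewrite [in RHS](bigD1 (kap a))//= [in RHS]mulrC EFinM; congr (_ * _)%E.
pose r := Q (a :: s) (kap a) f.
have QE z : Q s (kap a) (upd f a z) = r + v a * z.
  rewrite /Q (bigD1 a)/= ?eqxx// {1}/upd eqxx /r /Q -addrA; congr (_ + _).
  rewrite addrC; congr (_ + _); apply: eq_big => [b|b /andP[_ ba]].
    by rewrite inE negb_or andbAC -andbA.
  by rewrite /upd (negbTE ba).
have DE : D (a :: s) (kap a) = D s (kap a) + 2 * al (kap a) * v a ^+ 2.
  rewrite /D -addrA; congr (_ + _); rewrite -mulrDr; congr (_ * _).
  rewrite (bigD1 a)/= ?inE ?eqxx// addrC; congr (_ + _); apply: eq_bigl => b.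
  by rewrite inE; case: (altP (b =P a)) => [->|]/=; rewrite ?(negbTE as_) ?andbF// andbT.
have D0 := Ds_gt0 s (kap a); have D1 := Ds_gt0 (a :: s) (kap a).
have DD : 1 + 2 * (al (kap a) / D s (kap a)) * v a ^+ 2 = D (a :: s) (kap a) / D s (kap a).
  by rewrite DE; field; rewrite gt_eqF.
under eq_integral do rewrite /E QE EFinM.
rewrite ge0_integralZl_EFin//; last first.
  apply/measurable_EFinP; apply: measurableT_comp => //=.
  apply: measurable_funM => //; apply: measurable_funX => //.
  by apply: measurable_funD => //; apply: measurable_funM.
rewrite gauss_quad_integral ?DD ?divr_gt0// -EFinM; congr (_%:E).
rewrite /E -/r mulrA -invfM -sqrtrM ?ltW// [D s _ * _]mulrC divfK ?gt_eqF//.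
by do 4 f_equal; field; rewrite !gt_eqF.
Qed.

Lemma quad_integral :
  (\int[L]_f (expR (- \sum_c al c * (m c + \sum_(a | kap a == c) v a * f a) ^+ 2))%:E =
   L setT * (\prod_c ((Num.sqrt (1 + 2 * al c * \sum_(a | kap a == c) v a ^+ 2))^-1 *
     expR (- (al c / (1 + 2 * al c * \sum_(a | kap a == c) v a ^+ 2)) * m c ^+ 2)))%:E)%E.
Proof.
have H s : uniq s ->
  (\int[L]_f (\prod_c E [::] c f)%:E = \int[L]_f (\prod_c E s c f)%:E)%E.
  by elim: s => // a s IH /= /andP[as_ us]; rewrite IH//; exact: step.
transitivity (\int[L]_f (\prod_c E [::] c f)%:E)%E.
  apply: eq_integral => f _; congr (_%:E).
  rewrite -sumrN expR_sum; apply: eq_bigr => c _.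
  have D1 : D [::] c = 1 by rewrite /D big_pred0 ?mulr0 ?addr0// => b; rewrite andbF.
  rewrite /E D1 sqrtr1 invr1 mul1r mulr1 mulNr /Q.
  have e (b : I) : (kap b == c) && (b \notin [::]) = (kap b == c) by rewrite andbT.
  by rewrite (eq_bigl _ _ e).
rewrite (H (enum I)) ?enum_uniq// muleC -integral_cst//=; apply: eq_integral => f _; congr (_%:E).
apply: eq_bigr => c _; rewrite /E /D /Q.
rewrite [X in m c + X]big_pred0 ?addr0; last by move=> b; rewrite mem_enum andbF.
have e (b : I) : (kap b == c) && (b \in enum I) = (kap b == c) by rewrite mem_enum andbT.
by rewrite (eq_bigl _ _ e).
Qed.
End quad.
End one.
End resampling.

(** * Expectation bounds given the labels *)

Section gbound.
Variables (R : realType) (I : finType).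
Local Notation gam := (normal_prob (0 : R) 1).
Local Notation cylType := (g_sigma_algebraType (@rects R I)).
Implicit Types (M : (I -> R) -> R) (be : R).

Definition product_law (L : {finite_measure set cylType -> \bar R}) : Prop :=
  exists cL : \bar R, forall B, (forall a, measurable (B a)) ->
    (L (rect B) = cL * \prod_a gam (B a))%E.

(* [be] bounds the expectation of the nonnegative statistic [M] of the noise, conditionally on
   any event on the labels, which is why [L] need not have total mass 1. *)
Definition gbound M be : Prop :=
  [/\ measurable_fun setT (M : cylType -> R), (forall f, 0 <= M f) &
      forall L, product_law L -> (\int[L]_f (M f)%:E <= L setT * be%:E)%E].

Lemma gbound_ext M M' be : M =1 M' -> gbound M be -> gbound M' be.
Proof. by move=> /funext ->. Qed.

Lemma gbound_le M be be' : be <= be' -> gbound M be -> gbound M be'.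
Proof.
move=> bb [mM M0 H]; split=> // L HL; apply: le_trans (H L HL) _.
by rewrite lee_wpmul2l// lee_fin.
Qed.

Lemma gbound_scale (w : R) M be : 0 <= w -> gbound M be ->
  gbound (fun f => w * M f) (w * be).
Proof.
move=> w0 [mM M0 H]; split.
- exact: measurable_funM.
- by move=> f; rewrite mulr_ge0.
- move=> L HL; under eq_integral do rewrite EFinM.
  rewrite ge0_integralZl_EFin//; last exact/measurable_EFinP.
    by rewrite EFinM muleCA lee_wpmul2l// ?lee_fin// H.
  by move=> f _; rewrite lee_fin.
Qed.

Lemma gbound_sum (J : finType) (P : pred J) (M : J -> (I -> R) -> R) (be : J -> R) :
  (forall j, P j -> gbound (M j) (be j)) ->
  gbound (fun f => \sum_(j | P j) M j f) (\sum_(j | P j) be j).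
Proof.
move=> H; pose N j := if P j then M j else (fun=> 0).
have HN j : gbound (N j) (if P j then be j else 0).
  rewrite /N; case: ifPn => [/H//|_]; split => // L _.
  by rewrite integral0 mule0.
have -> : (fun f => \sum_(j | P j) M j f) = (fun f => \sum_j N j f).
  apply/funext => f; rewrite big_mkcond; apply: eq_bigr => j _.
  by rewrite /N; case: ifP.
rewrite [X in gbound _ X]big_mkcond; split.
- by apply: measurable_fin_sum => j; case: (HN j).
- by move=> f; apply: sumr_ge0 => j _; case: (HN j).
- move=> L HL; under eq_integral do rewrite -sumEFin.
  rewrite ge0_integral_sum//; last 2 first.
  + by move=> j; apply/measurable_EFinP; case: (HN j).
  + by move=> j f _; rewrite lee_fin; case: (HN j).
  have Lfin : (L setT \is a fin_num)%E by exact: fin_num_measure.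
  rewrite -sumEFin fin_num_sume_distrr//.
  apply: lee_sum => j _; by case: (HN j) => _ _; apply.
Qed.

(** Either alternative, a nonnegative coefficient or no shift, makes the exponential factor left by
    [m] at most 1, so the bound is free of the means. *)
Lemma gbound_quad (C : finType) (kap : I -> C) (v : I -> R) (al m : C -> R) :
  (forall c, 0 < 1 + 2 * al c * \sum_(a | kap a == c) v a ^+ 2) ->
  (forall c, 0 <= al c \/ m c = 0) ->
  gbound (fun f => expR (- \sum_c al c * (m c + \sum_(a | kap a == c) v a * f a) ^+ 2))
    (\prod_c (Num.sqrt (1 + 2 * al c * \sum_(a | kap a == c) v a ^+ 2))^-1).
Proof.
move=> D0 am; split.
- apply: measurableT_comp => //; apply: measurableT_comp => //.
  apply: measurable_fin_sum => c; apply: measurable_funM => //.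
  apply: measurable_funX; apply: measurable_funD => //.
  by apply: measurable_fin_sum => a; apply: measurable_funM => //; exact: measurable_proj.
- by move=> f; exact: expR_ge0.
- move=> L [cL HL]; rewrite (quad_integral HL)// lee_wpmul2l// lee_fin.
  apply: ler_prod => c _; rewrite mulr_ge0 ?expR_ge0 ?invr_ge0 ?sqrtr_ge0//=.
  rewrite ler_piMr ?invr_ge0 ?sqrtr_ge0// -[leRHS]expR0 ler_expR.
  have [a0|->] := am c; last by rewrite expr0n mulr0.
  by rewrite mulNr oppr_le0 mulr_ge0 ?sqr_ge0// divr_ge0// ltW.
Qed.
End gbound.

(** * From expectation bounds to the probability space *)

Section lower_integral.
Context d (T : measurableType d) (R : realType) (P : probability T R).
Import HBNNSimple.

(** [h] may fail to be measurable: the integral of a nonnegative function is a supremum over simple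
    functions below it, among them those below [x * \1_G]. *)
Lemma lower_integral_ge (h : T -> R) (G : set T) (x : R) :
  measurable G -> 0 <= x -> (forall w, 0 <= h w) -> (forall w, G w -> x <= h w) ->
  (x%:E * P G <= \int[P]_w (h w)%:E)%E.
Proof.
move=> mG x0 h0 hG.
apply: (@le_trans _ _ (\int[P]_w (x * \1_G w)%:E)%E).
  under eq_integral do rewrite EFinM.
  rewrite ge0_integralZl_EFin//; last exact/measurable_EFinP.
  by rewrite integral_indic// setIT.
have xG w : (0 <= (x * \1_G w)%:E)%E by rewrite lee_fin mulr_ge0// indicE.
have hE w : (0 <= (h w)%:E)%E by rewrite lee_fin.
rewrite (ge0_integralTE _ xG) (ge0_integralTE _ hE).
apply: ereal_sup_le => _ [g /= gh <-]; exists g => //= w.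
apply: le_trans (gh w) _; rewrite lee_fin indicE.
by case: (boolP (w \in G)) => [/set_mem/hG|_]; rewrite ?mulr1 ?mulr0.
Qed.
End lower_integral.

Section gmm_transfer.
Context (R : realType) (dsp : measure_display) (Omega : measurableType dsp).
Variables (P : probability Omega R) (n d k : nat).
Variables (T : 'I_n -> Omega -> 'I_k) (Z : 'I_n -> 'I_d -> Omega -> R).
Hypothesis noise : gmm_noise P T Z.
Local Notation I := ('I_n * 'I_d)%type.
Local Notation cylType := (g_sigma_algebraType (@rects R I)).

Let Zmap (w : Omega) : cylType := fun a => Z a.1 a.2 w.
Let Tset (tau : {ffun 'I_n -> 'I_k}) := [set w | forall i, T i w = tau i].

Let mZmap : measurable_fun setT Zmap.
Proof. by case: noise => _ mZ _; apply: measurable_cyl => a; exact: mZ. Qed.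

Let mTset tau : measurable (Tset tau).
Proof.
case: noise => mT _ _.
rewrite (_ : Tset tau = \big[setI/setT]_(i < n) (T i @^-1` [set tau i])).
  by apply: bigsetI_measurable => i _.
rewrite -bigcap_seq; apply/seteqP; split => w /= h i; first by move=> _; exact: h.
exact: h (mem_index_enum i).
Qed.

(** The unnormalised law of the noise on the event that the labels are [tau]; its mass is the
    probability of that event. *)
Let lawT tau := pushforward (mrestr P (mTset tau)) Zmap.

Let lawT0 tau : lawT tau set0 = 0%E.
Proof. by rewrite /lawT /pushforward preimage_set0 measure0. Qed.

Let lawT_ge0 tau A : (0 <= lawT tau A)%E.
Proof. exact: measure_ge0. Qed.

Let lawT_add tau : semi_sigma_additive (lawT tau).
Proof. exact: (@measure_semi_sigma_additive _ _ _ (measure_function_pushforward__canonical__measure_function_Measure (mrestr P (mTset tau)) mZmap)). Qed.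

HB.instance Definition _ tau := isMeasure.Build _ _ _ (lawT tau) (lawT0 tau) (lawT_ge0 tau) (@lawT_add tau).

Let lawT_fin tau : fin_num_fun (lawT tau).
Proof.
move=> A mA; rewrite /lawT /pushforward; apply: fin_num_measure.
by rewrite -[X in measurable X]setTI; exact: mZmap.
Qed.

HB.instance Definition _ tau := @Measure_isFinite.Build _ _ _ (lawT tau) (lawT_fin tau).

Let law_prod tau : product_law (lawT tau).
Proof.
exists (\prod_(i < n) (#|[set tau i]%SET|%:R / k%:R)%:E)%E => B mB.
rewrite /= /lawT /pushforward /mrestr.
case: noise => _ _ /(_ (fun i => [set tau i]%SET) (fun i j => B (i, j))) H.
rewrite (_ : _ `&` _ = \bigcap_(i in [set: 'I_n])
   ([set w | T i w \in [set tau i]%SET] `&`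
    \bigcap_(j in [set: 'I_d]) (Z i j @^-1` B (i, j)))); last first.
  apply/seteqP; split => w /=.
    move=> [hZ hT] i _; split; first by rewrite /= hT inE.
    by move=> j _; exact: (hZ (i, j)).
  move=> h; split; first by move=> [i j]; have [_ /(_ j Logic.I)] := h i Logic.I.
  by move=> i; have [+ _] := h i Logic.I; rewrite /= inE => /eqP.
rewrite H// big_split/=; congr (_ * _)%E.
by rewrite pair_big/=; apply: eq_bigr => -[].
Qed.

(** On each label event the noise law is a multiple of the product law, so Markov's inequality
    bounds the failure mass there by [be] times the mass of the event. These events partition the
    space. *)
Lemma gmm_transfer (M : {ffun 'I_n -> 'I_k} -> (I -> R) -> R) (be eps : R) (h : Omega -> R) :
  (forall tau, gbound (M tau) be) -> 0 <= be -> 0 <= eps <= 1 ->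
  (forall w, 0 <= h w) ->
  (forall w, M [ffun i => T i w] (fun a => Z a.1 a.2 w) < 1 -> 1 - eps <= h w) ->
  ((1 - be - eps)%:E <= \int[P]_w (h w)%:E)%E.
Proof.
move=> HM be0 /andP[e0 e1] h0 hG.
pose Bad tau := Tset tau `&` Zmap @^-1` [set f | 1 <= M tau f].
have mBad0 tau : measurable ([set f | 1 <= M tau f] : set cylType).
  have [mM _ _] := HM tau.
  rewrite (_ : [set f | _] = M tau @^-1` `[1, +oo[); last first.
    by apply/seteqP; split => f /=; rewrite in_itv/= andbT.
  by rewrite -[X in measurable X]setTI; exact: mM.
have mBad tau : measurable (Bad tau).
  apply: measurableI => //; rewrite -[X in measurable X]setTI; exact: mZmap.
pose B := \bigcup_tau Bad tau.
have finT : finite_set [set: {ffun 'I_n -> 'I_k}] by exact: finite_finset.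
have mB : measurable B by apply: fin_bigcup_measurable.
have trivT : trivIset setT Tset.
  move=> t1 t2 _ _ [w [h1 h2]]; apply/ffunP => i.
  by rewrite -(h1 i) -(h2 i).
have PB : (P B <= be%:E)%E.
  rewrite /B measure_fin_bigcup//; last first.
    by move=> t1 t2 _ _ [w [[h1 _] [h2 _]]]; apply: trivT => //; exists w.
  apply: (@le_trans _ _ (\sum_(tau \in [set: {ffun 'I_n -> 'I_k}]) (P (Tset tau) * be%:E))%E).
    apply: lee_fsum => // tau _.
    have [mM M0 /(_ (lawT tau) (law_prod tau)) ML] := HM tau.
    have LT : lawT tau setT = P (Tset tau).
      by rewrite /lawT /pushforward /mrestr preimage_setT setTI.
    rewrite -LT; apply: le_trans ML.
    apply: (@le_trans _ _ (\int[lawT tau]_f (\1_[set f | 1 <= M tau f] f)%:E)%E).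
      by rewrite integral_indic// setIT /= /lawT /pushforward /mrestr /Bad setIC.
    apply: ge0_le_integral => //=.
    - exact/measurable_EFinP.
    - exact/measurable_EFinP.
    - move=> f _; rewrite lee_fin indicE.
      by case: (boolP (f \in _)) => [/set_mem|_]; last exact: M0.
  have TU : \bigcup_tau Tset tau = setT.
    apply/seteqP; split => // w _; exists [ffun i => T i w] => // i.
    by rewrite ffunE.
  by rewrite -ge0_mule_fsuml// -measure_fin_bigcup// TU -[leRHS]mul1e lee_wpmul2r ?lee_fin ?probability_le1.
have hB w : (~` B) w -> 1 - eps <= h w.
  move=> nBw; apply: hG; rewrite ltNge; apply/negP => M1; apply: nBw.
  exists [ffun i => T i w] => //.
  by split => //= i; rewrite ffunE.
have e10 : 0 <= 1 - eps by rewrite subr_ge0.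
apply: le_trans _ (lower_integral_ge P (measurableC mB) e10 h0 hB).
have PBf : (P B \is a fin_num)%E by exact: fin_num_measure.
rewrite probability_setC// -(fineK PBf) -EFinB -EFinM lee_fin.
have : fine (P B) <= be by rewrite -lee_fin fineK.
have : 0 <= fine (P B) by rewrite fine_ge0.
by nra.
Qed.
End gmm_transfer.

(** * Covariance norms through a lattice net *)

Section exp_bounds.
Variable R : realType.

Lemma expR_ge_quad (u : R) : 0 <= u -> 1 + u + u ^+ 2 / 2 <= expR u.
Proof.
move=> u0.
have d1 (y : R) : is_derive y (1 : R) (fun y : R => expR y - (1 + y + y ^+ 2 / 2)) (expR y - (1 + y)).
  by apply: is_derive_eq; rewrite /GRing.scale/=; field.
have := ge0_of_derive u0 d1 (fun y _ => _).
rewrite expR0 expr0n/= mul0r !addr0 subrr subr_ge0; apply => y.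
by rewrite subr_ge0 expR_ge1Dx.
Qed.

(** After multiplication by [exp (x^2 - x)], the case [x >= 0] is [(1 + x) (1 - x + x^2) = 1 + x^3];
    negative [x] needs one more term of the exponential. *)
Lemma expR_sub_sqr_le (x : R) : - 2^-1 <= x -> expR (x - x ^+ 2) <= 1 + x.
Proof.
move=> xh; have [x0|x0] := leP 0 x; last first.
  have y0 : 0 <= x ^+ 2 - x by nra.
  have h := expR_ge_quad y0.
  have e0 := expR_gt0 (x ^+ 2 - x).
  have -> : x - x ^+ 2 = - (x ^+ 2 - x) by ring.
  rewrite expRN -[leLHS]mul1r ler_pdivrMr//.
  have x1 : 0 <= 1 + x by lra.
  apply: le_trans (ler_wpM2l x1 h).
  have : 0 <= x ^+ 2 * (1 + x - x ^+ 2 + x ^+ 3).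
    rewrite mulr_ge0 ?sqr_ge0//.
    have -> : 1 + x - x ^+ 2 + x ^+ 3 = 1 + x - x ^+ 2 * (1 - x) by ring.
    nra.
  have -> : (1 + x) * (1 + (x ^+ 2 - x) + (x ^+ 2 - x) ^+ 2 / 2) =
    1 + (x ^+ 2 * (1 + x - x ^+ 2 + x ^+ 3)) / 2 by field.
  lra.
have h := expR_ge1Dx (x ^+ 2 - x).
have e0 := expR_gt0 (x ^+ 2 - x).
have -> : x - x ^+ 2 = - (x ^+ 2 - x) by ring.
rewrite expRN -[leLHS]mul1r ler_pdivrMr//.
have x1 : 0 <= 1 + x by lra.
apply: le_trans (ler_wpM2l x1 h).
have -> : (1 + x) * (1 + (x ^+ 2 - x)) = 1 + x ^+ 3 by ring.
by rewrite lerDl exprn_ge0.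
Qed.

Lemma invsqrt_le_expR (x : R) : - 2^-1 <= x ->
  (Num.sqrt (1 + x))^-1 <= expR (- (x - x ^+ 2) / 2).
Proof.
move=> xh; have h := expR_sub_sqr_le xh.
have e0 := expR_gt0 ((x - x ^+ 2) / 2).
have s0 : 0 < 1 + x by lra.
rewrite mulNr expRN lef_pV2 ?posrE ?sqrtr_gt0 ?expR_gt0//.
rewrite -[leLHS]ger0_norm ?(ltW e0)// -sqrtr_sqr; apply: ler_wsqrtr; rewrite -expRM_natl.
by rewrite (_ : 2%:R * _ = x - x ^+ 2) //; field.
Qed.

Lemma gauss_tail_sum (N : nat) :
  \sum_(k < N) expR (- (k.+1%:R ^+ 2 / 2)) <= expR (- 2^-1) / (1 - expR (- 2^-1) ^+ 3) :> R.
Proof.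
set x := expR (- 2^-1); have x0 : 0 < x by exact: expR_gt0.
have x1 : x < 1 by rewrite expR_lt1 oppr_lt0 invr_gt0.
have x3 : x ^+ 3 < 1 by rewrite exprn_ilt1 ?ltW.
apply: (@le_trans _ _ (\sum_(k < N) x * (x ^+ 3) ^+ k)).
  apply: ler_sum => k _; rewrite -exprM -exprS -expRM_natl ler_expR mulrN lerN2.
  rewrite -[k.+1%:R]natr1 -[((3 * k)%N.+1)%:R]natr1 natrM.
  have : (k%:R : R) <= k%:R ^+ 2.
    by rewrite -natrX ler_nat; case: (k : nat) => // m; rewrite leq_pmulr.
  nra.
rewrite -mulr_sumr; apply: ler_wpM2l; first exact: ltW.
rewrite -[leRHS]mul1r ler_pdivlMr ?subr_gt0//.
have -> : (\sum_(i < N) (x ^+ 3) ^+ i) * (1 - x ^+ 3) = 1 - (x ^+ 3) ^+ N.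
  by rewrite -opprB mulrN mulrC -subrX1 opprB.
by rewrite gerBl exprn_ge0 ?exprn_ge0 ?ltW.
Qed.

(** The sum over all integers is about [sqrt (2 pi)], near 2.507, so [e] leaves little room. It is
    the price per coordinate of summing over the whole lattice. *)
Lemma gauss_lattice_sum (D : nat) :
  \sum_(m < (2 * D).+1) expR (- ((m%:R - D%:R) ^+ 2 / 2)) <= expR 1 :> R.
Proof.
rewrite (_ : (2 * D).+1 = D + D.+1)%N; last by rewrite mul2n -addnn addnS.
rewrite big_split_ord/= [X in _ + X]big_ord_recl/=.
rewrite (reindex_inj rev_ord_inj)/=.
under eq_bigr => k _.
  rewrite (_ : _ ^+ 2 = k.+1%:R ^+ 2); last first.
    by rewrite natrB ?ltn_ord//; ring.
  over.
under [X in _ + (_ + X)]eq_bigr => k _.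
  rewrite (_ : _ ^+ 2 = k.+1%:R ^+ 2); last first.
    by rewrite /bump/= natrD add1n; ring.
  over.
rewrite addn0 subrr expr0n/= mul0r oppr0 expR0.
set T := \sum_(k < D) _; have := gauss_tail_sum D; rewrite -/T.
set x := expR (- 2^-1) => hT.
(* [u] is [sqrt e]; the bound 1.62 comes from [e^(1/16) >= 17/16] by three squarings. *)
pose t : R := expR (16^-1); pose u : R := t ^+ 8.
have t1 : 17 / 16 <= t by apply: le_trans (expR_ge1Dx _); lra.
have u1 : 162 / 100 <= u.
  have t2 : 1128 / 1000 <= t ^+ 2 by nra.
  have t4 : 1272 / 1000 <= (t ^+ 2) ^+ 2 by nra.
  rewrite /u (_ : t ^+ 8 = ((t ^+ 2) ^+ 2) ^+ 2); last by ring.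
  nra.
have u0 : 0 < u by lra.
have uE : expR 2^-1 = u.
  by rewrite /u /t -expRM_natl; congr expR; field.
have xE : x = u^-1 by rewrite /x expRN uE.
have eE : expR 1 = u ^+ 2 by rewrite -uE -expRM_natl; congr expR; field.
rewrite eE.
have u31 : 0 < u ^+ 3 - 1 by nra.
have : x / (1 - x ^+ 3) = u ^+ 2 / (u ^+ 3 - 1).
  rewrite xE; field.
  by rewrite !gt_eqF.
move=> e; rewrite e in hT.
have : T * (u ^+ 3 - 1) <= u ^+ 2 by rewrite -ler_pdivlMr.
have P : 2 * u ^+ 2 <= (u ^+ 2 - 1) * (u ^+ 3 - 1).
  pose w := u - 162 / 100; have w0 : 0 <= w by rewrite subr_ge0.
  have -> : u = 162 / 100 + w by rewrite /w; ring.
  have : 0 <= w ^+ 2 by rewrite sqr_ge0.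
  have : 0 <= w ^+ 3 by rewrite exprn_ge0.
  have : 0 <= w ^+ 4 by rewrite exprn_ge0.
  have : 0 <= w ^+ 5 by rewrite exprn_ge0.
  move=> *; lra.
move=> h; rewrite -(ler_pM2r u31); nra.
Qed.
End exp_bounds.

Section lattice_net.
Variables (R : realType) (n d : nat).
Hypothesis d_gt0 : (0 < d)%N.
Local Notation I := ('I_n * 'I_d)%type.
Implicit Types (A : {set 'I_n}) (g : 'I_n -> 'rV[R]_d).

Definition noise_row (f : I -> R) i : 'rV[R]_d := \row_j f (i, j).

Definition energy A g (x : 'rV[R]_d) : R := \sum_(i in A) dotv (g i) x ^+ 2.

Lemma energyZ A g (a : R) x : energy A g (a *: x) = a ^+ 2 * energy A g x.
Proof. by rewrite mulr_sumr; apply: eq_bigr => i _; rewrite dotvZr exprMn. Qed.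

Lemma energy_ge0 A g x : 0 <= energy A g x.
Proof. by apply: sumr_ge0 => i _; exact: sqr_ge0. Qed.

(* Rounding one coordinate up or down at random with the right mean changes the quadratic
   form [th * energy - gam * sqnorm] by at least [- gam / 4] on average. *)
Lemma lattice_rounding A g (th gam : R) (y : 'rV[R]_d) : 0 <= th -> 0 <= gam ->
  exists x : 'rV[R]_d,
    [/\ (forall j, exists m : int, x 0 j = m%:~R),
        (forall j, `|x 0 j - y 0 j| <= 1) &
        th * energy A g y - gam * sqnorm y - gam * d%:R / 4 <=
        th * energy A g x - gam * sqnorm x].
Proof.
move=> th0 gam0; pose F x := th * energy A g x - gam * sqnorm x.
have Fline x e t : F (x + t *: e) =
    F x + t * (2 * (th * (\sum_(i in A) dotv (g i) x * dotv (g i) e) - gam * dotv x e)) + t ^+ 2 * F e.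
  rewrite /F sqnormD sqnormZ dotvZr.
  have -> : energy A g (x + t *: e) = energy A g x +
      2 * t * (\sum_(i in A) dotv (g i) x * dotv (g i) e) + t ^+ 2 * energy A g e.
    rewrite /energy !mulr_sumr -!big_split/=; apply: eq_bigr => i _.
    by rewrite dotvDr dotvZr; ring.
  by ring.
suff H (js : seq 'I_d) : uniq js -> exists x : 'rV[R]_d,
    [/\ (forall j, j \in js -> exists m : int, x 0 j = m%:~R),
        (forall j, `|x 0 j - y 0 j| <= 1), (forall j, j \notin js -> x 0 j = y 0 j) &
        F y - gam * (size js)%:R / 4 <= F x].
  have [x [h1 h2 _ h4]] := H _ (enum_uniq 'I_d).
  exists x; split => //; first by move=> j; apply: h1; rewrite mem_enum.
  by move: h4; rewrite size_enum_ord.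
elim: js => [_|j js IH /= /andP[jjs ujs]].
  by exists y; split => // [j|]; rewrite ?subrr ?normr0// mulr0 mul0r subr0.
have [x [h1 h2 h3 h4]] := IH ujs.
pose m := Num.floor (y 0 j); pose f := y 0 j - m%:~R.
have f0 : 0 <= f by rewrite subr_ge0 floor_le_tmp.
have f1 : f <= 1 by rewrite lerBlDr addrC -[1]/(1%:~R) -intrD ltW// floorD1_gt.
pose e : 'rV[R]_d := delta_mx 0 j.
have eE j' : e 0 j' = (j' == j)%:R by rewrite mxE eqxx.
have sqe : sqnorm e = 1.
  rewrite /sqnorm (bigD1 j)//= eE eqxx expr1n big1 ?addr0// => j' /negbTE jj.
  by rewrite eE jj expr0n.
have Fe : - gam <= F e by rewrite /F sqe mulr1 lerBrDr addNr mulr_ge0 ?energy_ge0.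
have upd_ok t : (exists m' : int, y 0 j + t = m'%:~R) -> `|t| <= 1 ->
    F x - gam / 4 <= F (x + t *: e) ->
  exists x' : 'rV[R]_d,
    [/\ (forall j', j' \in j :: js -> exists m : int, x' 0 j' = m%:~R),
        (forall j', `|x' 0 j' - y 0 j'| <= 1), (forall j', j' \notin j :: js -> x' 0 j' = y 0 j') &
        F y - gam * (size (j :: js))%:R / 4 <= F x'].
  move=> tint t1 Ft.
  have xE j' : (x + t *: e) 0 j' = x 0 j' + t * (j' == j)%:R by rewrite !mxE eqxx.
  exists (x + t *: e); split.
  - move=> j'; rewrite inE xE; have [->|jj] := eqVneq j' j => /=.
      by rewrite h3// mulr1.
    by rewrite mulr0 addr0; exact: h1.
  - move=> j'; rewrite xE; have [->|jj] := eqVneq j' j.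
      by rewrite h3// mulr1 addrC addKr.
    by rewrite mulr0 addr0.
  - move=> j'; rewrite inE negb_or xE => /andP[/negbTE -> js'].
    by rewrite mulr0 addr0 h3.
  - apply: le_trans Ft; rewrite /= -natr1; lra.
set b := 2 * (th * (\sum_(i in A) dotv (g i) x * dotv (g i) e) - gam * dotv x e).
have [c0|c0] := leP (F x - gam / 4) (F (x + (- f) *: e)).
  apply: (upd_ok (- f)) => //; first by exists m; rewrite /f; ring.
  by rewrite normrN ger0_norm.
have [c1|c1] := leP (F x - gam / 4) (F (x + (1 - f) *: e)).
  apply: (upd_ok (1 - f)) => //; first by exists (m + 1); rewrite intrD /f; ring.
  by rewrite ger0_norm ?subr_ge0// gerBl.
(* If both roundings failed, weighting them by [1 - f] and [f], which cancels the linear terms,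
   would give [f * (1 - f) * F e < - gam / 4]. *)
exfalso; move: c0 c1; rewrite !Fline -/b => c0 c1.
have ff : f * (1 - f) <= 4^-1 by have := sqr_ge0 (f - 2^-1); nra.
have ff0 : 0 <= f * (1 - f) by rewrite mulr_ge0// subr_ge0.
have : (1 - f) * (F x + - f * b + (- f) ^+ 2 * F e) + f * (F x + (1 - f) * b + (1 - f) ^+ 2 * F e) =
  F x + f * (1 - f) * F e by ring.
have hF : - (gam / 4) <= f * (1 - f) * F e by nra.
have [f00|f0'] := eqVneq f 0; first by rewrite f00 in c0; move: c0; lra.
have fp : 0 < f by rewrite lt_neqAle eq_sym f0'.
by nra.
Qed.

(** Coordinates are stored shifted by [2 d]. The integers from [- 2 d] to [2 d] suffice, since
    [sqnorm <= 4 d] bounds every coordinate by [2 sqrt d] in absolute value. *)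
Definition lattice := {ffun 'I_d -> 'I_(2 * (2 * d)).+1}.

Definition latv (z : lattice) : 'rV[R]_d := \row_j ((z j)%:R - (2 * d)%:R).

(* [16 * ln (netsum gam A g)] dominates the largest eigenvalue of the covariance of [g] over [A]:
   every unit vector, scaled by [sqrt d], is rounded to a lattice point of norm at most [2 sqrt d]. *)
Definition netsum (gam : R) A g : R := expR (5 / 4 * gam * d%:R) *
  \sum_(z : lattice | sqnorm (latv z) <= 4 * d%:R)
    expR ((16 * d%:R)^-1 * energy A g (latv z) - gam * sqnorm (latv z)).

Lemma lattice_surj (x : 'rV[R]_d) : (forall j, exists m : int, x 0 j = m%:~R) ->
  sqnorm x <= 4 * d%:R -> exists z, latv z = x.
Proof.
move=> xint xn.
have H j : exists a : 'I_(2 * (2 * d)).+1, x 0 j = a%:R - (2 * d)%:R.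
  have [m xm] := xint j.
  have xj : x 0 j ^+ 2 <= (2 * d)%:R ^+ 2.
    apply: le_trans (_ : sqnorm x <= _).
      by rewrite /sqnorm (bigD1 j)//= lerDl; apply: sumr_ge0 => i _; exact: sqr_ge0.
    apply: le_trans xn _; rewrite natrM exprMn; have -> : 2%:R ^+ 2 = 4 :> R by ring.
    by rewrite ler_wpM2l// -natrX ler_nat leq_pmulr.
  have := xj; rewrite -ler_sqrt ?sqr_ge0// !sqrtr_sqr [X in _ <= X]ger0_norm// ler_norml.
  rewrite xm => /andP[l1 l2].
  have k0 : (0 <= m + (2 * d)%N%:Z)%R.
    by rewrite -(ler_int R) intrD -pmulrn; lra.
  have k1 : (absz (m + (2 * d)%N%:Z)%R < (2 * (2 * d)).+1)%N.
    rewrite -ltz_nat gez0_abs// -(ltr_int R) intrD -!pmulrn -natr1 [X in _ < X + _]natrM; lra.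
  exists (Ordinal k1) => /=.
  have -> : ((absz (m + (2 * d)%N%:Z))%:R : R) = (m + (2 * d)%N%:Z)%:~R.
    by rewrite -[in RHS](gez0_abs k0) -pmulrn.
  by rewrite intrD -pmulrn addrK.
have [a aE] := choice H.
exists [ffun j => a j]; apply/rowP => j; by rewrite mxE ffunE aE.
Qed.

Lemma netsum_gt0 gam A g : 0 < netsum gam A g.
Proof.
rewrite mulr_gt0 ?expR_gt0//.
have [||z zE] := @lattice_surj 0.
- by move=> j; exists 0; rewrite mxE.
- by rewrite sqnorm0 mulr_ge0.
rewrite (bigD1 z)/=; last by rewrite zE sqnorm0 mulr_ge0.
by rewrite ltr_pwDl ?expR_gt0//; apply: sumr_ge0 => z' _; exact: expR_ge0.
Qed.

(** The rescaled vector [y] has squared norm [d], which costs [gam * d], and rounding costs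
    [gam * d / 4] more. The prefactor of [netsum] pays for both, so the term of the rounded point
    alone gives [exp (energy y / (16 d))]. *)
Lemma energy_le_netsum gam A g u : 0 <= gam ->
  energy A g u <= 16 * ln (netsum gam A g) * sqnorm u.
Proof.
move=> gam0; have [u0|un0] := eqVneq (sqnorm u) 0.
  rewrite (sqnorm_eq0 u0) sqnorm0 mulr0 /energy big1// => i _.
  by rewrite dotvC dotv0l expr0n.
have up : 0 < sqnorm u by rewrite lt_neqAle eq_sym un0 sqnorm_ge0.
have dR : 0 < d%:R :> R by rewrite ltr0n.
pose a := Num.sqrt (d%:R / sqnorm u).
have a2 : a ^+ 2 = d%:R / sqnorm u by rewrite sqr_sqrtr// divr_ge0// ltW.
pose y := a *: u.
have yn : sqnorm y = d%:R by rewrite sqnormZ a2 divfK// gt_eqF.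
have th0 : 0 <= (16 * d%:R)^-1 :> R by rewrite invr_ge0 mulr_ge0.
have [x [xint xy xF]] := lattice_rounding A g y th0 gam0.
have xn : sqnorm x <= 4 * d%:R.
  have dn : sqnorm (x - y) <= d%:R.
    rewrite /sqnorm -[leRHS](_ : \sum_(j < d) 1 = _); last by rewrite sumr_const card_ord.
    apply: ler_sum => j _; rewrite mxE [(- y) 0 j]mxE -real_normK ?num_real// exprn_ile1//.
  have h : sqnorm (y - (y - x)) <= 4 * d%:R.
    apply: sqnorm_sub_le; first by rewrite yn.
    have -> : y - x = - (x - y) by rewrite opprB.
    rewrite sqnormN; exact: dn.
  by rewrite subKr in h.
have [z zE] := lattice_surj xint xn.
have : expR ((16 * d%:R)^-1 * energy A g y) <= netsum gam A g.
  rewrite /netsum (bigD1 z)/=; last by rewrite zE.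
  rewrite mulrDr ler_wpDr//.
    by rewrite mulr_ge0 ?expR_ge0//; apply: sumr_ge0 => z' _; exact: expR_ge0.
  rewrite -expRD ler_expR zE.
  by move: xF; rewrite yn; lra.
rewrite -[X in _ <= X -> _]lnK ?posrE ?netsum_gt0// ler_expR energyZ a2 => h.
have -> : energy A g u = 16 * sqnorm u * ((16 * d%:R)^-1 * (d%:R / sqnorm u * energy A g u)).
  by field; rewrite !gt_eqF.
by rewrite [leRHS]mulrAC; apply: ler_wpM2l => //; rewrite mulr_ge0// ltW.
Qed.

Lemma sum_fst (F : I -> R) i : \sum_(a | a.1 == i) F a = \sum_j F (i, j).
Proof.
rewrite (reindex_onto (fun j : 'I_d => (i, j)) (fun a => a.2))/=.
  by apply: eq_bigl => j; rewrite !eqxx.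
by move=> [i' j] /= /eqP ->.
Qed.

(** Expanding the product gives one Gaussian integral per tuple of net points. A row against [z]
    contributes [(1 - |z|^2 / (8 d))^(-1/2)], at most [exp (3 |z|^2 / (32 d))] because
    [|z|^2 <= 4 d]. The weight [gam] cancels [q] such factors and leaves [exp (- |z|^2 / 2)], with
    lattice sum at most [exp d]; the prefactor adds [5/8 d + 15/128 q]. *)
Lemma gbound_netsum (B q : nat) (D : 'I_B -> {set 'I_n}) (gam : R) :
  gam = 2^-1 + 3 / 32 * q%:R / d%:R ->
  (forall b, #|D b| = q) -> (forall b b' i, i \in D b -> i \in D b' -> b = b') ->
  gbound (fun f : I -> R => \prod_b netsum gam (D b) (noise_row f))
    (expR (B%:R * (13 / 8 * d%:R + 15 / 128 * q%:R))).
Proof.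
move=> gamE cD dD.
have dR : 0 < d%:R :> R by rewrite ltr0n.
pose blk i := [pick b | i \in D b].
have blkP i b : (i \in D b) = (blk i == Some b).
  rewrite /blk; case: pickP => [b' ib'|h]; last by rewrite h.
  apply/idP/eqP => [/(dD _ _ _ ib') -> //|[<-//]].
have sum_blocks (h : 'I_B -> 'I_n -> R) : \sum_b \sum_(i in D b) h b i =
    \sum_i (if blk i is Some b then h b i else 0).
  rewrite (exchange_big_dep predT)//=; apply: eq_bigr => i _.
  under eq_bigl do rewrite blkP.
  case: (blk i) => [b0|]; last by rewrite big_pred0.
  by rewrite (bigD1 b0)//= big1 ?addr0// => b /andP[/eqP[<-]]; rewrite eqxx.
pose Pz (z : lattice) := sqnorm (latv z) <= 4 * d%:R.
pose zof (zs : {ffun 'I_B -> lattice}) i : 'rV[R]_d := if blk i is Some b then latv (zs b) else 0.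
pose quad (zs : {ffun 'I_B -> lattice}) (f : I -> R) :=
  expR (- \sum_(i < n) (- (16 * d%:R)^-1) * (0 + \sum_(a | a.1 == i) zof zs a.1 0 a.2 * f a) ^+ 2).
apply: (@gbound_ext _ _ (fun f => expR (5 / 4 * gam * d%:R) ^+ B *
   \sum_(zs in ffun_on Pz) expR (- (gam * \sum_b sqnorm (latv (zs b)))) * quad zs f)).
  move=> f; rewrite big_split/= prodr_const card_ord; congr (_ * _).
  rewrite bigA_distr_big/=; apply: eq_bigr => zs _.
  rewrite /quad -expR_sum -expRD; congr expR; rewrite [RHS]sumrB [LHS]addrC -[X in _ = _ - X]mulr_sumr; congr (_ - _).
  rewrite -sumrN.
  rewrite (eq_bigr (fun i => (16 * d%:R)^-1 * dotv (noise_row f i) (zof zs i) ^+ 2)); last first.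
    move=> i _; rewrite mulNr opprK add0r; congr (_ * _ ^+ 2).
    by rewrite sum_fst; apply: eq_bigr => j _; rewrite mxE mulrC.
  rewrite -!mulr_sumr; congr (_ * _).
  rewrite (sum_blocks (fun b i => dotv (noise_row f i) (latv (zs b)) ^+ 2)).
  apply: eq_bigr => i _; rewrite /zof; case: (blk i) => //.
  by rewrite dotvC dotv0l expr0n.
have Pzs zs : zs \in ffun_on Pz -> gbound (quad zs)
    (expR (3 / 32 / d%:R * q%:R * \sum_b sqnorm (latv (zs b)))).
  move=> /ffun_onP zsP.
  have sE i : \sum_(a : I | a.1 == i) zof zs a.1 0 a.2 ^+ 2 = sqnorm (zof zs i).
    by rewrite sum_fst.
  have s4 i : sqnorm (zof zs i) <= 4 * d%:R.
    by rewrite /zof; case: (blk i) => [b|]; [exact: zsP|rewrite sqnorm0 mulr_ge0].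
  have xh i : - 2^-1 <= 2 * - (16 * d%:R)^-1 * sqnorm (zof zs i).
    rewrite mulrN mulNr lerN2 invfM mulrA mulrAC ler_pdivrMr//.
    by have := s4 i; lra.
  apply: (@gbound_le _ _ _ (\prod_(i < n) (Num.sqrt (1 + 2 * - (16 * d%:R)^-1 *
     \sum_(a : I | a.1 == i) zof zs a.1 0 a.2 ^+ 2))^-1)); last first.
    apply: gbound_quad => i; last by right.
    by rewrite sE; have := xh i; lra.
  apply: (@le_trans _ _ (\prod_(i < n) expR (3 / 32 / d%:R * sqnorm (zof zs i)))).
    apply: ler_prod => i _; rewrite invr_ge0 sqrtr_ge0/= sE.
    apply: le_trans (invsqrt_le_expR (xh i)) _; rewrite ler_expR.
    have := xh i; set x := 2 * _ * _ => hx.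
    have x0 : x <= 0 by rewrite /x mulrN mulNr oppr_le0 !mulr_ge0 ?sqnorm_ge0.
    have -> : 3 / 32 / d%:R * sqnorm (zof zs i) = - (3 / 4 * x).
      by rewrite /x; field; rewrite gt_eqF.
    by nra.
  rewrite -expR_sum ler_expR -mulr_sumr -[leRHS]mulrA ler_wpM2l ?divr_ge0//.
  rewrite mulr_sumr le_eqVlt; apply/orP; left; apply/eqP.
  rewrite (eq_bigr (fun i => if blk i is Some b then sqnorm (latv (zs b)) else 0)); last first.
    by move=> i _; rewrite /zof; case: (blk i) => //; rewrite sqnorm0.
  rewrite -(sum_blocks (fun b i => sqnorm (latv (zs b)))); apply: eq_bigr => b _.
  by rewrite sumr_const cD mulr_natl.
apply: (@gbound_le _ _ _ (expR (5 / 4 * gam * d%:R) ^+ B * \sum_(zs in ffun_on Pz)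
   expR (- (gam * \sum_b sqnorm (latv (zs b)))) *
   expR (3 / 32 / d%:R * q%:R * \sum_b sqnorm (latv (zs b))))); last first.
  apply: gbound_scale; first by rewrite exprn_ge0// expR_ge0.
  apply: gbound_sum => zs zsP; apply: gbound_scale; first exact: expR_ge0.
  exact: Pzs.
have th1 : \sum_(z : lattice) expR (- (sqnorm (latv z) / 2)) <= expR d%:R.
  rewrite (eq_bigr (fun z : lattice => \prod_j expR (- (((z j)%:R - (2 * d)%:R) ^+ 2 / 2)))); last first.
    move=> z _; rewrite -expR_sum sumrN -mulr_suml.
    have -> // : sqnorm (latv z) = \sum_j ((z j)%:R - (2 * d)%:R) ^+ 2.
    by apply: eq_bigr => j _; rewrite mxE.
  rewrite -(bigA_distr_bigA (fun (j : 'I_d) (m : 'I_(2 * (2 * d)).+1) =>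
     expR (- ((m%:R - (2 * d)%:R) ^+ 2 / 2)))).
  rewrite prodr_const card_ord -[d%:R]mulr1 expRM_natl lerXn2r ?nnegrE ?expR_ge0//.
    by apply: sumr_ge0 => m _; exact: expR_ge0.
  exact: gauss_lattice_sum.
apply: (@le_trans _ _ (expR (5 / 4 * gam * d%:R) ^+ B * expR d%:R ^+ B)).
  rewrite ler_wpM2l ?exprn_ge0 ?expR_ge0//.
  apply: (@le_trans _ _ (\prod_(b < B) \sum_(z : lattice) expR (- (sqnorm (latv z) / 2)))); last first.
    rewrite prodr_const card_ord lerXn2r ?nnegrE ?expR_ge0//.
    by apply: sumr_ge0 => m _; exact: expR_ge0.
  rewrite bigA_distr_bigA/= [leRHS](bigID (fun zs => zs \in ffun_on Pz))/= ler_wpDr//.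
    by apply: sumr_ge0 => zs _; apply: prodr_ge0 => b _; exact: expR_ge0.
  apply: ler_sum => zs _; rewrite -expRD -expR_sum ler_expR sumrN -mulr_suml gamE.
  by rewrite le_eqVlt; apply/orP; left; apply/eqP; field; rewrite gt_eqF.
rewrite -!expRM_natl -expRD ler_expR gamE le_eqVlt; apply/orP; left; apply/eqP.
by field; rewrite gt_eqF.
Qed.
End lattice_net.

(** * U-statistics *)

Section permutation_averages.
Variables (R : realType) (n : nat).

Lemma exists_perm_imset (A A' : {set 'I_n}) : #|A| = #|A'| ->
  exists p : {perm 'I_n}, (p @: A')%SET = A.
Proof.
move=> cAA'.
have cC : #|~: A| = #|~: A'|.
  by apply/eqP; rewrite -(eqn_add2l #|A|) cardsC cAA' cardsC.
pose h i := if i \in A' then nth i (enum A) (index i (enum A'))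
            else nth i (enum (~: A)) (index i (enum (~: A'))).
have idx (S S' : {set 'I_n}) (i : 'I_n) : #|S| = #|S'| -> i \in S' ->
    (index i (enum S') < size (enum S))%N.
  by move=> cS iS'; rewrite -cardE cS cardE index_mem mem_enum.
have nthin (S S' : {set 'I_n}) (i : 'I_n) : #|S| = #|S'| -> i \in S' ->
    nth i (enum S) (index i (enum S')) \in S.
  by move=> cS iS'; rewrite -mem_enum mem_nth// idx.
have nthinj (S S' : {set 'I_n}) (i j : 'I_n) : #|S| = #|S'| -> i \in S' -> j \in S' ->
    nth i (enum S) (index i (enum S')) = nth j (enum S) (index j (enum S')) -> i = j.
  move=> cS iS' jS'; rewrite (set_nth_default i) ?idx// => /eqP.
  rewrite nth_uniq ?enum_uniq ?idx// => /eqP e.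
  by rewrite -[i](nth_index i (s := enum S')) ?mem_enum// e nth_index ?mem_enum.
have hA i : (h i \in A) = (i \in A').
  rewrite /h; case: ifPn => iA; first by rewrite nthin.
  have : nth i (enum (~: A)) (index i (enum (~: A'))) \in ~: A by rewrite nthin// inE.
  by rewrite inE => /negbTE.
have hinj : injective h.
  move=> i j hij; have := hA i; rewrite hij hA; move: hij; rewrite /h.
  case: ifPn => iA'; case: ifPn => jA' // hij _; first exact: (nthinj _ _ _ _ cAA').
  by apply: (nthinj _ _ _ _ cC) => //; rewrite inE.
exists (perm hinj); apply/eqP; rewrite eqEcard; apply/andP; split.
  by apply/fintype.subsetP => _ /imsetP[i iA' ->]; rewrite permE hA.
by rewrite card_imset ?cAA'//; exact: perm_inj.
Qed.

Lemma card_perm_gt0 : (0 < #|{: {perm 'I_n}}|)%N.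
Proof. by apply/card_gt0P; exists 1%g. Qed.

Lemma avg_perm_imset (G : {set 'I_n} -> R) (A A' : {set 'I_n}) : #|A| = #|A'| ->
  avg (fun s : {perm 'I_n} => G (s @: A)%SET) = avg (fun s : {perm 'I_n} => G (s @: A')%SET).
Proof.
move=> /exists_perm_imset[p <-].
rewrite -(avg_reindex (fun s : {perm 'I_n} => G (s @: A')%SET) (mulgI p)).
apply: eq_avg => s; congr G; rewrite -imset_comp; apply: eq_imset => i /=.
by rewrite permM.
Qed.

Lemma avg_perm_pair (K : 'I_n -> 'I_n -> R) (a b c e : 'I_n) : a != b -> c != e ->
  avg (fun s : {perm 'I_n} => K (s a) (s b)) = avg (fun s : {perm 'I_n} => K (s c) (s e)).
Proof.
move=> ab ce.
pose b1 := tperm c a e; pose p := (tperm c a * tperm b1 b)%g.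
have b1a : b1 != a.
  by rewrite /b1 -[X in _ != X](tpermL c a) (inj_eq perm_inj) eq_sym.
have pc : p c = a by rewrite permM tpermL tpermD// eq_sym.
have pe : p e = b by rewrite permM -/b1 tpermL.
rewrite -(avg_reindex (fun s : {perm 'I_n} => K (s c) (s e)) (mulgI p)).
by apply: eq_avg => s; rewrite [(p * s)%g c]permM [(p * s)%g e]permM pc pe.
Qed.
End permutation_averages.

Lemma gbound_avg (R : realType) (I A : finType) (M : A -> (I -> R) -> R) (be : R) :
  (0 < #|A|)%N -> (forall a, gbound (M a) be) -> gbound (fun f => avg (fun a => M a f)) be.
Proof.
move=> A0 H; rewrite -[be](avg_const be A0).
by apply: gbound_scale; [rewrite invr_ge0|apply: gbound_sum].
Qed.

Section net_ustat.
Variables (R : realType) (n d : nat).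
Hypothesis d_gt0 : (0 < d)%N.
Local Notation I := ('I_n * 'I_d)%type.

Definition block (q : nat) (b : 'I_(n %/ q)) : {set 'I_n} := [set i : 'I_n | (i %/ q == b)%N]%SET.

Lemma card_block q (b : 'I_(n %/ q)) : (0 < q)%N -> #|block b| = q.
Proof.
move=> q0.
have bq (j : 'I_q) : (b * q + j < n)%N.
  apply: (@leq_trans (b.+1 * q)); first by rewrite mulSn addnC ltn_add2r.
  by apply: leq_trans (leq_trunc_div n q); rewrite leq_mul2r (ltn_ord b) orbT.
pose h (j : 'I_q) : 'I_n := Ordinal (bq j).
have -> : block b = (h @: [set: 'I_q])%SET.
  apply/setP => i; rewrite inE; apply/eqP/imsetP => [ib|[j _ ->]].
    have mq : (i %% q < q)%N by rewrite ltn_mod.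
    exists (Ordinal mq) => //; apply/val_inj => /=; by rewrite -ib -divn_eq.
  by rewrite /= divnMDl// (divn_small (ltn_ord j)) addn0.
rewrite card_imset ?cardsT ?card_ord// => j j' /(congr1 val) /= /eqP.
by rewrite eqn_add2l => /eqP /val_inj.
Qed.

Definition gamq (q : nat) : R := 2^-1 + 3 / 32 * q%:R / d%:R.

Lemma gamq_ge0 q : 0 <= gamq q.
Proof. by rewrite addr_ge0 ?invr_ge0// divr_ge0// mulr_ge0// divr_ge0. Qed.

(* By Jensen, the average over permutations of a product over disjoint blocks controls the average
   of the logarithm over all subsets of size [q], while the blocks of noise are independent. *)
Definition netM (q : nat) (f : I -> R) : R := avg (fun s : {perm 'I_n} =>
  \prod_(b < n %/ q) netsum (gamq q) (s @: block b)%SET (noise_row f)).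

Lemma gbound_netM q : (0 < q)%N ->
  gbound (netM q) (expR ((n %/ q)%:R * (13 / 8 * d%:R + 15 / 128 * q%:R))).
Proof.
move=> q0; apply: gbound_avg => [|s]; first exact: card_perm_gt0.
apply: (gbound_netsum (D := fun b : 'I_(n %/ q) => (s @: block b)%SET) d_gt0 (erefl _)).
- by move=> b; rewrite card_imset ?card_block//; exact: perm_inj.
- move=> b b' i /imsetP[j jb ->] /imsetP[j' jb' /perm_inj e]; subst j'.
  by move: jb jb'; rewrite !inE => /eqP e1 /eqP e2; apply: val_inj; rewrite /= -e1 -e2.
Qed.

(** The average over images of a set depends only on its size, so the mean over the disjoint blocks
    equals the average for [A]. *)
Lemma netM_bound q (f : I -> R) (y : R) (A : {set 'I_n}) : (0 < q <= n)%N ->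
  netM q f <= expR ((n %/ q)%:R * y) -> #|A| = q ->
  avg (fun s : {perm 'I_n} => ln (netsum (gamq q) (s @: A)%SET (noise_row f))) <= y.
Proof.
move=> /andP[q0 qn] Mle cA.
have B0 : 0 < (n %/ q)%:R :> R by rewrite ltr0n divn_gt0.
rewrite -(ler_pM2l B0) -ler_expR; apply: le_trans Mle.
have -> : (n %/ q)%:R * avg (fun s : {perm 'I_n} => ln (netsum (gamq q) (s @: A)%SET (noise_row f))) =
  avg (fun s : {perm 'I_n} => \sum_(b < n %/ q) ln (netsum (gamq q) (s @: block b)%SET (noise_row f))).
  rewrite avg_sum (eq_bigr (fun=> avg (fun s : {perm 'I_n} => ln (netsum (gamq q) (s @: A)%SET (noise_row f))))).
    by rewrite sumr_const card_ord mulr_natl.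
  move=> b _; apply: (avg_perm_imset (fun S => ln (netsum (gamq q) S (noise_row f)))).
  by rewrite cA card_block.
apply: le_trans (expR_avg _ (card_perm_gt0 n)) _; apply: le_avg => s.
rewrite expR_sum; apply: ler_prod => b _; rewrite expR_ge0 lnK ?posrE ?lexx//.
exact: netsum_gt0.
Qed.
End net_ustat.

Lemma prod_option (R : realType) (A : finType) (F : option A -> R) :
  \prod_o F o = F None * \prod_a F (Some a).
Proof.
rewrite (bigD1 None)//=; congr (_ * _); rewrite (reindex_omap Some id)/=; last by case.
by apply: eq_bigl => a; rewrite eqxx.
Qed.

Section pair_ustat.
Variables (R : realType) (n d k : nat) (mu : 'I_k -> 'rV[R]_d) (tau : 'I_n -> 'I_k).
Local Notation I := ('I_n * 'I_d)%type.

Definition sample (f : I -> R) i : 'rV[R]_d := mu (tau i) + noise_row f i.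
Definition kern (f : I -> R) i i' : R := expR (- (sqnorm (sample f i - sample f i') / 2)).
(* The expectation of the kernel for two independent standard normal points. *)
Definition kap3 : R := (Num.sqrt 3)^-1 ^+ d.

Lemma kap3_ge0 : 0 <= kap3.
Proof. by rewrite exprn_ge0// invr_ge0 sqrtr_ge0. Qed.

(** The product expands over sets of pairs into exponentials of quadratic forms. Each coordinate of
    a chosen pair gives at most [3^(-1/2)]: a difference of variance 2 with coefficient [1/2] yields
    [1 + 2 * 1/2 * 2], and the shift by the means only lowers the integral. *)
Lemma gbound_pairs (B : nat) (p0 p1 : 'I_B -> 'I_n) (x : R) : 0 <= x ->
  injective p0 -> injective p1 -> (forall b b', p0 b != p1 b') ->
  gbound (fun f => \prod_b (1 + x * kern f (p0 b) (p1 b))) (expR (B%:R * (x * kap3))).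
Proof.
move=> x0 i0 i1 i01.
pose blk i := [pick b | (i == p0 b) || (i == p1 b)].
have blk0 b : blk (p0 b) = Some b.
  rewrite /blk; case: pickP => [b'|/(_ b)]; last by rewrite eqxx.
  by rewrite (negbTE (i01 _ _)) orbF => /eqP /i0 ->.
have blk1 b : blk (p1 b) = Some b.
  rewrite /blk; case: pickP => [b'|/(_ b)]; last by rewrite eqxx orbT.
  by rewrite eq_sym (negbTE (i01 _ _)) => /eqP /i1 ->.
have blkP i b : blk i = Some b -> (i == p0 b) || (i == p1 b).
  by rewrite /blk; case: pickP => // b' h [<-].
(* One class per pair and coordinate; [None] collects the unpaired points, with coefficient 0. *)
pose C := (option 'I_B * 'I_d)%type.
pose kp (a : I) : C := (blk a.1, a.2).
pose v (a : I) : R := if [exists b, a.1 == p0 b] then 1 else -1.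
have v0 b j : v (p0 b, j) = 1 by rewrite /v; case: existsP => // -[]; exists b.
have v1 b j : v (p1 b, j) = -1.
  by rewrite /v; case: existsP => // -[b' /=]; rewrite eq_sym (negbTE (i01 _ _)).
have sumkp (F : I -> R) b j : \sum_(a | kp a == (Some b, j)) F a = F (p0 b, j) + F (p1 b, j).
  rewrite (bigD1 (p0 b, j))/=; last by rewrite /kp/= blk0.
  rewrite (bigD1 (p1 b, j))/=; last first.
    by rewrite /kp/= blk1 eqxx/= xpair_eqE eq_sym (negbTE (i01 _ _)).
  rewrite big1 ?addr0// => -[i j'] /andP[/andP[/eqP [/blkP/orP[]/eqP -> ->]]].
    by rewrite eqxx.
  by move=> _; rewrite eqxx.
(* [J] is the set of pairs where the expansion picks the term 1. *)
pose al (J : {set 'I_B}) (c : C) : R := if c.1 is Some b then (if b \in J then 0 else 2^-1) else 0.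
pose m (c : C) : R := if c.1 is Some b then mu (tau (p0 b)) 0 c.2 - mu (tau (p1 b)) 0 c.2 else 0.
pose quad J (f : I -> R) := expR (- \sum_c al J c * (m c + \sum_(a | kp a == c) v a * f a) ^+ 2).
apply: (@gbound_ext _ _ (fun f => \sum_(J : {set 'I_B}) x ^+ #|~: J| * quad J f)).
  move=> f; rewrite bigA_distr/=; apply: eq_bigr => J _.
  have -> : x ^+ #|~: J| = \prod_(b < B) (if b \in J then 1 else x).
    rewrite -prodr_const big_mkcond/=; apply: eq_bigr => b _; rewrite inE.
    by case: (b \in J).
  have -> : quad J f = \prod_(b < B) (if b \in J then 1 else kern f (p0 b) (p1 b)).
    rewrite /quad -sumrN expR_sum -(pair_big predT predT (fun ob j => expR (- (al J (ob, j) *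
       (m (ob, j) + \sum_(a | kp a == (ob, j)) v a * f a) ^+ 2))))/=.
    rewrite prod_option/= big1 ?mul1r; last first.
      by move=> j _; rewrite /al/= mul0r oppr0 expR0.
    apply: eq_bigr => b _; case: ifPn => bJ.
      by rewrite big1// => j _; rewrite /al/= bJ mul0r oppr0 expR0.
    rewrite -expR_sum; congr expR; rewrite sumrN /sqnorm mulr_suml; congr (- _).
    apply: eq_bigr => j _; rewrite /al/= (negbTE bJ) sumkp v0 v1 /m/= !mxE mulrC.
    by congr (_ ^+ 2 / _); ring.
  by rewrite -big_split/=; apply: eq_bigr => b _; case: ifP; rewrite ?mulr1.
have Dc J (c : C) : 1 + 2 * al J c * \sum_(a | kp a == c) v a ^+ 2 =
    if c.1 is Some b then (if b \in J then 1 else 3) else 1.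
  case: c => -[b|] j; rewrite /al/=; last by rewrite mulr0 mul0r addr0.
  case: ifP => _; first by rewrite mulr0 mul0r addr0.
  by rewrite sumkp v0 v1; field.
have Hq J : gbound (quad J) (kap3 ^+ #|~: J|).
  apply: (@gbound_le _ _ _ (\prod_c (Num.sqrt (1 + 2 * al J c * \sum_(a | kp a == c) v a ^+ 2))^-1)); last first.
    apply: gbound_quad => c.
      by rewrite Dc; case: c => -[b|] j //=; case: ifP.
    by left; rewrite /al; case: c.1 => // b; case: ifP => // _; rewrite invr_ge0.
  under eq_bigr do rewrite Dc.
  rewrite -(pair_big predT predT (fun (ob : option 'I_B) (j : 'I_d) => (Num.sqrt
      (if ob is Some b then (if b \in J then 1 else 3) else 1))^-1))/=.
  rewrite prod_option/= big1 ?mul1r; last by move=> j _; rewrite sqrtr1 invr1.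
  rewrite -prodr_const [leRHS]big_mkcond/= le_eqVlt; apply/orP; left; apply/eqP.
  apply: eq_bigr => b _; rewrite inE; case: (b \in J) => /=.
    by rewrite big1// => j _; rewrite sqrtr1 invr1.
  by rewrite prodr_const card_ord.
apply: (@gbound_le _ _ _ (\sum_(J : {set 'I_B}) x ^+ #|~: J| * kap3 ^+ #|~: J|)); last first.
  by apply: gbound_sum => J _; apply: gbound_scale => //; exact: exprn_ge0.
have -> : \sum_(J : {set 'I_B}) x ^+ #|~: J| * kap3 ^+ #|~: J| = (1 + x * kap3) ^+ B.
  rewrite -[in RHS](card_ord B) -prodr_const bigA_distr/=; apply: eq_bigr => J _.
  rewrite -exprMn -prodr_const [LHS]big_mkcond/=; apply: eq_bigr => b _; rewrite inE.
  by case: (b \in J).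
rewrite expRM_natl lerXn2r ?nnegrE ?expR_ge0 ?expR_ge1Dx//.
by rewrite addr_ge0// mulr_ge0// kap3_ge0.
Qed.

Definition pairM (x : R) (B : nat) (p0 p1 : 'I_B -> 'I_n) (f : I -> R) : R :=
  avg (fun s : {perm 'I_n} => \prod_b (1 + x * kern f (s (p0 b)) (s (p1 b)))).

Lemma gbound_pairM x (B : nat) (p0 p1 : 'I_B -> 'I_n) : 0 <= x ->
  injective p0 -> injective p1 -> (forall b b', p0 b != p1 b') ->
  gbound (pairM x p0 p1) (expR (B%:R * (x * kap3))).
Proof.
move=> x0 i0 i1 i01; apply: gbound_avg => [|s]; first exact: card_perm_gt0.
apply: (gbound_pairs (p0 := fun b => s (p0 b)) (p1 := fun b => s (p1 b))) => //.
- by move=> b b' /perm_inj /i0.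
- by move=> b b' /perm_inj /i1.
- by move=> b b'; rewrite (inj_eq perm_inj).
Qed.

(** As [1 + y >= exp (y - y^2)] and the kernel is at most 1, each factor is at least
    [exp ((x - x^2) * kern)]; Jensen then applies over permutations. *)
Lemma pairM_bound x (B : nat) (p0 p1 : 'I_B -> 'I_n) (f : I -> R) (y : R) (a b : 'I_n) :
  0 <= x -> (0 < B)%N -> (forall b b', p0 b != p1 b') -> a != b ->
  pairM x p0 p1 f <= expR (B%:R * y) ->
  (x - x ^+ 2) * avg (fun s : {perm 'I_n} => kern f (s a) (s b)) <= y.
Proof.
move=> x0 B0 i01 ab Mle.
have BR : 0 < B%:R :> R by rewrite ltr0n.
rewrite -(ler_pM2l BR) -ler_expR; apply: le_trans Mle.
have -> : B%:R * ((x - x ^+ 2) * avg (fun s : {perm 'I_n} => kern f (s a) (s b))) =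
  avg (fun s : {perm 'I_n} => \sum_(b < B) (x - x ^+ 2) * kern f (s (p0 b)) (s (p1 b))).
  rewrite avg_sum (eq_bigr (fun=> (x - x ^+ 2) * avg (fun s : {perm 'I_n} => kern f (s a) (s b)))).
    by rewrite sumr_const card_ord mulr_natl.
  move=> b' _; rewrite avgZ; congr (_ * _); apply: avg_perm_pair => //.
apply: le_trans (expR_avg _ (card_perm_gt0 n)) _; apply: le_avg => s.
rewrite expR_sum; apply: ler_prod => b' _; rewrite expR_ge0/=.
set K := kern _ _ _.
have K0 : 0 <= K by exact: expR_ge0.
have K1 : K <= 1 by rewrite expR_le1 oppr_le0 divr_ge0// sqnorm_ge0.
have xK : 0 <= x * K by rewrite mulr_ge0.
have h : - 2^-1 <= x * K by lra.
apply: le_trans (expR_sub_sqr_le h); rewrite ler_expR.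
have -> : x * K - (x * K) ^+ 2 = x * K - x ^+ 2 * K * K by ring.
have : x ^+ 2 * K * K <= x ^+ 2 * K * 1 by rewrite ler_wpM2l// mulr_ge0// sqr_ge0.
by lra.
Qed.
End pair_ustat.

(** * The lower bound of the procedure *)

Section part_a.
Variable R : realType.

Lemma proc_prob_ge0 (n s l : nat) (E : {ffun 'I_l * 'I_s -> 'I_n} -> bool) :
  0 <= proc_prob n s l E :> R.
Proof. by rewrite divr_ge0. Qed.

Lemma le_proc_prob (n s l : nat) (E E' : {ffun 'I_l * 'I_s -> 'I_n} -> bool) :
  (forall J, E J -> E' J) -> proc_prob n s l E <= proc_prob n s l E' :> R.
Proof.
move=> EE'; rewrite ler_wpM2r ?invr_ge0// ler_nat; apply: subset_leq_card.
by apply/fintype.subsetP => J /set_mem/= /EE' h; apply/mem_set.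
Qed.

Section fixed_sample.
Variables (n d k s : nat) (X : 'I_n -> 'rV[R]_d).
Hypotheses (k_gt0 : (0 < k)%N) (ks : (k <= s)%N) (kn : (k <= n)%N).

Definition sub_sdp (r : {ffun 'I_s -> 'I_n}) : R := SDP (fun j => X (r j)) k.

Let s_gt0 : (0 < s)%N. Proof. exact: leq_trans ks. Qed.
Let n_gt0 : (0 < n)%N. Proof. exact: leq_trans kn. Qed.

(** Assigning each drawn point to a greedy center within squared distance [kpp_b] gives the upper
    end. *)
Lemma sub_sdp_bounds (c : 'I_k -> 'I_n) r : 0 <= sub_sdp r <= kpp_b X c.
Proof.
rewrite SDP_ge0 ?k_gt0 ?ks//=.
have [p pP] := choice (fun j : 'I_s => sqnorm_le_kpp_b X c (r j) k_gt0).
apply: le_trans (SDP_le_assign (p := p) (fun t => X (c t)) _ _) _.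
  by rewrite ks andbT (leq_trans (max_card _))// card_ord.
have sR : 0 < s%:R :> R by rewrite ltr0n.
rewrite ler_pdivrMl//; apply: le_trans (ler_sum _ (fun j _ => pP j)) _.
by rewrite sumr_const card_ord mulr_natl.
Qed.

Lemma avg_subsample (phi : 'I_n -> R) :
  avg (fun r : {ffun 'I_s -> 'I_n} => s%:R^-1 * \sum_j phi (r j)) = n%:R^-1 * \sum_i phi i.
Proof.
have sR : s%:R != 0 :> R by rewrite pnatr_eq0 -lt0n.
rewrite avgZ avg_sum (eq_bigr (fun=> avg phi)); last first.
  by move=> j _; rewrite avg_ffun_eval// card_ord.
by rewrite sumr_const card_ord -[avg phi *+ s]mulr_natl mulKf// /avg card_ord.
Qed.

Lemma avg_sub_sdp_le_IP : avg sub_sdp <= IP X k.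
Proof.
apply: IP_ge; first by rewrite k_gt0 kn.
move=> p C pk.
rewrite -(avg_subsample (fun i => sqnorm (X i - C (p i)))); apply: le_avg => r.
apply: (SDP_le_assign (p := fun j => p (r j))); rewrite ks andbT.
apply: leq_trans pk; apply: subset_leq_card; apply/fintype.subsetP => S.
by move=> /imsetP[j _ ->]; exact: imset_f.
Qed.

Lemma BHE l (c : 'I_k -> 'I_n) eps (J : {ffun 'I_l * 'I_s -> 'I_n}) :
  BH s X c eps J = l%:R^-1 * \sum_(i < l) sub_sdp (row_of J i)
    - Num.sqrt ((kpp_b X c) ^+ 2 / (2 * l%:R) * ln (eps^-1)).
Proof.
rewrite /BH; congr (_ * _ - _); apply: eq_bigr => i _; rewrite /sub_sdp.
by congr (SDP _ k); apply/funext => j; rewrite ffunE.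
Qed.

Lemma BH_le_IP_prob l (c : 'I_k -> 'I_n) (eps : R) : (0 < l)%N -> 0 < eps ->
  1 - eps <= proc_prob n s l (fun J => BH s X c eps J <= IP X k).
Proof.
move=> l0 e0; have [e1|e1] := leP 1 eps.
  by apply: le_trans (proc_prob_ge0 _); rewrite subr_le0.
have e01 : 0 < eps < 1 by rewrite e0.
apply: le_trans (hoeffding_upper n_gt0 l0 e01 (sub_sdp_bounds c)) _.
apply: le_proc_prob => J h; rewrite BHE lerBlDr.
by apply: le_trans h _; rewrite lerD2r avg_sub_sdp_le_IP.
Qed.

Lemma BH_ge_prob l (c : 'I_k -> 'I_n) (eps x : R) : (0 < l)%N -> 0 < eps < 1 ->
  Num.sqrt ((kpp_b X c) ^+ 2 / (2 * l%:R) * ln (eps^-1)) <= 2^-1 ->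
  x <= avg sub_sdp - 1 ->
  1 - eps <= proc_prob n s l (fun J => x <= BH s X c eps J).
Proof.
move=> l0 e01 t2 xS.
apply: le_trans (hoeffding_lower n_gt0 l0 e01 (sub_sdp_bounds c)) _.
apply: le_proc_prob => J; rewrite BHE; move: t2.
set t := Num.sqrt _; set a := _^-1 * _ => t2 h; lra.
Qed.
End fixed_sample.
End part_a.

(** * Mean subsampled value when the noise is good *)

Section good_sample.
Variables (R : realType) (n d k s : nat) (mu : 'I_k -> 'rV[R]_d) (tau : 'I_n -> 'I_k).
Hypotheses (k_ge2 : (2 <= k)%N) (kd : (k <= d)%N) (ds : (d <= s)%N) (sn : (s <= n)%N).
Hypothesis s_large : 15 * d%:R * ln (d%:R) <= (s%:R : R).
Variable f : 'I_n * 'I_d -> R.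
Let g := noise_row f.
Let X := sample mu tau f.

Let d_gt0 : (0 < d)%N. Proof. by apply: leq_trans kd; exact: ltnW. Qed.
Let k_gt0 : (0 < k)%N. Proof. exact: ltnW. Qed.
Let ks : (k <= s)%N. Proof. exact: leq_trans ds. Qed.
Let kn : (k <= n)%N. Proof. exact: leq_trans sn. Qed.
Let s_gt0 : (0 < s)%N. Proof. exact: leq_trans ks. Qed.
Let n_gt0 : (0 < n)%N. Proof. exact: leq_trans kn. Qed.
Let dR : 0 < d%:R :> R. Proof. by rewrite ltr0n. Qed.
Let sR : 0 < s%:R :> R. Proof. by rewrite ltr0n. Qed.
Let nR : 0 < n%:R :> R. Proof. by rewrite ltr0n. Qed.
Let A_gt0 : (0 < #|{: {ffun 'I_s -> 'I_n}}|)%N.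
Proof. by rewrite card_ffun expn_gt0 card_ord n_gt0. Qed.

Lemma ln_netsum_ge0 (gam : R) (A : {set 'I_n}) : 0 <= gam -> 0 <= ln (netsum gam A g).
Proof.
move=> gam0; pose u : 'rV[R]_d := const_mx 1.
have un : sqnorm u = d%:R.
  rewrite /sqnorm (eq_bigr (fun=> 1)) ?sumr_const ?card_ord// => j _.
  by rewrite mxE expr1n.
have := le_trans (energy_ge0 A g u) (energy_le_netsum d_gt0 A g u gam0).
by rewrite un pmulr_lge0// pmulr_rge0.
Qed.

(** The net bound costs a multiple of [d] whatever the size of the set, so empty levels are given 0
    and only the [max_mult] nonempty ones pay. *)
Definition lam_set (A : {set 'I_n}) : R :=
  if A == finset.set0 then 0 else 16 * ln (netsum (gamq R d #|A|) A g).

Lemma lam_set_ge0 A : 0 <= lam_set A.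
Proof. by rewrite /lam_set; case: ifP => // _; rewrite mulr_ge0// ln_netsum_ge0// gamq_ge0. Qed.

Definition lam_sub (r : {ffun 'I_s -> 'I_n}) : R := \sum_t lam_set (level r t).

Lemma lam_sub_spec (r : {ffun 'I_s -> 'I_n}) v : \sum_j dotv (g (r j)) v ^+ 2 <= lam_sub r * sqnorm v.
Proof.
rewrite (sum_level r (fun i => dotv (g i) v ^+ 2)) mulr_suml; apply: ler_sum => t _.
rewrite /lam_set; case: eqP => [->|_]; first by rewrite big_set0 mul0r.
exact: (energy_le_netsum d_gt0 _ _ _ (gamq_ge0 _ _ _)).
Qed.

Hypothesis netM_le : forall q, (0 < q <= n)%N ->
  netM q f <= expR ((n %/ q)%:R * (13 / 8 * d%:R + 15 / 128 * q%:R + 640^-1 * (q%:R + d%:R))).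

(** The constants are 16 times the net rates: [16 * (15/128 + 1/640) = 19/10], and
    [16 * (13/8 + 1/640) = 26.025], rounded up. *)
Lemma avg_lam_set (A : {set 'I_n}) :
  avg (fun p : {perm 'I_n} => lam_set (p @: A)%SET) <=
  if A == finset.set0 then 0 else 19 / 10 * #|A|%:R + 2605 / 100 * d%:R.
Proof.
case: eqP => [->|/eqP A0].
  rewrite (eq_avg (g := fun=> 0)) ?avg_const ?card_perm_gt0// => p.
  by rewrite /lam_set imset0 eqxx.
rewrite (eq_avg (g := fun p : {perm 'I_n} => 16 * ln (netsum (gamq R d #|A|) (p @: A)%SET g))); last first.
  move=> p; rewrite /lam_set card_imset; last exact: perm_inj.
  case: eqP => // /eqP; rewrite -cards_eq0 card_imset; last exact: perm_inj.
  by rewrite cards_eq0 (negbTE A0).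
rewrite avgZ.
have qn : (0 < #|A| <= n)%N by rewrite card_gt0 A0 -[leqRHS]card_ord max_card.
have := netM_bound d_gt0 qn (netM_le qn) (erefl _).
rewrite -/g; set a := avg _ => h.
have : 16 * a <= 16 * (13 / 8 * d%:R + 15 / 128 * #|A|%:R + 640^-1 * (#|A|%:R + d%:R)).
  by rewrite ler_wpM2l.
move=> /le_trans; apply; have := ltW dR; have : 0 <= #|A|%:R :> R by []; lra.
Qed.

(** The uniform law of [r] is invariant under permuting the indices, so each level set may first be
    averaged over its images. Level sizes add up to [s], and [max_mult r] levels pay the term in
    [d]. *)
Lemma avg_lam_sub : avg lam_sub <= 19 / 10 * s%:R + 2605 / 100 * d%:R * avg (fun r : {ffun 'I_s -> 'I_n} => (max_mult r)%:R).
Proof.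
pose act (p : {perm 'I_n}) (r : {ffun 'I_s -> 'I_n}) : {ffun 'I_s -> 'I_n} := [ffun j => p (r j)].
have actinj p : injective (act p).
  by move=> r r' /ffunP e; apply/ffunP => j; have := e j; rewrite !ffunE => /perm_inj.
have levelE p r t : level (act p r) t = (p @: level r t)%SET.
  have multE i : mult (act p r) (p i) = mult r i.
    by apply: eq_card => j; rewrite !inE ffunE (inj_eq perm_inj).
  apply/setP => i; rewrite -[i](permKV p) (mem_imset _ _ (@perm_inj _ p)) /level !inE.
  by rewrite multE.
have -> : avg lam_sub = avg (fun p : {perm 'I_n} => avg (fun r => lam_sub (act p r))).
  rewrite [RHS](eq_avg (g := fun=> avg lam_sub)) ?avg_const ?card_perm_gt0// => p.
  exact: avg_reindex.
rewrite avg_exchange.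
apply: (@le_trans _ _ (avg (fun r : {ffun 'I_s -> 'I_n} => 19 / 10 * s%:R + 2605 / 100 * d%:R * (max_mult r)%:R))); last first.
  by rewrite avgD avg_const// avgZ.
apply: le_avg => r.
rewrite (eq_avg (g := fun p : {perm 'I_n} => \sum_t lam_set (p @: level r t)%SET)); last first.
  by move=> p; apply: eq_bigr => t _; rewrite levelE.
rewrite avg_sum; apply: le_trans (ler_sum _ (fun t _ => avg_lam_set (level r t))) _.
rewrite (eq_bigr (fun t => 19 / 10 * #|level r t|%:R +
    2605 / 100 * d%:R * (level r t != finset.set0)%:R)); last first.
  move=> t _; case: eqP => [->|_]; first by rewrite cards0 !mulr0 addr0.
  by rewrite mulr1.
rewrite big_split/= -!mulr_sumr.
have -> : \sum_t (#|level r t|%:R : R) = s%:R.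
  transitivity (\sum_(j < s) (1 : R)); last by rewrite sumr_const card_ord.
  by rewrite (sum_level r (fun=> 1)); apply: eq_bigr => t _; rewrite sumr_const.
rewrite -(card_level_nonempty r) -sum1_card natr_sum [in leRHS]big_mkcond/=.
rewrite le_eqVlt; apply/orP; left; apply/eqP; congr (_ + _ * _).
by apply: eq_bigr => t _; rewrite inE; case: (_ != _).
Qed.

Lemma avg_sub_sdp_spectral :
  avg (fun r : {ffun 'I_s -> 'I_n} => (max_mult r)%:R) * d%:R <= 25^-1 * s%:R :> R ->
  n%:R^-1 * \sum_i sqnorm (g i) - 6 * k%:R <= avg (sub_sdp k X (s := s)).
Proof.
move=> mm.
have H (r : {ffun 'I_s -> 'I_n}) : s%:R^-1 * \sum_j sqnorm (g (r j)) - (2 * k%:R / s%:R) * lam_sub r <= sub_sdp k X r.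
  have l0 : 0 <= lam_sub r by apply: sumr_ge0 => t _; exact: lam_set_ge0.
  have ks' : (0 < k <= s)%N by rewrite k_gt0.
  have := SDP_spectral_lower mu (fun j => tau (r j)) ks' l0 (lam_sub_spec r).
  by move=> /(le_trans _); apply; rewrite le_eqVlt; apply/orP; left; apply/eqP; field; rewrite gt_eqF.
apply: le_trans (le_avg H).
rewrite (eq_avg (g := fun r : {ffun 'I_s -> 'I_n} => s%:R^-1 * \sum_j sqnorm (g (r j)) + (- (2 * k%:R / s%:R)) * lam_sub r)); last first.
  by move=> r; rewrite mulNr.
rewrite avgD (avg_subsample k_gt0 ks kn (fun i => sqnorm (g i))) avgZ lerD2l mulNr lerN2.
have h := avg_lam_sub.
(* [19/10 + 26.05/25 = 2.942], just below 3. *)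
have h2 : avg lam_sub <= 3 * s%:R by move: h mm; set a := avg (fun r : {ffun 'I_s -> 'I_n} => _); have := sR; nra.
have -> : 6 * k%:R = 2 * k%:R / s%:R * (3 * s%:R) :> R by field; rewrite gt_eqF.
by rewrite ler_wpM2l// divr_ge0 ?mulr_ge0.
Qed.

(* For a feasible [Z], the Frobenius norm is at most [sqrt k], so by Cauchy-Schwarz the value of the
   program is controlled by the number of pairs at squared distance less than 4. *)
Lemma avg_sub_sdp_kernel (U c : R) : 0 < c ->
  (forall a b : 'I_n, a != b -> avg (fun p : {perm 'I_n} => kern mu tau f (p a) (p b)) <= U) ->
  k%:R / s%:R + k%:R / n%:R + k%:R * U <= c ^+ 2 ->
  2 * (1 - c) <= avg (sub_sdp k X (s := s)).
Proof.
move=> c0 HU pc.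
pose K := kern mu tau f.
have K0 i i' : 0 <= K i i' by exact: expR_ge0.
have Kii i : K i i = 1 by rewrite /K /kern subrr sqnorm0 mul0r oppr0 expR0.
have n1 : (1 < n)%N by apply: leq_trans kn.
have U0 : 0 <= U.
  have ab : (Ordinal n_gt0 : 'I_n) != Ordinal n1 by [].
  by apply: le_trans (HU _ _ ab); apply: avg_ge0 => p; exact: expR_ge0.
(* The double sum equals its average over permutations, where the diagonal terms are 1 and the
   others at most [U]. *)
have sumK : \sum_i \sum_i' K i i' <= n%:R + n%:R * (n%:R - 1) * U.
  have P (p : {perm 'I_n}) : \sum_i \sum_i' K i i' = \sum_i \sum_i' K (p i) (p i').
    rewrite (reindex_inj (@perm_inj _ p)); apply: eq_bigr => i _; exact: (reindex_inj (@perm_inj _ p)).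
  have -> : \sum_i \sum_i' K i i' = avg (fun p : {perm 'I_n} => \sum_i \sum_i' K (p i) (p i')).
    by rewrite (eq_avg (g := fun=> \sum_i \sum_i' K i i')) ?avg_const ?card_perm_gt0.
  rewrite avg_sum (eq_bigr (fun i => \sum_i' avg (fun p : {perm 'I_n} => K (p i) (p i')))); last first.
    by move=> i _; rewrite avg_sum.
  apply: (@le_trans _ _ (\sum_(i < n) (1 + (n%:R - 1) * U))).
    apply: ler_sum => i _; rewrite (bigD1 i)//=; apply: lerD.
      by rewrite (eq_avg (g := fun=> 1)) ?avg_const ?card_perm_gt0.
    apply: (@le_trans _ _ (\sum_(i' < n | i' != i) U)).
      by apply: ler_sum => i' ii'; apply: HU; rewrite eq_sym.
    rewrite sumr_const cardC1 card_ord -[leLHS]mulr_natl ler_wpM2r//.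
    by rewrite lerBrDr natr1 prednK.
  by rewrite sumr_const card_ord -[X in X <= _]mulr_natl; lra.
pose T (r : {ffun 'I_s -> 'I_n}) := k%:R * (s%:R ^- 2 * \sum_j \sum_j' K (r j) (r j')).
have avgT : avg T <= c ^+ 2.
  apply: le_trans pc; rewrite /T avgZ avgZ avg_sum.
  (* Distinct positions of the subsample are independent uniform indices and may coincide. The
     diagonal in positions yields [k / s], the diagonal in indices [k / n]. *)
  rewrite (eq_bigr (fun j => 1 + (s%:R - 1) * (n%:R^-1 * (n%:R^-1 * \sum_i \sum_i' K i i')))); last first.
    move=> j _; rewrite avg_sum (bigD1 j)//=; congr (_ + _).
      by rewrite (eq_avg (g := fun=> 1)) ?avg_const// => r; rewrite Kii.
    rewrite (eq_bigr (fun=> n%:R^-1 * (n%:R^-1 * \sum_i \sum_i' K i i'))); last first.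
      move=> j' jj'; rewrite avg_ffun_eval2 ?card_ord// 1?eq_sym// /avg card_ord.
      by rewrite -mulr_sumr.
    by rewrite sumr_const cardC1 card_ord -[X in X = _]mulr_natl; congr (_ * _); rewrite -subn1 natrB.
  rewrite sumr_const card_ord -[X in _ * (_ * X)]mulr_natl.
  set Q := \sum_i \sum_i' K i i' in sumK *.
  have Q0 : 0 <= Q by apply: sumr_ge0 => i _; apply: sumr_ge0.
  rewrite -[X in _ <= X + _]mulrDr -mulrDr; apply: ler_wpM2l => //.
  have e1 : n%:R^-1 * (n%:R^-1 * Q) <= n%:R^-1 + U.
    rewrite mulrA -invfM mulrC ler_pdivrMr ?mulr_gt0//; apply: le_trans sumK _.
    have -> : (n%:R^-1 + U) * (n%:R * n%:R) = n%:R + n%:R * n%:R * U by field; rewrite gt_eqF.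
    by have := mulr_ge0 (ltW nR) U0; nra.
  have e0 : 0 <= n%:R^-1 * (n%:R^-1 * Q) by rewrite !mulr_ge0 ?invr_ge0.
  have -> : s%:R ^- 2 * (s%:R * (1 + (s%:R - 1) * (n%:R^-1 * (n%:R^-1 * Q)))) =
     s%:R^-1 + (1 - s%:R^-1) * (n%:R^-1 * (n%:R^-1 * Q)) by field; rewrite !gt_eqF.
  have si : 0 <= s%:R^-1 :> R by rewrite invr_ge0.
  by nra.
(* [2 sqrt T <= c + T / c] makes the bound linear in [T] before averaging. *)
have H r : 2 - c - c^-1 * T r <= sub_sdp k X r.
  have ks' : (0 < k <= s)%N by rewrite k_gt0.
  apply: le_trans (SDP_kernel_lower (fun j => X (r j)) ks').
  have T0 : 0 <= T r by rewrite !mulr_ge0 ?invr_ge0 ?sqr_ge0//; apply: sumr_ge0 => j _; apply: sumr_ge0.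
  rewrite -[k%:R * _]/(T r); set q := Num.sqrt _.
  have q2 : q ^+ 2 = T r by rewrite sqr_sqrtr.
  have : c * (c^-1 * T r) = q ^+ 2 by rewrite q2 mulrA mulfV ?gt_eqF// mul1r.
  set z := c^-1 * T r => hz.
  have := sqr_ge0 (q - c) => h.
  suff : 2 * q <= c + z by lra.
  by rewrite -(ler_pM2l c0); nra.
apply: le_trans (le_avg H).
rewrite (eq_avg (g := fun r : {ffun 'I_s -> 'I_n} => (2 - c) + (- c^-1) * T r)); last first.
  by move=> r; rewrite mulNr.
rewrite avgD avg_const// avgZ mulNr.
have : c^-1 * avg T <= c^-1 * c ^+ 2 by rewrite ler_wpM2l ?invr_ge0 ?(ltW c0).
rewrite expr2 mulKf ?gt_eqF//; lra.
Qed.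
End good_sample.

(** * Numerical estimates behind the constants *)

Section numerics.
Variable R : realType.

Lemma ln2_ge : 2 / 3 <= ln 2 :> R.
Proof.
rewrite -[2 / 3]expRK ler_ln ?posrE ?expR_gt0//.
have -> : expR (2 / 3) = expR 24^-1 ^+ 16 :> R.
  by rewrite -expRM_natl; congr expR; field.
have h : expR 24^-1 <= 24 / 23 :> R.
  have := expR_ge1Dx (- 24^-1 : R); rewrite expRN.
  have := expR_gt0 (24^-1 : R); set e := expR _ => e0.
  have : e * e^-1 = 1 by rewrite mulfV// gt_eqF.
  by move: e^-1 => i; nra.
apply: (@le_trans _ _ ((24 / 23) ^+ 16)); last by lra.
by rewrite lerXn2r// nnegrE ?expR_ge0// divr_ge0.
Qed.

Lemma ln_pow2_le (m d : nat) : (2 ^ m <= d)%N -> m%:R * (2 / 3) <= ln (d%:R : R).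
Proof.
move=> md.
have d0 : (0 < d)%N by apply: leq_trans md; rewrite expn_gt0.
apply: (@le_trans _ _ (ln (2 ^+ m))); last first.
  by rewrite ler_ln ?posrE ?exprn_gt0 ?ltr0n// -natrX ler_nat.
by rewrite lnXn// -[leRHS]mulr_natl ler_wpM2l// ln2_ge.
Qed.

(** Here [s >= 15 d log d] is spent. With [w = s / d >= 15 ln d >= 30] and [tau = 20], a large [K]
    makes the collision term at most [d w^2 / 10^4], and the mean maximum is at most [1 + (ln d +
    w/50) / 20 <= w (1/30 + 1/300 + 1/1000) < w / 25]. *)
Lemma avg_max_mult_le (n d s : nat) (K : R) : (8 <= d)%N -> (d <= s)%N -> (s <= n)%N ->
  15 * d%:R * ln (d%:R) <= (s%:R : R) ->
  10 ^+ 4 * ((expR 20 - 1) ^+ 2 * expR (expR 20 - 1)) <= K -> K * d%:R <= n%:R ->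
  avg (fun r : {ffun 'I_s -> 'I_n} => (max_mult r)%:R) * d%:R <= 25^-1 * s%:R :> R.
Proof.
move=> d8 ds sn sl; set c' := _ * expR _ => cK Kn.
have d0 : (0 < d)%N by apply: leq_trans d8.
have n0 : (0 < n)%N by apply: leq_trans sn; apply: leq_trans ds.
have dR : 0 < d%:R :> R by rewrite ltr0n.
have nR : 0 < n%:R :> R by rewrite ltr0n.
have E21 : 21 <= expR 20 :> R by have := expR_ge1Dx (20 : R); lra.
have E2 : 2 <= expR 20 :> R by lra.
have c0 : 0 < c' by rewrite mulr_gt0 ?expR_gt0// exprn_gt0//; lra.
have t0 : 0 < 20 :> R by [].
have := avg_max_mult n0 sn t0 E2; rewrite -/c'; set a := avg _ => ha.
pose w : R := s%:R / d%:R.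
have sE : s%:R = w * d%:R by rewrite /w mulfVK// gt_eqF.
have ld2 : 2 <= ln (d%:R : R) by have := @ln_pow2_le 3 d d8; lra.
have wl : 15 * ln (d%:R) <= w by rewrite /w ler_pdivlMr// mulrAC.
have w30 : 30 <= w by lra.
have w0 : 0 < 1 + w / 100 by lra.
suff : a <= w / 25 by move=> h; rewrite sE; have := ler_wpM2r (ltW dR) h; lra.
apply: le_trans ha _.
have hq : 1 + c' * (s%:R ^+ 2 / n%:R) <= d%:R * (1 + w / 100) ^+ 2.
  have h1 : c' * (s%:R ^+ 2 / n%:R) <= d%:R * w ^+ 2 / 10 ^+ 4.
    rewrite mulrA ler_pdivrMr// sE.
    have : 10 ^+ 4 * c' * d%:R <= n%:R by apply: le_trans Kn; rewrite ler_wpM2r// ltW.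
    have := mulr_ge0 (ltW dR) (sqr_ge0 w).
    set z := d%:R * w ^+ 2 => z0 h.
    have := ler_wpM2l z0 h; rewrite /z.
    set x := d%:R; set y := n%:R => hh.
    have -> : c' * (w * x) ^+ 2 = 10 ^- 4 * (x * w ^+ 2 * (10 ^+ 4 * c' * x)) by field.
    have -> : x * w ^+ 2 / 10 ^+ 4 * y = 10 ^- 4 * (x * w ^+ 2 * y) by field.
    by rewrite ler_wpM2l// invr_ge0 exprn_ge0.
  have d1 : 1 <= d%:R :> R by rewrite ler1n.
  have := mulr_ge0 (ltW dR) (ltW (lt_le_trans (ltr0n R 30) w30)).
  by move: h1; nra.
have p0 : 0 < 1 + c' * (s%:R ^+ 2 / n%:R).
  by rewrite ltr_pwDl// mulr_ge0 ?(ltW c0)// divr_ge0// sqr_ge0.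
have hl : ln (1 + c' * (s%:R ^+ 2 / n%:R)) <= ln d%:R + w / 50.
  apply: (@le_trans _ _ (ln (d%:R * (1 + w / 100) ^+ 2))).
    by rewrite ler_ln ?posrE// mulr_gt0 ?exprn_gt0.
  rewrite lnM ?posrE ?exprn_gt0// lerD2l lnXn// mulr2n.
  have : ln (1 + w / 100) <= w / 100.
    rewrite -[leRHS]expRK ler_ln ?posrE ?expR_gt0//; exact: expR_ge1Dx.
  lra.
have := ler_wpM2l (ltW (ltac:(by rewrite invr_gt0) : 0 < 20^-1 :> R)) hl.
lra.
Qed.

Let a : R := (Num.sqrt 3)^-1.
Let a2 : a * a = 3^-1.
Proof. by rewrite /a -invfM -expr2 sqr_sqrtr. Qed.
Let a0 : 0 <= a. Proof. by rewrite invr_ge0 sqrtr_ge0. Qed.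
Let a_le : a <= 289 / 500. Proof. by have := a2; have := a0; nra. Qed.

(** From [d = 7] on, consecutive terms have ratio at most [8/7 / sqrt 3 < 1], so [d = 7] is the
    worst case. *)
Lemma kap3_small (d : nat) : (7 <= d)%N -> d%:R * kap3 R d <= 3 / 20.
Proof.
rewrite /kap3 -/a => d7; rewrite -(subnKC d7); elim: (d - 7)%N => [|m ih].
  rewrite addn0; have -> : a ^+ 7 = (a * a) * (a * a) * (a * a) * a by ring.
  by rewrite a2; have := a_le; lra.
rewrite addnS exprS; apply: le_trans ih.
have : 0 <= a ^+ (7 + m) by rewrite exprn_ge0.
set p := a ^+ _ => p0; set t := (7 + m)%N.
have t7 : 7 <= t%:R :> R by rewrite ler_nat leq_addr.
rewrite -natr1 mulrA; apply: ler_wpM2r => //.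
have := a0; have := a_le; nra.
Qed.

(** [c] bounds [sqrt p]. From [d = 7] on, [c = 1/2] suffices because [(d+1) / (6k+3) < 1]. Smaller
    dimensions use [k >= 2]; at [d = k = 2] the target is [1/5], so [c = 9/10] is the largest value
    allowed. *)
Lemma kernel_threshold (n d k s : nat) : (2 <= k)%N -> (k <= d)%N -> (d <= s)%N ->
  (s <= n)%N -> 15 * d%:R * ln (d%:R) <= (s%:R : R) -> 1000 * d%:R <= n%:R :> R ->
  (d < 6 * k + 2)%N ->
  exists c : R, [/\ 0 < c,
    k%:R / s%:R + k%:R / n%:R +
      k%:R * ((kap3 R d + (250 * k%:R)^-1) * (200 / 199)) <= c ^+ 2 &
    (d%:R + 1) / (6 * k%:R + 3) <= 2 * (1 - c)].
Proof.
move=> k2 kd ds sn sl nl dk.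
have d2 : (2 <= d)%N by apply: leq_trans kd.
have kR : 2 <= k%:R :> R by rewrite ler_nat.
have kdR : k%:R <= d%:R :> R by rewrite ler_nat.
have k0 : 0 < k%:R :> R by lra.
have dR : 0 < d%:R :> R by lra.
have sR : 0 < s%:R :> R by rewrite ltr0n (leq_trans _ ds)// ltnW.
have nR : 0 < n%:R :> R by lra.
(* [L] is a lower bound for [s / d], and [x] an upper bound for [d * kap3]. *)
have core (L x c : R) : 0 < L -> L <= 15 * ln d%:R -> d%:R * kap3 R d <= x ->
   L^-1 + 1000^-1 + (x + 250^-1) * (200 / 199) <= c ^+ 2 ->
   k%:R / s%:R + k%:R / n%:R +
      k%:R * ((kap3 R d + (250 * k%:R)^-1) * (200 / 199)) <= c ^+ 2.
  move=> L0 Ll xl /(le_trans _); apply; apply: lerD; first apply: lerD.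
  - rewrite ler_pdivrMr// -(ler_pM2l L0) mulrA mulfV ?gt_eqF// mul1r.
    apply: le_trans sl; apply: (@le_trans _ _ (L * d%:R)); first by rewrite ler_wpM2l// ltW.
    by rewrite mulrAC ler_wpM2r// ltW.
  - by rewrite ler_pdivrMr//; lra.
  - have -> : k%:R * ((kap3 R d + (250 * k%:R)^-1) * (200 / 199)) =
      (k%:R * kap3 R d + 250^-1) * (200 / 199) :> R by field; rewrite gt_eqF.
    have := ler_wpM2r (kap3_ge0 R d) kdR; lra.
have thr (c : R) : d%:R + 1 <= 2 * (1 - c) * (6 * k%:R + 3) ->
    (d%:R + 1) / (6 * k%:R + 3) <= 2 * (1 - c).
  by move=> h; rewrite ler_pdivrMr//; lra.
have [d7|d7] := leqP 7 d.
  exists (1 / 2); split; first by lra.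
    apply: (core 20 (3 / 20)) => //; last by lra.
      have := @ln_pow2_le 2 d (leq_trans (isT : 4 <= 7)%N d7); lra.
    exact: kap3_small.
  apply: thr; have : d%:R + 1 <= (6 * k + 2)%:R :> R by rewrite natr1 ler_nat.
  by rewrite natrD natrM; lra.
have al := a_le; have a_sq := a2.
have [d4|d4] := leqP 4 d.
  exists (18 / 25); split; first by lra.
    apply: (core 20 (9 / 20)) => //; last by lra.
      have := @ln_pow2_le 2 d d4; lra.
    move: d7 d4; rewrite /kap3 -/a; clear -al a_sq.
    case: d => [|[|[|[|[|[|[|d]]]]]]]// _ _.
    - have -> : a ^+ 4 = (a * a) * (a * a) by ring.
      by rewrite a_sq; lra.
    - have -> : a ^+ 5 = (a * a) * (a * a) * a by ring.
      by rewrite a_sq; lra.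
    - have -> : a ^+ 6 = (a * a) * (a * a) * (a * a) by ring.
      by rewrite a_sq; lra.
  apply: thr; have : d%:R <= 6 :> R by rewrite ler_nat.
  lra.
have l10 : 10 <= 15 * ln d%:R :> R by have := @ln_pow2_le 1 d d2; lra.
have [d3|d3] := leqP 3 d.
  have dE : d = 3%N by apply/eqP; rewrite eqn_leq d3 andbT -ltnS.
  exists (17 / 20); split; first by lra.
    apply: (core 10 (867 / 1500)) => //; last by lra.
    rewrite /kap3 -/a dE; have -> : a ^+ 3 = (a * a) * a by ring.
    by rewrite a_sq; lra.
  by apply: thr; rewrite dE; lra.
have dE : d = 2%N by apply/eqP; rewrite eqn_leq d2 andbT -ltnS.
exists (9 / 10); split; first by lra.
  apply: (core 10 (2 / 3)) => //; last by lra.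
  by rewrite /kap3 -/a dE expr2 a_sq; lra.
by apply: thr; rewrite dE; lra.
Qed.
End numerics.

(** * The good event *)

Section good_event.
Variables (R : realType) (n d k : nat) (mu : 'I_k -> 'rV[R]_d).
Hypotheses (d_gt0 : (0 < d)%N) (k_gt0 : (0 < k)%N) (kd : (k <= d)%N) (n_ge2 : (2 <= n)%N).
Local Notation I := ('I_n * 'I_d)%type.

Let dR : 0 < d%:R :> R. Proof. by rewrite ltr0n. Qed.
Let kR : 0 < k%:R :> R. Proof. by rewrite ltr0n. Qed.
Let n_gt0 : (0 < n)%N. Proof. exact: ltnW. Qed.
Let nR : 0 < n%:R :> R. Proof. by rewrite ltr0n. Qed.

Lemma gboundD (M M' : (I -> R) -> R) be be' : gbound M be -> gbound M' be' ->
  gbound (fun f : I -> R => M f + M' f) (be + be').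
Proof.
move=> H H'.
have -> : be + be' = \sum_(b : bool) (if b then be else be') by rewrite big_bool.
apply: (@gbound_ext _ _ (fun f => \sum_(b : bool) (if b then M f else M' f))).
  by move=> f; rewrite big_bool.
apply: (gbound_sum (M := fun b f => if b then M f else M' f)) => b _.
by case: b.
Qed.

Lemma gbound_sqsum (w : 'I_n -> R) : (forall i, 2 * w i < 1) ->
  gbound (fun f : I -> R => expR (\sum_i w i * sqnorm (noise_row f i)))
    (\prod_i (Num.sqrt (1 - 2 * w i))^-1 ^+ d).
Proof.
move=> w1.
have D (c : I) : 1 + 2 * - w c.1 * \sum_(a | a == c) (1 : R) ^+ 2 = 1 - 2 * w c.1.
  by rewrite big_pred1_eq expr1n mulr1 mulrN.
have := @gbound_quad R I I id (fun=> 1) (fun c => - w c.1) (fun=> 0).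
move=> /(_ _ _)/=.
have h1 (c : I) : 0 < 1 + 2 * - w c.1 * \sum_(a | a == c) (1 : R) ^+ 2.
  by rewrite D subr_gt0.
move=> /(_ h1 (fun c => or_intror (erefl _))) H.
have -> : \prod_i (Num.sqrt (1 - 2 * w i))^-1 ^+ d =
    \prod_(c : I) (Num.sqrt (1 + 2 * - w c.1 * \sum_(a | a == c) (1 : R) ^+ 2))^-1.
  under [RHS]eq_bigr do rewrite D.
  rewrite -(pair_big predT predT (fun i (j : 'I_d) => (Num.sqrt (1 - 2 * w i))^-1))/=.
  by apply: eq_bigr => i _; rewrite prodr_const card_ord.
apply: gbound_ext H => f; congr expR.
rewrite -sumrN -(pair_big predT predT (fun i j => - (- w i * (0 + \sum_(a | a == (i, j)) 1 * f a) ^+ 2)))/=.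
apply: eq_bigr => i _; rewrite /sqnorm mulr_sumr; apply: eq_bigr => j _.
by rewrite big_pred1_eq mxE add0r mul1r mulNr opprK.
Qed.

Definition tot_sq (f : I -> R) : R := \sum_i sqnorm (noise_row f i).

(** Exponent [1/3] costs [sqrt 3 <= exp (2/3)] per coordinate, and the union over [n] points costs
    [n * n^-2]. This is the origin of the [1/n] in the theorem and of the radius
    [2 (d + 3 log n)]. *)
Lemma gbound_max_sq : gbound (fun f : I -> R => \sum_i expR (- (2 / 3 * d%:R + 2 * ln n%:R)) *
    expR (3^-1 * sqnorm (noise_row f i))) n%:R^-1.
Proof.
have H (i : 'I_n) : gbound (fun f : I -> R => expR (3^-1 * sqnorm (noise_row f i))) (expR (2 / 3 * d%:R)).
  have w1 (i' : 'I_n) : 2 * (if i' == i then 3^-1 else 0) < 1 :> R by case: ifP => _; lra.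
  have := gbound_sqsum w1; rewrite (bigD1 i)//= eqxx big1 ?mulr1; last first.
    by move=> i' /negbTE ->; rewrite mulr0 subr0 sqrtr1 invr1 expr1n.
  move=> G.
  apply: (@gbound_le _ _ _ ((Num.sqrt (1 - 2 * 3^-1))^-1 ^+ d)); last first.
    apply: gbound_ext G => f; congr expR.
    by rewrite (bigD1 i)//= eqxx big1 ?addr0// => i' /negbTE ->; rewrite mul0r.
  rewrite [2 / 3 * _]mulrC expRM_natl lerXn2r ?nnegrE ?invr_ge0 ?sqrtr_ge0 ?expR_ge0//.
  have q0 : 0 < Num.sqrt (1 - 2 * 3^-1) :> R by rewrite sqrtr_gt0; lra.
  rewrite -[leLHS]mul1r ler_pdivrMr//.
  have e0 := expR_gt0 (2 / 3 : R).
  rewrite -(@ler_pXn2r _ 2)// ?nnegrE ?ler01 ?mulr_ge0 ?sqrtr_ge0 ?(ltW e0)//.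
  rewrite exprMn sqr_sqrtr; last by lra.
  rewrite -expRM_natl expr1n.
  have -> : 2 * (2 / 3) = 4 / 3 :> R by field.
  have e43 : 0 <= 4 / 3 :> R by lra.
  have := expR_ge_quad e43; lra.
apply: gbound_le (gbound_sum (P := predT) (fun i _ => gbound_scale (expR_ge0 _) (H i))).
have -> : n%:R^-1 = expR (- ln n%:R) :> R by rewrite expRN lnK ?posrE.
rewrite sumr_const card_ord -expRD -[leLHS]mulr_natl -[X in X * _](@lnK _ n%:R) ?posrE//.
by rewrite -expRD ler_expR; lra.
Qed.

(** Both tails of a chi-square variable, [sg] being the side. The size [1 / (4 d)] of the exponent
    minimises [2 d th^2 - th]. *)
Lemma gbound_tot_sq (sg : R) : sg ^+ 2 = 1 ->
  gbound (fun f : I -> R => expR (- (sg / (4 * d%:R) * (n%:R * (d%:R + sg)))) *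
     expR (sg / (4 * d%:R) * tot_sq f)) (expR (- (n%:R / (8 * d%:R)))).
Proof.
move=> sg2; set th := sg / _.
have d1 : 1 <= d%:R :> R by rewrite ler1n.
have thb : - 4^-1 <= th <= 4^-1.
  have i0 : 0 < (4 * d%:R)^-1 :> R by rewrite invr_gt0 mulr_gt0.
  have i1 : (4 * d%:R)^-1 <= 4^-1 :> R by rewrite lef_pV2 ?posrE ?mulr_gt0//; lra.
  have s1 : -1 <= sg <= 1 by apply/andP; split; nra.
  by rewrite /th; move: i0 i1 s1; set i := _^-1 => ? ? /andP[? ?]; apply/andP; split; nra.
have /andP[th1 th2] := thb.
have w1 (i : 'I_n) : 2 * th < 1 by lra.
have G := gbound_sqsum w1; clear w1.
have G1 : gbound (fun f : I -> R => expR (th * tot_sq f)) (expR (th + 2 * th ^+ 2) ^+ (n * d)).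
  apply: (@gbound_le _ _ _ (\prod_(i < n) (Num.sqrt (1 - 2 * th))^-1 ^+ d)); last first.
    by apply: gbound_ext G => f; rewrite /tot_sq mulr_sumr.
  rewrite prodr_const card_ord -exprM mulnC lerXn2r ?nnegrE ?invr_ge0 ?sqrtr_ge0 ?expR_ge0//.
  have x2 : - 2^-1 <= - (2 * th) by lra.
  have := invsqrt_le_expR x2 => /le_trans; apply; rewrite ler_expR; lra.
apply: gbound_le (gbound_scale (expR_ge0 _) G1).
rewrite -expRM_natl -expRD ler_expR natrM le_eqVlt; apply/orP; left; apply/eqP.
have t2 : th ^+ 2 = (16 * d%:R ^+ 2)^-1.
  by rewrite /th expr_div_n sg2 div1r exprMn; congr (_ * _)^-1; ring.
have ts : th * sg = (4 * d%:R)^-1 by rewrite /th mulrAC -expr2 sg2 mul1r.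
have -> : - (th * (n%:R * (d%:R + sg))) = - (n%:R * th * d%:R) - n%:R * (th * sg) by ring.
by rewrite ts t2; field; rewrite gt_eqF.
Qed.

Definition net_level (q : nat) : R :=
  (n %/ q)%:R * (13 / 8 * d%:R + 15 / 128 * q%:R + 640^-1 * (q%:R + d%:R)).

(** All sizes [q] at once: the blocks cover at least half of the [n] points, so the slack
    [(q + d) / 640] per block gains at least [n / 1280] in each exponent. *)
Lemma gbound_net : gbound (fun f : I -> R => \sum_(q < n) expR (- net_level q.+1) * netM q.+1 f)
  (n%:R * expR (- (n%:R / (2 * 10 ^+ 3)))).
Proof.
have H (q : 'I_n) := gbound_scale (expR_ge0 (- net_level q.+1)) (gbound_netM R n d_gt0 (ltn0Sn q)).
apply: gbound_le (gbound_sum (P := predT) (fun q _ => H q)).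
apply: (@le_trans _ _ (\sum_(q < n) expR (- (n%:R / (2 * 10 ^+ 3))))); last first.
  by rewrite sumr_const card_ord -[leLHS]mulr_natl.
apply: ler_sum => q _; rewrite -expRD ler_expR /net_level.
have B1 : (1 <= n %/ q.+1)%N by rewrite divn_gt0.
have : (n <= 2 * ((n %/ q.+1) * q.+1))%N.
  rewrite {1}(divn_eq n q.+1) mul2n -addnn leq_add2l.
  by apply: leq_trans (ltnW (ltn_pmod n (ltn0Sn q))) _; rewrite leq_pmull.
rewrite -(ler_nat R) !natrM.
have : 0 <= (n %/ q.+1)%:R :> R by [].
move: (n %/ q.+1)%:R (q.+1)%:R (ltW dR) => B x d0 B0 h.
have := mulr_ge0 B0 d0; have := ltW nR; lra.
Qed.

Let lt_even (b : 'I_(n./2)) : (b.*2 < n)%N.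
Proof.
apply: (@leq_trans (n./2).*2); first by rewrite ltn_double.
by rewrite -[leqRHS]odd_double_half leq_addl.
Qed.
Let lt_odd (b : 'I_(n./2)) : (b.*2.+1 < n)%N.
Proof.
apply: (@leq_trans (n./2).*2); first by rewrite -doubleS leq_double.
by rewrite -[leqRHS]odd_double_half leq_addl.
Qed.
Definition pair0 (b : 'I_(n./2)) : 'I_n := Ordinal (lt_even b).
Definition pair1 (b : 'I_(n./2)) : 'I_n := Ordinal (lt_odd b).

Lemma pair01 b b' : pair0 b != pair1 b'.
Proof. by apply/eqP => /(congr1 (fun i : 'I_n => odd i)); rewrite /= !odd_double. Qed.

(** [1/200] is the parameter [x] of the pair statistic. The slack [1 / (250 k)] becomes a constant
    once the kernel mean is multiplied by [k]. *)
Definition pair_level : R := 200^-1 * kap3 R d + 200^-1 * (250 * k%:R)^-1.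

Lemma gbound_pair (tau : 'I_n -> 'I_k) :
  gbound (fun f : I -> R => expR (- ((n./2)%:R * pair_level)) * pairM mu tau 200^-1 pair0 pair1 f)
    (expR (- (n%:R / (15 * 10 ^+ 4 * d%:R)))).
Proof.
have x0 : 0 <= 200^-1 :> R by rewrite invr_ge0.
have i0 : injective pair0 by move=> b b' /(congr1 val)/= /double_inj /val_inj.
have i1 : injective pair1 by move=> b b' /(congr1 val)/= [] /double_inj /val_inj.
apply: gbound_le (gbound_scale (expR_ge0 _) (gbound_pairM mu tau x0 i0 i1 pair01)).
rewrite -expRD ler_expR /pair_level.
have Bn : n%:R <= 3 * (n./2)%:R :> R.
  rewrite -natrM ler_nat -{1}[n]odd_double_half mulSn mul2n leq_add2r.
  have : (0 < n./2)%N by rewrite half_gt0.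
  by case: (odd n).
have -> : n%:R / (15 * 10 ^+ 4 * d%:R) = n%:R / 3 * (200^-1 * (250 * d%:R)^-1) :> R.
  by field; rewrite gt_eqF.
have : (250 * d%:R)^-1 <= (250 * k%:R)^-1 :> R.
  by rewrite lef_pV2 ?posrE ?mulr_gt0// ler_pM2l// ler_nat.
have : 0 <= (250 * d%:R)^-1 :> R by rewrite invr_ge0 mulr_ge0.
set y := (250 * d%:R)^-1; set z := (250 * k%:R)^-1 => y0 yz.
have : n%:R / 3 * y <= (n./2)%:R * z by apply: ler_pM => //; lra.
lra.
Qed.

(** Each summand reaches 1 when its bound fails, so a single application of Markov's inequality
    covers all failures. *)
Definition good_stat (tau : 'I_n -> 'I_k) (f : I -> R) : R :=
  (\sum_i expR (- (2 / 3 * d%:R + 2 * ln n%:R)) * expR (3^-1 * sqnorm (noise_row f i)))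
  + expR (- (1 / (4 * d%:R) * (n%:R * (d%:R + 1)))) * expR (1 / (4 * d%:R) * tot_sq f)
  + expR (- (-1 / (4 * d%:R) * (n%:R * (d%:R - 1)))) * expR (-1 / (4 * d%:R) * tot_sq f)
  + (\sum_(q < n) expR (- net_level q.+1) * netM q.+1 f)
  + expR (- ((n./2)%:R * pair_level)) * pairM mu tau 200^-1 pair0 pair1 f.

(** The last four terms are each at most [exp (- u)]. As [u >= 4], the factor [4 <= exp 2] is
    absorbed into [exp (- u / 2)], still below the claimed exponential. *)
Lemma gbound_good_stat tau (K : R) : 10 ^+ 6 <= K -> K * (d%:R + ln n%:R) <= n%:R ->
  gbound (good_stat tau) (n%:R^-1 + expR (- (K ^- 2 * n%:R / (d%:R + ln n%:R) ^+ 2))).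
Proof.
move=> K6 Kn.
have sq1 : 1 ^+ 2 = 1 :> R by rewrite expr1n.
have sqN1 : (-1) ^+ 2 = 1 :> R by rewrite sqrrN expr1n.
apply: gbound_le (gboundD (gboundD (gboundD (gboundD gbound_max_sq (gbound_tot_sq sq1))
  (gbound_tot_sq sqN1)) gbound_net) (gbound_pair tau)).
rewrite -!addrA lerD2l.
have d1 : 1 <= d%:R :> R by rewrite ler1n.
have l0 : 0 <= ln n%:R :> R by rewrite ln_ge0// ler1n.
set a := d%:R + ln n%:R in Kn *.
have a0 : 0 < a by rewrite /a; lra.
have da : d%:R <= a by rewrite /a; lra.
have K0 : 0 < K by apply: lt_le_trans K6; rewrite exprn_gt0.
have n6 : 10 ^+ 6 * a <= n%:R by apply: le_trans Kn; rewrite ler_wpM2r// ltW.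
set u := n%:R / (15 * 10 ^+ 4 * d%:R).
have md0 : 0 < 15 * 10 ^+ 4 * d%:R :> R by lra.
have u4 : 4 <= u by rewrite ler_pdivlMr//; lra.
have e1 : expR (- (n%:R / (8 * d%:R))) <= expR (- u).
  rewrite ler_expR lerN2; apply: ler_wpM2l; first exact: ltW.
  by rewrite lef_pV2 ?posrE//; lra.
have e2 : n%:R * expR (- (n%:R / (2 * 10 ^+ 3))) <= expR (- u).
  rewrite -[X in X * _](@lnK _ n%:R) ?posrE// -expRD ler_expR.
  have un : u <= n%:R / (15 * 10 ^+ 4).
    by apply: ler_wpM2l; [exact: ltW|rewrite lef_pV2 ?posrE//; lra].
  have la : ln n%:R <= a by rewrite /a; lra.
  lra.
apply: (@le_trans _ _ (4 * expR (- u))); first by move: e1 e2; set z := expR (- u); lra.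
have E4 : 4 <= expR 2 :> R by have := expR_ge_quad (ler0n R 2); lra.
apply: (@le_trans _ _ (expR 2 * expR (- u))).
  by rewrite ler_wpM2r// expR_ge0.
rewrite -expRD ler_expR.
suff : K ^- 2 * n%:R / a ^+ 2 <= u / 2 by lra.
have -> : K ^- 2 * n%:R / a ^+ 2 = n%:R * ((K * a) ^+ 2)^-1.
  by field; rewrite !gt_eqF.
have -> : u / 2 = n%:R * (3 * 10 ^+ 5 * d%:R)^-1 by rewrite /u; field; rewrite gt_eqF.
apply: ler_wpM2l; first exact: ltW.
have Ka : 10 ^+ 6 * d%:R <= K * a by apply: ler_pM => //; rewrite ?exprn_ge0// ltW.
have Ka1 : 10 ^+ 6 <= K * a by lra.
have p1 : 0 < 3 * 10 ^+ 5 * d%:R :> R by lra.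
have p2 : 0 < (K * a) ^+ 2 by rewrite exprn_gt0// mulr_gt0.
rewrite lef_pV2 ?posrE//.
have h0 : 0 <= K * a - 10 ^+ 6 * d%:R by lra.
have h1 : 0 <= K * a by lra.
by nra.
Qed.

Lemma scaled_expR_lt1 (x y : R) : expR (- x) * expR y < 1 -> y < x.
Proof. by rewrite -expRD expR_lt1 addrC subr_lt0. Qed.

Lemma scaled_lt1 (x y : R) : expR (- x) * y < 1 -> y <= expR x.
Proof. by rewrite expRN mulrC ltr_pdivrMr ?expR_gt0// mul1r => /ltW. Qed.

Lemma good_stat_lt1 tau f : good_stat tau f < 1 ->
  [/\ forall i, sqnorm (noise_row f i) <= 2 * (d%:R + 3 * ln n%:R),
      d%:R - 1 <= n%:R^-1 * tot_sq f <= d%:R + 1,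
      forall q, (0 < q <= n)%N -> netM q f <= expR (net_level q) &
      forall a b : 'I_n, a != b -> avg (fun p : {perm 'I_n} => kern mu tau f (p a) (p b)) <=
        (kap3 R d + (250 * k%:R)^-1) * (200 / 199)].
Proof.
have N0 q : (0 < q)%N -> 0 <= netM q f by move=> q0; have [_ p _] := gbound_netM R n d_gt0 q0; exact: p.
have [_ p1 _] := gbound_max_sq; have [_ p4 _] := gbound_net; have [_ p5 _] := gbound_pair tau.
have := p1 f; have := p4 f; have := p5 f; rewrite /good_stat.
set t1 := \sum_i (expR (- (2 / 3 * d%:R + 2 * ln n%:R)) * expR (3^-1 * sqnorm (noise_row f i))).
set t4 := \sum_(q < n) (expR (- net_level q.+1) * netM q.+1 f); set t5 := _ * pairM _ _ _ _ _ _.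
set t2 := expR (- (1 / _ * _)) * _; set t3 := expR (- (-1 / _ * _)) * _.
have t2p : 0 <= t2 by rewrite mulr_ge0 ?expR_ge0.
have t3p : 0 <= t3 by rewrite mulr_ge0 ?expR_ge0.
move=> q5 q4 q1 lt1.
have l1 : t1 < 1 by lra.
have l2 : t2 < 1 by lra.
have l3 : t3 < 1 by lra.
have l4 : t4 < 1 by lra.
have l5 : t5 < 1 by lra.
have id0 : 0 < (4 * d%:R)^-1 :> R by rewrite invr_gt0 mulr_gt0.
split.
- move=> i; have : expR (- (2 / 3 * d%:R + 2 * ln n%:R)) * expR (3^-1 * sqnorm (noise_row f i)) < 1.
    apply: le_lt_trans l1; rewrite /t1 (bigD1 i)//= lerDl; apply: sumr_ge0 => j _.
    by rewrite mulr_ge0 ?expR_ge0.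
  by move=> /scaled_expR_lt1; lra.
- move: l2 l3 => /scaled_expR_lt1 h2 /scaled_expR_lt1.
  rewrite !mulN1r !mulNr ltrN2 => h3; move: h2; rewrite div1r.
  rewrite !ltr_pM2l// in h3 * => h2.
  rewrite mulrC ler_pdivlMr// ler_pdivrMr// ![_ * n%:R]mulrC.
  by rewrite (ltW h2) (ltW h3).
- move=> q /andP[q0 qn]; apply: scaled_lt1; apply: le_lt_trans l4.
  have qn' : (q.-1 < n)%N by rewrite prednK.
  rewrite /t4 (bigD1 (Ordinal qn'))//= prednK// lerDl; apply: sumr_ge0 => j _.
  by rewrite mulr_ge0 ?expR_ge0// N0.
- move=> a b ab; have x0 : 0 <= 200^-1 :> R by rewrite invr_ge0.
  have B0 : (0 < n./2)%N by rewrite half_gt0.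
  (* [200/199] is [x / (x - x^2)] at [x = 1/200]. *)
  have := pairM_bound x0 B0 pair01 ab (scaled_lt1 l5); rewrite /pair_level.
  by move: (avg _) => A; lra.
Qed.
End good_event.

Lemma good_sample_bound (R : realType) (n d k s : nat) (mu : 'I_k -> 'rV[R]_d)
    (tau : 'I_n -> 'I_k) (K : R) (f : 'I_n * 'I_d -> R) :
  (2 <= k)%N -> (k <= d)%N -> (d <= s)%N -> (s <= n)%N ->
  15 * d%:R * ln (d%:R) <= (s%:R : R) ->
  10 ^+ 6 <= K -> 10 ^+ 4 * ((expR 20 - 1) ^+ 2 * expR (expR 20 - 1)) <= K ->
  K * d%:R <= n%:R ->
  d%:R - 1 <= n%:R^-1 * tot_sq f <= d%:R + 1 ->
  (forall q, (0 < q <= n)%N -> netM q f <= expR (net_level R n d q)) ->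
  (forall a b : 'I_n, a != b -> avg (fun p : {perm 'I_n} => kern mu tau f (p a) (p b)) <=
        (kap3 R d + (250 * k%:R)^-1) * (200 / 199)) ->
  (d%:R - 6 * k%:R - 2) / (d%:R + 1) * IP (sample mu tau f) k <=
    avg (sub_sdp k (sample mu tau f) (s := s)) - 1.
Proof.
move=> k2 kd ds sn sl K6 Kc Kn /andP[lo hi] net ker.
have d0 : (0 < d)%N by apply: leq_trans kd; exact: ltnW.
have k0 : (0 < k)%N by exact: ltnW.
have kn : (k <= n)%N by apply: leq_trans sn; apply: leq_trans ds.
have ks : (k <= s)%N by apply: leq_trans ds.
have dR : 0 < d%:R :> R by rewrite ltr0n.
have kR : 0 < k%:R :> R by rewrite ltr0n.
have d1 : 0 < d%:R + 1 :> R by lra.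
set S := avg _.
have IPS : S <= IP (sample mu tau f) k by exact: avg_sub_sdp_le_IP.
have [dk|dk] := leqP (6 * k + 2) d.
  have d8 : (8 <= d)%N.
    by apply: leq_trans dk; apply: (@leq_trans (6 * 1 + 2)) => //; rewrite leq_add2r leq_mul2l.
  have mm := avg_max_mult_le d8 ds sn sl Kc Kn.
  have hS : n%:R^-1 * tot_sq f - 6 * k%:R <= S by exact: avg_sub_sdp_spectral.
  have hI : IP (sample mu tau f) k <= n%:R^-1 * tot_sq f.
    have := @IP_le_assign R d n k _ tau mu (sample mu tau f).
    have -> : \sum_i sqnorm (sample mu tau f i - mu (tau i)) = tot_sq f.
      by apply: eq_bigr => i _; rewrite /sample addrC addKr.
    by apply; rewrite kn andbT (leq_trans (max_card _))// card_ord.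
  have : (6 * k + 2)%:R <= d%:R :> R by rewrite ler_nat.
  rewrite natrD natrM => c0.
  have b0 : 0 <= (d%:R - 6 * k%:R - 2) / (d%:R + 1) :> R by rewrite divr_ge0; lra.
  (* The product is [(d - 1) - 6k - 1], which is why the noise energy must be within 1 of [d] on
     both sides. *)
  apply: (@le_trans _ _ ((d%:R - 6 * k%:R - 2) / (d%:R + 1) * (d%:R + 1))).
    by rewrite ler_wpM2l//; lra.
  by rewrite divfK ?gt_eqF//; lra.
have nl : 1000 * d%:R <= n%:R :> R.
  apply: le_trans Kn; apply: ler_wpM2r; first exact: ltW.
  by apply: le_trans K6; lra.
have [c [c0 pc thr]] := kernel_threshold k2 kd ds sn sl nl dk.
have hS : 2 * (1 - c) <= S by exact: (avg_sub_sdp_kernel k2 kd ds sn c0 ker pc).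
have {}hS := le_trans thr hS.
have : d%:R + 1 <= (6 * k + 2)%:R :> R by rewrite natr1 ler_nat.
rewrite natrD natrM => dk'.
(* Multiplied by [d + 1] and with [IP >= S], the claim becomes [(6k+3) * S >= d + 1], hence the
   threshold. *)
rewrite mulrAC ler_pdivrMr//.
move: hS; rewrite ler_pdivrMr; last by lra.
have := IPS; set P := IP _ _ => PS hS.
have : (6 * k%:R + 2 - d%:R) * S <= (6 * k%:R + 2 - d%:R) * P by rewrite ler_wpM2l//; lra.
lra.
Qed.

(** [(8 A)^2 / (2 * 128 A^2) = 1/4], where the constant 128 is spent. *)
Lemma hoeffding_radius_le (R : realType) (b A L l : R) : 0 <= b <= 8 * A -> 0 <= L ->
  0 < l -> 128 * A ^+ 2 * L <= l -> Num.sqrt (b ^+ 2 / (2 * l) * L) <= 2^-1.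
Proof.
move=> /andP[b0 bA] L0 l0 Al.
have h : b ^+ 2 / (2 * l) * L <= 2^-1 ^+ 2.
  rewrite mulrAC ler_pdivrMr ?mulr_gt0//.
  have : b ^+ 2 * L <= (8 * A) ^+ 2 * L by rewrite ler_wpM2r// lerXn2r// nnegrE; lra.
  have -> : (8 * A) ^+ 2 * L = 64 * A ^+ 2 * L by ring.
  lra.
apply: le_trans (ler_wsqrtr h) _.
by rewrite sqrtr_sqr ger0_norm// invr_ge0.
Qed.

Theorem theorem4 (R : realType) :
  (* (a) *)
  (forall (n d k s l : nat) (X : 'I_n -> 'rV[R]_d) (eps : R),
     (2 <= k <= s)%N -> (k <= n)%N -> (0 < l)%N -> 0 < eps ->
     forall c : 'I_k -> 'I_n, kpp_run X c ->
     1 - eps <= proc_prob n s l (fun J => BH s X c eps J <= IP X k))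
  /\
  (* (b) *)
  (exists C : R, 0 < C /\
   forall (n d k s l : nat) (mu : 'I_k -> 'rV[R]_d) (eps : R)
     (dsp : measure_display) (Omega : measurableType dsp)
     (P : probability Omega R)
     (T : 'I_n -> Omega -> 'I_k) (Z : 'I_n -> 'I_d -> Omega -> R),
     gmm_noise P T Z ->
     (2 <= k)%N -> (k <= d)%N -> (d <= s)%N -> (s <= n)%N -> 0 < eps ->
     15 * d%:R * ln (d%:R) <= (s%:R : R) ->
     128 * (d%:R + 3 * ln (n%:R)) ^+ 2 * ln (eps^-1) <= l%:R ->
     forall kpp : ('I_n -> 'rV[R]_d) -> 'I_k -> 'I_n,
     (forall X, kpp_run X (kpp X)) ->
     ((1 - (n%:R)^-1 - expR (- (C * n%:R / (d%:R + ln (n%:R)) ^+ 2)) - eps)%:E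
      <= \int[P]_w
           (proc_prob n s l
              (fun J =>
                 (d%:R - 6 * k%:R - 2) / (d%:R + 1) * IP (gmm_X mu T Z w) k
                 <= BH s (gmm_X mu T Z w) (kpp (gmm_X mu T Z w)) eps J))%:E)%E).
Proof.
split.
  move=> n d k s l X eps /andP[k2 ks] kn l0 e0 c _.
  exact: (BH_le_IP_prob _ (ltnW k2) ks kn).
(* The coefficient of [s^2 / n] in the multiplicity bound at [tau = 20]. *)
pose c' : R := (expR 20 - 1) ^+ 2 * expR (expR 20 - 1).
pose K : R := 10 ^+ 6 + 10 ^+ 4 * c'.
have c0 : 0 <= c' by rewrite mulr_ge0 ?expR_ge0// sqr_ge0.
have K6 : 10 ^+ 6 <= K by rewrite lerDl mulr_ge0// exprn_ge0.
have Kc : 10 ^+ 4 * c' <= K by rewrite lerDr exprn_ge0.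
have K0 : 0 < K by apply: lt_le_trans K6; rewrite exprn_gt0.
exists (K ^- 2); split; first by rewrite invr_gt0 exprn_gt0.
move=> n d k s l mu eps dsp Omega P T Z noise k2 kd ds sn e0 sl ll kpp run.
have k0 : (0 < k)%N by exact: ltnW.
have d0 : (0 < d)%N by exact: leq_trans kd.
have ks : (k <= s)%N by exact: leq_trans ds.
have kn : (k <= n)%N by exact: leq_trans sn.
have n2 : (2 <= n)%N by exact: leq_trans kn.
have n0 : (0 < n)%N by exact: ltnW.
have nR : 0 < n%:R :> R by rewrite ltr0n.
have d1 : 1 <= d%:R :> R by rewrite ler1n.
have l0 : 0 <= ln n%:R :> R by rewrite ln_ge0// ler1n.
set a := d%:R + ln n%:R.
have a0 : 0 < a by rewrite /a; lra.
set y := K ^- 2 * n%:R / a ^+ 2.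
have i0 : 0 <= n%:R^-1 :> R by rewrite invr_ge0 ltW.
have E0 := expR_ge0 (- y).
have trivial (x : R) (h : Omega -> R) : x <= 0 -> (forall w, 0 <= h w) ->
    (x%:E <= \int[P]_w (h w)%:E)%E.
  move=> x0 h0; apply: (@le_trans _ _ 0%E); first by rewrite lee_fin.
  by apply: integral_ge0 => w _; rewrite lee_fin.
have [e1|e1] := leP 1 eps.
  by apply: trivial => [|w]; [lra|exact: proc_prob_ge0].
(* Below this size [y = n / (K a)^2 <= 1/n], so [exp (- y) >= 1 - 1/n] and the claimed probability
   is at most 0. *)
have [nK|nK] := ltP n%:R (K * a).
  apply: trivial => [|w]; last exact: proc_prob_ge0.
  suff : y <= n%:R^-1 by have := expR_ge1Dx (- y); lra.
  have -> : y = n%:R / (K * a) ^+ 2 by rewrite /y; field; rewrite !gt_eqF.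
  rewrite ler_pdivrMr ?exprn_gt0 ?mulr_gt0// -(ler_pM2l nR) mulrA mulfV ?gt_eqF// mul1r.
  by rewrite -expr2 lerXn2r ?nnegrE ?ltW// mulr_gt0.
have L0 : 0 < ln eps^-1 by rewrite ln_gt0// invf_gt1.
have A0 : 0 < d%:R + 3 * ln n%:R :> R by lra.
have lR : 0 < l%:R :> R by apply: lt_le_trans ll; rewrite !mulr_gt0// exprn_gt0.
have Kd : K * d%:R <= n%:R.
  by apply: le_trans nK; rewrite ler_pM2l// /a; lra.
have -> : 1 - n%:R^-1 - expR (- y) - eps = 1 - (n%:R^-1 + expR (- y)) - eps by ring.
apply: (gmm_transfer noise (M := fun tau : {ffun 'I_n -> 'I_k} => good_stat mu tau)).
- by move=> tau; exact: gbound_good_stat.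
- exact: addr_ge0.
- by rewrite !ltW.
- by move=> w; exact: proc_prob_ge0.
move=> w; set f := fun a => Z a.1 a.2 w; set tau := [ffun i => T i w].
move=> /(good_stat_lt1 d0 k0 kd n2)[g1 g2 g3 g4].
have -> : gmm_X mu T Z w = sample mu tau f.
  by apply/funext => i; rewrite /gmm_X /sample ffunE.
apply: (BH_ge_prob k0 ks kn) => //; first by rewrite -(ltr0n R).
- by rewrite e0.
- apply: (@hoeffding_radius_le _ _ (d%:R + 3 * ln n%:R)) => //; last exact: ltW.
  rewrite kpp_b_ge0//=.
  have := kpp_b_le n0 k0 (run (sample mu tau f)) g1; rewrite -/(sample mu tau f).
  by set b := kpp_b _ _; lra.
- exact: (good_sample_bound k2 kd ds sn sl K6 Kc Kd g2 g3 g4).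
Qed.
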